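(* Let $\xi\in\mathcal{A}$, $K\in\mathbb{N}$, let $f:U^{\mathbb{N}}\to\mathbb{R}$ be bounded with $f((z_i)_{i\ge1})$ independent of $(z_i)_{i>K}$, and let $\epsilon>0$. Then $$\limsup_{\delta\to0}\limsup_{n\to\infty}\frac1n\log P_0\left(\left|\int f\,\mathrm{d}\bar\nu_{n,X}^\infty-\int f\,\mathrm{d}\bar\mu_\xi^\infty\right|>\epsilon\ \middle|\ \left|\tfrac{X_n}{n}-\xi\right|\le\delta\right)<0.$$
   Context: Nearest-neighbor RWRE on $\mathbb{Z}^d$, $U:=\{z:|z_1|+\cdots+|z_d|=1\}$, environments $\omega_x=(\pi(x,x+z))_{z\in U}$ under $\mathbb{P}$; quenched law $P_0^\omega$, averaged $P_0=\int P_0^\omega\,\mathrm{d}\mathbb{P}$, expectation $E_0$; $Z_i:=X_i-X_{i-1}$. Assumptions: (A1) $\mathbb{P}$ product measure; (A2) $\mathbb{P}(\pi(0,z)\ge c_1)=1$ for all $z$, some $c_1>0$; (A3) Kalikow's condition relative to a unit vector $\hat u$: $\inf_{\mathcal{G}}\inf_{x\in\mathcal{G}}\frac{\mathbb{E}[E_0^\omega[\sum_{k=0}^{t_{\mathcal{G}}}\mathbf 1_{X_k=x}]\sum_{z}\pi(x,x+z)\langle z,\hat u\rangle]}{E_0[\sum_{k=0}^{t_{\mathcal{G}}}\mathbf 1_{X_k=x}]}>0$ (over connected strict $\mathcal{G}\ni0$, $t_{\mathcal G}$ exit time). $\Lambda_a(\theta):=\lim_n\frac1n\log E_0[\mathrm{e}^{\langle\theta,X_n\rangle}]$.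 $D:=\inf\{k\ge0:\langle X_k,\hat u\rangle<\langle X_0,\hat u\rangle\}$; $\tau_1:=\inf\{j>0:\langle X_i,\hat u\rangle<\langle X_j,\hat u\rangle\le\langle X_k,\hat u\rangle\ \forall i<j<k\}$, $\tau_{m+1}:=\inf\{j>\tau_m:\text{same condition}\}$. Nestling: convex hull of the support of the law of $\sum_z\pi(0,z)z$ contains $0$. $c_3>0$ with $E_0[\mathrm{e}^{2c_3\tau_1}]<\infty$ (non-nestling), $c_4>0$ with $E_0[\sup_{1\le n\le\tau_1}\mathrm{e}^{c_4|X_n|}]<\infty$ (nestling); $\mathcal{C}:=\{|\theta|<c_3\}$ resp. $\{|\theta|<c_4,\Lambda_a(\theta)>0\}$; $\mathcal{A}:=\{\nabla\Lambda_a(\theta):\theta\in\mathcal{C}\}$, and for $\xi\in\mathcal{A}$ there is a unique $\theta\in\mathcal{C}$ with $\xi=\nabla\Lambda_a(\theta)$. $\bar\mu_\xi^\infty$ is the measure on $U^{\mathbb{N}}$ with $\int f\,\mathrm{d}\bar\mu_\xi^\infty=\frac{E_0[\sum_{j=0}^{\tau_1-1}f((Z_{j+i})_{i\ge1})\mathrm{e}^{\langle\theta,X_{\tau_K}\rangle-\Lambda_a(\theta)\tau_K}\mid D=\infty]}{E_0[\tau_1\mathrm{e}^{\langle\theta,X_{\tau_1}\rangle-\Lambda_a(\theta)\tau_1}\mid D=\infty]}$ for every $K$ and bounded $f$ depending only on $(z_i)_{i\le K}$. $\bar\nu_{n,X}^\infty:=\frac1n\sum_{j=0}^{n-1}\delta_{(Z_{j+i})_{i\ge1}}$.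 *)

(* Defs.v *)
From HB Require Import structures.
From mathcomp Require Import all_boot all_order all_algebra.
From mathcomp Require Import all_classical all_reals all_analysis.
Set Implicit Arguments. Unset Strict Implicit. Unset Printing Implicit Defensive.
Import Order.TTheory GRing.Theory Num.Theory.
Import numFieldNormedType.Exports.
Local Open Scope ring_scope.
Local Open Scope classical_set_scope.

Definition site (d : nat) := 'rV[int]_d.

(* U = {±e_i}; the step (i, true) is +e_i and (i, false) is -e_i. *)
Definition dir (d : nat) := ('I_d * bool)%type.

Definition vec (d : nat) (z : dir d) : site d :=
  (if z.2 then 1 else -1) *: delta_mx 0 z.1.

Definition toR (R : realType) (d : nat) (x : site d) : 'rV[R]_d :=
  \row_i ((x 0 i)%:~R).

Definition dotR (R : realType) (d : nat) (t v : 'rV[R]_d) : R :=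
  \sum_(i < d) t 0 i * v 0 i.

Definition enorm (R : realType) (d : nat) (v : 'rV[R]_d) : R :=
  Num.sqrt (\sum_(i < d) v 0 i ^+ 2).

Definition xpos (d n : nat) (s : n.-tuple (dir d)) (j : nat) : site d :=
  \sum_(i < n | (i < j)%N) vec (tnth s i).

Definition qpath (R : realType) (d : nat) (om : site d -> dir d -> R)
  (n : nat) (s : n.-tuple (dir d)) : R :=
  \prod_(i < n) om (xpos s i) (tnth s i).

Definition envcyl (R : realType) (d : nat) (T : Type)
  (pi : T -> site d -> dir d -> R) (S : seq (site d))
  (B : site d -> dir d -> set R) : set T :=
  [set w | forall x, x \in S -> forall z, B x z (pi w x z)].

(* the walk X_n = Z_1 + ... + Z_n, where Zs w i = Z_{i+1} *)
Definition walk (d : nat) (T : Type) (Zs : T -> nat -> dir d) (w : T) (n : nat)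
  : site d := \sum_(i < n) vec (Zs w i).

Definition nn_connected (d : nat) (G : set (site d)) : Prop :=
  forall x y, G x -> G y ->
    exists n (s : n.-tuple (dir d)),
      x + xpos s n = y /\ forall j : 'I_n.+1, G (x + xpos s j).

(* quenched P_0^om(X_k = x, k <= t_G)  (k <= t_G iff X_j in G for all j<k) *)
Definition qhit (R : realType) (d : nat) (om : site d -> dir d -> R)
  (G : set (site d)) (x : site d) (k : nat) : R :=
  \sum_(s : k.-tuple (dir d) |
          (xpos s k == x) && [forall j : 'I_k, `[< G (xpos s j) >]])
     qpath om s.

(* quenched Green function E_0^om[ sum_{k=0}^{t_G} 1_{X_k = x} ] *)
Definition qgreen (R : realType) (d : nat) (om : site d -> dir d -> R)
  (G : set (site d)) (x : site d) : \bar R :=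
  (\sum_(0 <= k <oo) (qhit om G x k)%:E)%E.

Definition udrift (R : realType) (d : nat) (om : site d -> dir d -> R)
  (u : 'rV[R]_d) (x : site d) : R :=
  \sum_(z : dir d) om x z * dotR (toR R (vec z)) u.

Definition Kalikow (R : realType) (d : nat) (dT : measure_display)
  (T : measurableType dT) (P : probability T R)
  (pi : T -> site d -> dir d -> R) (Zs : T -> nat -> dir d)
  (u : 'rV[R]_d) : Prop :=
  exists2 c : R, 0 < c &
    forall G : set (site d), G <> setT -> nn_connected G -> G 0 ->
    forall x, G x ->
      (c%:E * \int[P]_w
          (\sum_(0 <= k <oo)
             (((walk Zs w k == x) &&
               [forall j : 'I_k, `[< G (walk Zs w j) >]])%:R : R)%:E)
       <= \int[P]_w (qgreen (pi w) G x * (udrift (pi w) u x)%:E))%E.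

Definition drift0 (R : realType) (d : nat) (om : site d -> dir d -> R)
  : 'rV[R]_d := \sum_(z : dir d) om 0 z *: toR R (vec z).

Definition drift_support (R : realType) (d : nat) (dT : measure_display)
  (T : measurableType dT) (P : probability T R)
  (pi : T -> site d -> dir d -> R) : set 'rV[R]_d :=
  [set v | forall e : R, 0 < e ->
     (0 < P [set w | (enorm (drift0 (pi w) - v) < e)%R])%E].

Definition nestling (R : realType) (d : nat) (dT : measure_display)
  (T : measurableType dT) (P : probability T R)
  (pi : T -> site d -> dir d -> R) : Prop :=
  exists n (v : 'I_n -> 'rV[R]_d) (l : 'I_n -> R),
    [/\ forall i, drift_support P pi (v i),
        forall i, 0 <= l i,
        \sum_i l i = 1 &
        \sum_i l i *: v i = 0].

Definition hgt (R : realType) (d : nat) (T : Type) (Zs : T -> nat -> dir d)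
  (u : 'rV[R]_d) (w : T) (k : nat) : R := dotR (toR R (walk Zs w k)) u.

Definition Dinf (R : realType) (d : nat) (T : Type) (Zs : T -> nat -> dir d)
  (u : 'rV[R]_d) : set T :=
  [set w | forall k, hgt Zs u w 0 <= hgt Zs u w k].

Definition regen (R : realType) (d : nat) (T : Type) (Zs : T -> nat -> dir d)
  (u : 'rV[R]_d) (w : T) (j : nat) : Prop :=
  (forall i, (i < j)%N -> hgt Zs u w i < hgt Zs u w j) /\
  (forall k, (j < k)%N -> hgt Zs u w j <= hgt Zs u w k).

Definition next_regen (R : realType) (d : nat) (T : Type)
  (Zs : T -> nat -> dir d) (u : 'rV[R]_d) (w : T) (t : nat) : option nat :=
  if pselect (exists j, (t < j)%N /\ regen Zs u w j) then
    Some (xget 0%N [set j | [/\ (t < j)%N, regen Zs u w j &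
           forall i, (t < i)%N -> regen Zs u w i -> (j <= i)%N]])
  else None.

(* tau_m (tau_0 := 0); None encodes tau_m = oo *)
Fixpoint tau (R : realType) (d : nat) (T : Type) (Zs : T -> nat -> dir d)
  (u : 'rV[R]_d) (w : T) (m : nat) : option nat :=
  match m with
  | 0 => Some 0%N
  | m'.+1 => obind (next_regen Zs u w) (tau Zs u w m')
  end.

Definition Lambda_a (R : realType) (d : nat) (dT : measure_display)
  (T : measurableType dT) (P : probability T R) (Zs : T -> nat -> dir d)
  (t : 'rV[R]_d) : R :=
  limn ((fun n : nat =>
    ln (fine (\int[P]_w (expR (dotR t (toR R (walk Zs w n))))%:E)) / n%:R)
    : R^nat).

Definition nonnest_const (R : realType) (d : nat) (dT : measure_display)
  (T : measurableType dT) (P : probability T R) (Zs : T -> nat -> dir d)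
  (u : 'rV[R]_d) (c : R) : Prop :=
  (0 < c) /\
  (\int[P]_w (match tau Zs u w 1 with
              | Some t => (expR (2 * c * t%:R))%:E
              | None => +oo end) < +oo)%E.

Definition nest_const (R : realType) (d : nat) (dT : measure_display)
  (T : measurableType dT) (P : probability T R) (Zs : T -> nat -> dir d)
  (u : 'rV[R]_d) (c : R) : Prop :=
  (0 < c) /\
  (\int[P]_w ereal_sup
      [set (expR (c * enorm (toR R (walk Zs w n))))%:E | n in
         [set n | (1 <= n)%N /\
                  match tau Zs u w 1 with
                  | Some t => (n <= t)%N | None => True end]] < +oo)%E.

(* the set C (c plays the role of c_3 resp. c_4) *)
Definition Cset (R : realType) (d : nat) (dT : measure_display)
  (T : measurableType dT) (P : probability T R)
  (pi : T -> site d -> dir d -> R) (Zs : T -> nat -> dir d) (c : R)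
  : set 'rV[R]_d :=
  [set t | enorm t < c /\ (nestling P pi -> 0 < Lambda_a P Zs t)].

Definition is_grad (R : realType) (d : nat) (L : 'rV[R]_d -> R)
  (t xi : 'rV[R]_d) : Prop :=
  forall i : 'I_d, is_derive t (delta_mx 0 i : 'rV[R]_d) L (xi 0 i).

(* sequences (z_i)_{i>=1} are coded as s : nat -> dir d with s k = z_{k+1} *)

Definition nu_int (d : nat) (R : realType) (T : Type) (Zs : T -> nat -> dir d)
  (f : (nat -> dir d) -> R) (n : nat) (w : T) : R :=
  n%:R^-1 * \sum_(j < n) f (fun k => Zs w (j + k)%N).

Definition condE (R : realType) (dT : measure_display) (T : measurableType dT)
  (P : probability T R) (Y : T -> \bar R) (B : set T) : R :=
  fine (\int[P]_(w in B) Y w) / fine (P B).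

(* int f d mu_xi^oo, for f depending only on (z_i)_{i <= K} (K >= 1) *)
Definition mu_int (R : realType) (d : nat) (dT : measure_display)
  (T : measurableType dT) (P : probability T R) (Zs : T -> nat -> dir d)
  (u t : 'rV[R]_d) (f : (nat -> dir d) -> R) (K : nat) : R :=
  let L := Lambda_a P Zs t in
  condE P (fun w => match tau Zs u w 1, tau Zs u w K with
     | Some t1, Some tK =>
        ((\sum_(j < t1) f (fun k => Zs w (j + k)%N)) *
         expR (dotR t (toR R (walk Zs w tK)) - L * tK%:R))%:E
     | _, _ => 0%E end) (Dinf Zs u)
  / condE P (fun w => match tau Zs u w 1 with
     | Some t1 => (t1%:R * expR (dotR t (toR R (walk Zs w t1)) - L * t1%:R))%:E
     | None => 0%E end) (Dinf Zs u).

Definition condP (R : realType) (dT : measure_display) (T : measurableType dT)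
  (P : probability T R) (A B : set T) : \bar R :=
  (fine (P (A `&` B)) / fine (P B))%:E.

Definition limsup0 (R : realType) (g : R -> \bar R) : \bar R :=
  ereal_inf [set ereal_sup [set g x | x in [set x | 0 < x < e]]
            | e in [set e : R | 0 < e]].

(* Main.v *)
Require Import Defs.
From HB Require Import structures.
From mathcomp Require Import all_boot all_order all_algebra.
From mathcomp Require Import all_classical all_reals all_analysis measurable_realfun.
From mathcomp Require Import ring lra zify.
Import Order.TTheory GRing.Theory Num.Theory.
Import numFieldNormedType.Exports.
Local Open Scope ring_scope.
Local Open Scope classical_set_scope.
Set Implicit Arguments. Unset Strict Implicit. Unset Printing Implicit Defensive.

(** Cut the path at its regeneration times.  As the environment is a product measure,
    the probability of a finite trajectory factorises there, so that the path laws under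
    P_0 and under P_0 restricted to D = oo satisfy renewal equations whose kernel is the
    law of the trajectory between two regenerations.  Tilt this block law by
    e^(<theta,X> - lambda tau).  By convexity its total mass is 1 for exactly one lambda,
    and two-sided renewal bounds identify that lambda with the growth rate Lambda_a(theta)
    of E_0 e^<theta,X_n>.

    Under the tilted block law, the integral of f against mu_xi is the mean of the sum of
    f over a block divided by the mean block length.  Over superblocks of many blocks the
    sum of f - mu_xi(f) - eps has negative mean and small exponential moments, hence
    E_0 [e^(<theta,X_n> - n Lambda_a(theta)) e^(sigma (S_n f - n mu_xi(f)))] grows at most
    like e^(n sigma eps / 2), up to a linear factor, for a small sigma > 0: under the
    tilted law a deviation by eps is exponentially unlikely.  The tilted law concentrates
    X_n / n at xi, because Lambda_a is differentiable at theta, and near xi the density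
    e^<theta,X_n> is constant up to e^(n |theta| delta), so that it cancels in the
    conditional probability. *)

(** * Sums over words and renewal equations *)

(** No tilted probability measure is built. A tilt is a multiplicative function on words, and every
    law is a nonnegative weight on words with values in [\bar R], so that sums may be rearranged
    before they are known to be finite. The obstacle is that [f] reads up to [K] letters past the
    end of a block, hence the block sums of [f] are not independent. A cut costs at most [M K]; over
    a superblock of [l] blocks this fixed cost is beaten by a gain proportional to [l eps], which is
    why single blocks do not suffice. All exponential moments have one source: the tilted block sums
    are still finite at some [lam0 < Lambda_a(theta)], and the gap is the available moment of the
    block length. The unrestricted path has a first block with a law of its own, so that each bound
    is proved for the plain equation and carried over to the delayed one. The absolute value is
    handled by applying the one-sided bound to [f] and to [- f]. *)

Section word_sums.
Local Open Scope ereal_scope.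
Context {R : realType} {A : finType}.
Implicit Types (g h w : seq A -> \bar R) (n m : nat).

(** Recursion on the first letter rather than a sum over tuples: splitting a word at a given length
    then needs no casts. *)
Fixpoint wsum n g : \bar R :=
  if n is m.+1 then \sum_(z : A) wsum m (fun s => g (z :: s)) else g [::].

Definition csum g : \bar R := \sum_(0 <= n <oo) wsum n g.

Lemma wsum_ge0 n g : (forall s, 0 <= g s) -> 0 <= wsum n g.
Proof. by elim: n g => //= n IH g g0; apply: sume_ge0 => z _; exact: IH. Qed.

Lemma eq_wsum n g h : (forall s, size s = n -> g s = h s) -> wsum n g = wsum n h.
Proof.
elim: n g h => /= [|n IH] g h gh; first exact: gh.
by apply: eq_bigr => z _; apply: IH => s sn; apply: gh; rewrite /= sn.
Qed.

Lemma le_wsum n g h : (forall s, size s = n -> g s <= h s) -> wsum n g <= wsum n h.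
Proof.
elim: n g h => /= [|n IH] g h gh; first exact: gh.
by apply: lee_sum => z _; apply: IH => s sn; apply: gh; rewrite /= sn.
Qed.

Lemma wsum0 n g : (forall s, size s = n -> g s = 0) -> wsum n g = 0.
Proof.
elim: n g => /= [|n IH] g g0; first exact: g0.
by apply: big1 => z _; apply: IH => s sn; apply: g0; rewrite /= sn.
Qed.

Lemma wsumD n g h : wsum n (fun s => g s + h s) = wsum n g + wsum n h.
Proof.
elim: n g h => //= n IH g h.
by rewrite -big_split; apply: eq_bigr => z _; rewrite IH.
Qed.

Lemma wsumZl n c g : (forall s, 0 <= g s) ->
  wsum n (fun s => c * g s) = c * wsum n g.
Proof.
elim: n g => //= n IH g g0; rewrite ge0_sume_distrr; last first.
  by move=> z _; apply: wsum_ge0.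
by apply: eq_bigr => z _; rewrite IH.
Qed.

Lemma wsum_cat m n g :
  wsum (m + n) g = wsum m (fun a => wsum n (fun b => g (a ++ b))).
Proof. by elim: m g => //= m IH g; apply: eq_bigr => z _; rewrite IH. Qed.

Lemma wsum_sum (I : Type) (r : seq I) (Q : pred I) n (g : I -> seq A -> \bar R) :
  wsum n (fun s => \sum_(i <- r | Q i) g i s) = \sum_(i <- r | Q i) wsum n (g i).
Proof.
elim: n g => //= n IH g; rewrite exchange_big/=.
by apply: eq_bigr => z _; rewrite IH.
Qed.

Lemma wsum_series n (g : nat -> seq A -> \bar R) : (forall i s, 0 <= g i s) ->
  wsum n (fun s => \sum_(0 <= i <oo) g i s) = \sum_(0 <= i <oo) wsum n (g i).
Proof.
elim: n g => //= n IH g g0; rewrite nneseries_sum; last first.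
  by move=> z i _; apply: wsum_ge0.
by apply: eq_bigr => z _; rewrite IH.
Qed.

Lemma csum_ge0 g : (forall s, 0 <= g s) -> 0 <= csum g.
Proof. by move=> g0; apply: nneseries_ge0 => n _ _; exact: wsum_ge0. Qed.

Lemma eq_csum g h : g =1 h -> csum g = csum h.
Proof. by move=> gh; apply: eq_eseriesr => n _; apply: eq_wsum. Qed.

Lemma le_csum g h : (forall s, 0 <= g s) -> (forall s, g s <= h s) -> csum g <= csum h.
Proof.
move=> g0 gh; apply: lee_nneseries => [n _ _|n _]; first exact: wsum_ge0.
exact: le_wsum.
Qed.

Lemma csum0 g : (forall s, g s = 0) -> csum g = 0.
Proof. by move=> g0; apply: eseries0 => n _ _; apply: wsum0. Qed.

Lemma csumD g h : (forall s, 0 <= g s) -> (forall s, 0 <= h s) ->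
  csum (fun s => g s + h s) = csum g + csum h.
Proof.
move=> g0 h0; rewrite /csum -nneseriesD; last 2 first.
- by move=> n _ _; apply: wsum_ge0.
- by move=> n _ _; apply: wsum_ge0.
by apply: eq_eseriesr => n _; rewrite wsumD.
Qed.

Lemma le_wsum_csum n g : (forall s, 0 <= g s) -> wsum n g <= csum g.
Proof.
move=> g0; rewrite /csum (@nneseriesD1 _ _ n xpredT)//; last first.
  by move=> k _; apply: wsum_ge0.
by rewrite leeDl// nneseries_ge0// => k _ _; apply: wsum_ge0.
Qed.

Let csumZl_fin (c : R) g : (forall s, 0 <= g s) ->
  csum (fun s => c%:E * g s) = c%:E * csum g.
Proof.
move=> g0; rewrite /csum -nneseriesZl; last by move=> n _; apply: wsum_ge0.
by apply: eq_eseriesr => n _; rewrite wsumZl.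
Qed.

(** The factor may be [+oo], since block weights are extended reals. Either every layer [wsum n g]
    vanishes, or one positive layer already makes the left side infinite. *)
Lemma csumZl (c : \bar R) g : 0 <= c -> (forall s, 0 <= g s) ->
  csum (fun s => c * g s) = c * csum g.
Proof.
move=> + g0; case: c => [c _||//]; first exact: csumZl_fin.
move=> _; have := csum_ge0 g0; rewrite le_eqVlt => /predU1P[g_eq0|g_gt0].
  rewrite -g_eq0 mule0 -[in RHS](mule0 0%:E) [in RHS]g_eq0 -csumZl_fin//.
  apply: eq_eseriesr => n _; rewrite !wsumZl// (_ : wsum n g = 0) ?mule0//.
  by apply/eqP; rewrite eq_le wsum_ge0// g_eq0 le_wsum_csum.
rewrite gt0_mulye//; apply/eqP; rewrite -leye_eq.
have [gn|gn] := pselect (exists n, 0 < wsum n g); last first.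
  suff : csum g = 0 by move=> g_eq0; rewrite g_eq0 ltxx in g_gt0.
  apply: eseries0 => n _ _; apply/eqP; rewrite eq_le wsum_ge0// andbT leNgt.
  by apply/negP => ng; apply: gn; exists n.
case: gn => n gn; apply: le_trans (le_wsum_csum n _); last first.
  by move=> s; rewrite mule_ge0.
by rewrite wsumZl// gt0_mulye.
Qed.

Lemma csum_size n g :
  csum (fun s => if size s == n then g s else 0) = wsum n g.
Proof.
transitivity (wsum n (fun s => if size s == n then g s else 0)); last first.
  by apply: eq_wsum => s ->; rewrite eqxx.
rewrite /csum; apply/cvg_lim => //; apply: cvg_near_cst.
exists n.+1 => //= k /= nk; rewrite (bigD1_seq n) ?mem_index_iota ?iota_uniq//=.
rewrite big1 ?adde0// => i /negbTE ni.
by apply: wsum0 => s ->; rewrite ni.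
Qed.

Lemma cauchy_series (a : nat -> nat -> \bar R) : (forall i j, 0 <= a i j) ->
  \sum_(0 <= n <oo) \sum_(i < n.+1) a i (n - i)%N =
  \sum_(0 <= i <oo) \sum_(0 <= j <oo) a i j.
Proof.
move=> a0.
transitivity (\sum_(0 <= i <oo) \sum_(0 <= n <oo)
    (if (i <= n)%N then a i (n - i)%N else 0)); last first.
  apply: eq_eseriesr => i _; rewrite (nneseries_split _ i) => [|k _]; last by case: ifP.
  rewrite [X in X + _]big1_seq ?add0e; last first.
    by move=> k; rewrite mem_index_iota => /andP[_ /andP[_ ki]]; rewrite leqNgt ki.
  rewrite add0n -nneseries_addn => [|k]; last by case: ifP.
  by apply: eq_eseriesr => n _; rewrite leq_addl addnK.
rewrite nneseries_interchange; last by move=> i j; case: ifP.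
apply: eq_eseriesr => n _; rewrite (nneseries_split _ n.+1); last first.
  by move=> k _; case: ifP.
rewrite [X in _ = _ + X]eseries0 ?adde0; last first.
  by move=> k nk _; rewrite leqNgt nk.
by rewrite add0n big_mkord; apply: eq_bigr => i _; rewrite -ltnS ltn_ord.
Qed.

(** Each pair of words arises from exactly one word and one cut position: this is a Cauchy product
    graded by length, summed by Tonelli. *)
Lemma csum_conv (w : seq A -> \bar R) (D : seq A -> \bar R) g :
  (forall s, 0 <= w s) -> (forall s, 0 <= D s) -> (forall s, 0 <= g s) ->
  csum (fun s => (\sum_(i < (size s).+1) w (take i s) * D (drop i s)) * g s) =
  csum (fun a => w a * csum (fun b => D b * g (a ++ b))).
Proof.
move=> w0 D0 g0.
pose a i j := wsum i (fun a => wsum j (fun b => w a * (D b * g (a ++ b)))).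
have t0 x y : 0 <= w x * (D y * g (x ++ y)) by rewrite !mule_ge0.
have a0 i j : 0 <= a i j by apply: wsum_ge0 => s; exact: wsum_ge0.
transitivity (\sum_(0 <= n <oo) \sum_(i < n.+1) a i (n - i)%N).
  apply: eq_eseriesr => n _.
  transitivity (wsum n (fun s => \sum_(i < n.+1)
      (w (take i s) * D (drop i s) * g s))).
    apply: eq_wsum => s sn; rewrite ge0_sume_distrl ?sn// => i _.
    by rewrite mule_ge0.
  rewrite wsum_sum; apply: eq_bigr => i _; rewrite /a.
  have lein : (i <= n)%N by rewrite -ltnS ltn_ord.
  rewrite -{1}(subnKC lein) wsum_cat; apply: eq_wsum => x xi.
  by apply: eq_wsum => y _; rewrite -xi take_size_cat// drop_size_cat// muleA.
rewrite cauchy_series//; apply: eq_eseriesr => i _.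
rewrite /a -wsum_series//; last by move=> j s; exact: wsum_ge0.
apply: eq_wsum => x _; rewrite -csumZl// => b; exact: mule_ge0.
Qed.

End word_sums.

(** * Weighted sums over lists of blocks *)

Section block_sums.
Local Open Scope ereal_scope.
Context {R : realType} {A : finType}.
Variable w : seq A -> \bar R.
Hypothesis w0 : forall s, 0 <= w s.
Implicit Types (g h : seq A -> \bar R) (G H : seq (seq A) -> \bar R).

Definition bsum g : \bar R := csum (fun b => w b * g b).

(** [G] receives the list and not its concatenation, because [headsum] has to know where the first
    block ends. *)
Fixpoint bsumn m G : \bar R :=
  if m is k.+1 then bsum (fun b => bsumn k (fun L => G (b :: L))) else G [::].

Lemma bsum_ge0 g : (forall s, 0 <= g s) -> 0 <= bsum g.
Proof. by move=> g0; apply: csum_ge0 => s; rewrite mule_ge0. Qed.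

Lemma bsumn_ge0 m G : (forall L, 0 <= G L) -> 0 <= bsumn m G.
Proof. by elim: m G => //= m IH G G0; apply: bsum_ge0 => b; exact: IH. Qed.

Lemma le_bsum g h : (forall s, 0 <= g s) -> (forall s, w s != 0 -> g s <= h s) ->
  bsum g <= bsum h.
Proof.
move=> g0 gh; apply: le_csum => s; first by rewrite mule_ge0.
by have [->|/gh ghs] := eqVneq (w s) 0; rewrite ?mul0e// lee_pmul.
Qed.

Lemma eq_bsum g h : (forall s, w s != 0 -> g s = h s) -> bsum g = bsum h.
Proof.
move=> gh; apply: eq_csum => s.
by have [->|/gh ->] := eqVneq (w s) 0; rewrite ?mul0e.
Qed.

Lemma eq_bsumn m G H :
  (forall L, size L = m -> all (fun b => w b != 0) L -> G L = H L) ->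
  bsumn m G = bsumn m H.
Proof.
elim: m G H => /= [|m IH] G H GH; first exact: GH.
apply: eq_bsum => b wb; apply: IH => L Lm wL.
by apply: GH; rewrite /= ?Lm// wb.
Qed.

Lemma le_bsumn m G H : (forall L, 0 <= G L) ->
  (forall L, size L = m -> all (fun b => w b != 0) L -> G L <= H L) ->
  bsumn m G <= bsumn m H.
Proof.
elim: m G H => /= [|m IH] G H G0 GH; first exact: GH.
apply: le_bsum => [b|b wb]; first exact: bsumn_ge0.
by apply: IH => // L Lm wL; apply: GH; rewrite /= ?Lm// wb.
Qed.

Lemma bsumD g h : (forall s, 0 <= g s) -> (forall s, 0 <= h s) ->
  bsum (fun s => g s + h s) = bsum g + bsum h.
Proof.
move=> g0 h0; rewrite /bsum -csumD => [|s|s]; try by rewrite mule_ge0.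
by apply: eq_csum => s; rewrite ge0_muleDr.
Qed.

Lemma bsumnD m G H : (forall L, 0 <= G L) -> (forall L, 0 <= H L) ->
  bsumn m (fun L => G L + H L) = bsumn m G + bsumn m H.
Proof.
elim: m G H => //= m IH G H G0 H0; rewrite -bsumD => [|b|b]; try exact: bsumn_ge0.
by apply: eq_bsum => b _; rewrite IH.
Qed.

Lemma bsumZl c g : 0 <= c -> (forall s, 0 <= g s) ->
  bsum (fun s => c * g s) = c * bsum g.
Proof.
move=> c0 g0; rewrite /bsum -csumZl// => [|s]; last by rewrite mule_ge0.
by apply: eq_csum => s; rewrite muleCA.
Qed.

Lemma bsumnZl m c G : 0 <= c -> (forall L, 0 <= G L) ->
  bsumn m (fun L => c * G L) = c * bsumn m G.
Proof.
move=> c0; elim: m G => //= m IH G G0.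
rewrite -bsumZl// => [|b]; last exact: bsumn_ge0.
by apply: eq_bsum => b _; rewrite IH.
Qed.

Lemma bsumn_cat m k G :
  bsumn (m + k) G = bsumn m (fun L => bsumn k (fun L' => G (L ++ L'))).
Proof. by elim: m G => //= m IH G; apply: eq_bsum => b _; rewrite IH. Qed.

Lemma bsumn_mul (chi : seq A -> R) (phi : R) m :
  (forall s, 0 <= chi s)%R -> chi [::] = 1%R ->
  (forall s t, chi (s ++ t) = chi s * chi t)%R ->
  bsum (fun b => (chi b)%:E) = phi%:E ->
  bsumn m (fun L => (chi (flatten L))%:E) = (phi ^+ m)%:E.
Proof.
move=> chi0 chi1 chiM hphi; elim: m => [|m IH] /=; first by rewrite chi1.
transitivity (bsum (fun b => (phi ^+ m)%:E * (chi b)%:E)).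
  apply: eq_bsum => b _; rewrite -IH [RHS]muleC -bsumnZl ?lee_fin// => [|L]; last by rewrite lee_fin.
  by apply: eq_bsumn => L _ _; rewrite chiM EFinM.
have phi0 : (0 <= phi)%R by rewrite -lee_fin -hphi bsum_ge0// => b; rewrite lee_fin.
rewrite (@bsumZl _ (fun b => (chi b)%:E)) ?lee_fin ?exprn_ge0//.
by rewrite hphi -EFinM exprSr.
Qed.

Lemma bsumn_cst m c : 0 <= c -> bsum (fun=> 1) = 1 -> bsumn m (fun=> c) = c.
Proof.
move=> c0 w1; elim: m => //= m ->.
rewrite -[RHS]mule1 -w1 -bsumZl//.
by apply: eq_bsum => b _; rewrite mule1.
Qed.

Section renewal.
Variables PD rho : seq A -> \bar R.
Hypotheses (PD0 : forall s, 0 <= PD s) (rho0 : forall s, 0 <= rho s).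
Hypothesis renewal : forall s,
  PD s = rho s + \sum_(i < (size s).+1) w (take i s) * PD (drop i s).

Lemma renewal_csum g : (forall s, 0 <= g s) ->
  csum (fun s => PD s * g s) =
  csum (fun s => rho s * g s) + bsum (fun b => csum (fun t => PD t * g (b ++ t))).
Proof.
move=> g0; rewrite /bsum -csum_conv// -csumD; last 2 first.
- by move=> s; rewrite mule_ge0.
- move=> s; rewrite mule_ge0// sume_ge0// => i _; exact: mule_ge0.
apply: eq_csum => s; rewrite {1}renewal ge0_muleDl// sume_ge0// => i _.
exact: mule_ge0.
Qed.

(** The renewal equation iterated [m] times: a path either consists of [j < m] complete blocks and a
    remainder weighted by [rho], or contains at least [m] blocks. *)
Lemma renewal_csumn m g : (forall s, 0 <= g s) ->
  csum (fun s => PD s * g s) =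
  \sum_(j < m) bsumn j (fun L => csum (fun t => rho t * g (flatten L ++ t))) +
  bsumn m (fun L => csum (fun t => PD t * g (flatten L ++ t))).
Proof.
elim: m g => [|m IH] g g0 /=; first by rewrite big_ord0 add0e.
rewrite renewal_csum// big_ord_recl -addeA; congr (_ + _).
transitivity (bsum (fun b =>
  \sum_(j < m) bsumn j (fun L => csum (fun t => rho t * g (b ++ flatten L ++ t)))
  + bsumn m (fun L => csum (fun t => PD t * g (b ++ flatten L ++ t))))).
  by apply: eq_bsum => b _; exact: (IH (fun s => g (b ++ s))).
have g1 (f : seq A -> \bar R) b (L : seq (seq A)) : (forall s, 0 <= f s) ->
    0 <= csum (fun t => f t * g (b ++ flatten L ++ t)).
  by move=> f0; apply: csum_ge0 => t; rewrite mule_ge0.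
rewrite bsumD; last 2 first.
- by move=> b; apply: sume_ge0 => j _; apply: bsumn_ge0 => L; exact: g1.
- by move=> b; apply: bsumn_ge0 => L; exact: g1.
apply: (congr2 adde); last first.
  by apply: eq_bsum => b _; apply: eq_bsumn => L _ _; apply: eq_csum => t; rewrite /= catA.
transitivity (\sum_(j < m) bsum (fun b => bsumn j
    (fun L => csum (fun t => rho t * g (b ++ flatten L ++ t))))).
  rewrite /bsum; elim: (m) => [|k IHk].
    by rewrite big_ord0 csum0// => s; rewrite big_ord0 mule0.
  rewrite big_ord_recr -IHk /= -csumD; last 2 first.
  - move=> b; rewrite mule_ge0// sume_ge0// => j _; apply: bsumn_ge0 => L; exact: g1.
  - by move=> b; rewrite mule_ge0// bsumn_ge0// => L; exact: g1.
  apply: eq_csum => b; rewrite big_ord_recr/= ge0_muleDr//.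
    by apply: sume_ge0 => j _; apply: bsumn_ge0 => L; exact: g1.
  by apply: bsumn_ge0 => L; exact: g1.
apply: eq_bigr => j _ /=.
by apply: eq_bsum => b _; apply: eq_bsumn => L _ _; apply: eq_csum => t; rewrite /= catA.
Qed.

End renewal.
End block_sums.

(** * Growth of solutions of a renewal equation *)

Section renewal_bounds.
Local Open Scope ereal_scope.
Context {R : realType} {A : finType}.
Variables w PD rho : seq A -> \bar R.
Hypotheses (w0 : forall s, 0 <= w s) (PD0 : forall s, 0 <= PD s)
  (rho0 : forall s, 0 <= rho s) (w_nil : w [::] = 0).
Hypothesis renewal : forall s,
  PD s = rho s + \sum_(i < (size s).+1) w (take i s) * PD (drop i s).

Lemma size_flatten_charged (L : seq (seq A)) :
  all (fun b => w b != 0) L -> (size L <= size (flatten L))%N.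
Proof.
elim: L => //= b L IH /andP[wb /IH IHL]; rewrite size_cat -add1n leq_add//.
by case: b wb => //; rewrite w_nil eqxx.
Qed.

(** Strong induction on [n]. Paths with fewer than [l] blocks contribute at most a constant, by the
    multiplicative majorant [chi]. On the others [h] is cut after [l] blocks, the induction
    hypothesis at the shorter length gains [e^(- kap |L|)], and the last hypothesis says that these
    gains sum to at most 1. *)
Lemma renewal_upper (h chi : seq A -> R) (G : seq (seq A) -> R) (l : nat)
    (kap C phi : R) :
  (0 < l)%N -> (0 <= kap)%R ->
  (forall s, 0 <= h s <= chi s)%R ->
  (forall L, 0 <= G L)%R ->
  chi [::] = 1%R -> (forall s t, chi (s ++ t) = chi s * chi t)%R ->
  bsum w (fun b => (chi b)%:E) = phi%:E ->
  (forall n, wsum n (fun s => rho s * (chi s)%:E) <= C%:E) ->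
  (forall L s, size L = l -> h (flatten L ++ s) <= G L * h s)%R ->
  bsumn w l (fun L => (G L * expR (- kap * (size (flatten L))%:R))%:E) <= 1 ->
  exists2 C', (0 <= C')%R & forall n,
    wsum n (fun s => PD s * (h s)%:E) <= (C' * n.+1%:R * expR (kap * n%:R))%:E.
Proof.
move=> l0 kap0 hchi G0 chi1 chiM hphi hrho hG hsum.
have chi0 s : (0 <= chi s)%R by case/andP: (hchi s) => h0; exact: le_trans.
have h0 s : (0 <= h s)%R by case/andP: (hchi s).
have C0 : (0 <= C)%R.
  by rewrite -lee_fin; apply: le_trans (hrho 0%N); rewrite mule_ge0// lee_fin.
have phi0 : (0 <= phi)%R by rewrite -lee_fin -hphi bsum_ge0// => b; rewrite lee_fin.
(* The [j]-th term pays for [j] complete blocks, of mass [phi] each, and a remainder of mass at most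
   [C]. *)
pose C' := (\sum_(j < l) phi ^+ j * C)%R.
have C'0 : (0 <= C')%R by apply: sumr_ge0 => j _; rewrite mulr_ge0// exprn_ge0.
exists C' => //; elim/ltn_ind => n IH.
pose g s : \bar R := if size s == n then (h s)%:E else 0.
have g0 s : 0 <= g s by rewrite /g; case: ifP; rewrite ?lee_fin.
have gcat (L : seq (seq A)) (f : seq A -> \bar R) :
    csum (fun t => f t * g (flatten L ++ t)) =
    if (size (flatten L) <= n)%N then
      wsum (n - size (flatten L)) (fun t => f t * (h (flatten L ++ t))%:E) else 0.
  case: ifPn => [Ln|]; last first.
    rewrite -ltnNge => Ln; apply: csum0 => t.
    rewrite /g size_cat gtn_eqF ?mule0//; exact: leq_trans (leq_addr _ _).
  rewrite -csum_size; apply: eq_csum => t; rewrite /g size_cat.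
  by rewrite -{1}(subnKC Ln) eqn_add2l; case: ifP; rewrite ?mule0.
have -> : wsum n (fun s => PD s * (h s)%:E) = csum (fun s => PD s * g s).
  by rewrite -csum_size; apply: eq_csum => s; rewrite /g; case: ifP; rewrite ?mule0.
rewrite (renewal_csumn w0 PD0 rho0 renewal l g0).
(* One share of [C'] is for the paths with fewer than [l] blocks, the other [n] shares are for the
   induction hypothesis: hence the linear factor. *)
have -> : (C' * n.+1%:R * expR (kap * n%:R))%:E =
    (C' * expR (kap * n%:R))%:E + (C' * n%:R * expR (kap * n%:R))%:E.
  by rewrite -EFinD; congr _%:E; rewrite -[n.+1]addn1 natrD; ring.
apply: leeD.
  apply: (@le_trans _ _ C'%:E); last first.
    by rewrite lee_fin ler_peMr// -[leLHS]expR0 ler_expR mulr_ge0.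
  rewrite /C' -sumEFin; apply: lee_sum => j _.
  apply: (@le_trans _ _ (bsumn w j (fun L => C%:E * (chi (flatten L))%:E))).
    apply: le_bsumn => // [L|L _ _].
      by apply: csum_ge0 => t; rewrite mule_ge0.
    rewrite gcat; case: ifPn => _; last by rewrite mule_ge0// lee_fin.
    apply: (@le_trans _ _ (wsum (n - size (flatten L))
        (fun t => (chi (flatten L))%:E * (rho t * (chi t)%:E)))).
      apply: le_wsum => t _; rewrite muleCA lee_wpmul2l//.
      by rewrite -EFinM lee_fin -chiM; case/andP: (hchi (flatten L ++ t)).
    rewrite wsumZl => [|t]; last by rewrite mule_ge0// lee_fin.
    by rewrite muleC lee_wpmul2r ?lee_fin.
  rewrite (bsumnZl w0) ?lee_fin// => [|L]; last by rewrite lee_fin.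
  by rewrite (bsumn_mul w0 _ chi0 chi1 chiM hphi) -EFinM mulrC.
apply: (@le_trans _ _ (bsumn w l (fun L => (C' * n%:R * expR (kap * n%:R))%:E *
    (G L * expR (- kap * (size (flatten L))%:R))%:E))); last first.
  rewrite (bsumnZl w0) => [||L]; last 2 first.
  - by rewrite lee_fin !mulr_ge0// expR_ge0.
  - by rewrite lee_fin mulr_ge0// expR_ge0.
  rewrite -[leRHS]mule1; apply: lee_wpmul2l hsum.
  by rewrite lee_fin !mulr_ge0// expR_ge0.
apply: le_bsumn => // [L|L Ll wL].
  by apply: csum_ge0 => t; rewrite mule_ge0.
have Lsz := size_flatten_charged wL; rewrite Ll in Lsz.
rewrite gcat; case: ifPn => Ln; last first.
  by rewrite -EFinM lee_fin !mulr_ge0// expR_ge0.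
apply: (@le_trans _ _ (wsum (n - size (flatten L))
    (fun t => (G L)%:E * (PD t * (h t)%:E)))).
  by apply: le_wsum => t _; rewrite muleCA lee_wpmul2l// -EFinM lee_fin hG.
rewrite wsumZl => [|t]; last by rewrite mule_ge0// lee_fin.
have Lnn : (n - size (flatten L) < n)%N.
  by rewrite ltn_subrL (leq_trans l0 Lsz) (leq_trans (leq_trans l0 Lsz)).
apply: le_trans; first by apply: lee_wpmul2l; [rewrite lee_fin | exact: IH].
rewrite -!EFinM lee_fin.
have -> : (C' * n%:R * expR (kap * n%:R) * (G L * expR (- kap * (size (flatten L))%:R)) =
   G L * (C' * n%:R * expR (kap * (n - size (flatten L))%:R)))%R.
  by rewrite natrB// mulrBr expRD mulNr; ring.
rewrite ler_wpM2l// ler_wpM2r ?expR_ge0// ler_wpM2l// ler_nat.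
by rewrite ltn_subrL (leq_trans l0 Lsz) (leq_trans (leq_trans l0 Lsz)).
Qed.

(* Comparison with the subsolution n |-> c exp(- kap n): a truncation of the
   block sum of exp(kap * size) still exceeds 1. *)
Lemma renewal_lower (chi : seq A -> R) (b1 : seq A) (kap : R) :
  (forall s, 0 < chi s)%R -> (forall s t, chi (s ++ t) = chi s * chi t)%R ->
  bsum w (fun b => (chi b)%:E) = 1 -> (0 < kap)%R ->
  size b1 = 1%N -> 0 < w b1 -> 0 < PD [::] ->
  exists2 c : R, (0 < c)%R & forall n,
    (c * expR (- kap * n%:R))%:E <= wsum n (fun s => PD s * (chi s)%:E).
Proof.
move=> chi0 chiM hphi kap0 b1sz wb1 PDnil.
pose u n := wsum n (fun s => PD s * (chi s)%:E).
pose B i := wsum i (fun b => w b * (chi b)%:E).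
have t0 (f : seq A -> \bar R) s : (forall s, 0 <= f s) -> 0 <= f s * (chi s)%:E.
  by move=> f0; rewrite mule_ge0// lee_fin ltW.
have u0 n : 0 <= u n by apply: wsum_ge0 => s; exact: t0.
have B0 n : 0 <= B n by apply: wsum_ge0 => s; exact: t0.
have uB n : \sum_(i < n.+1) B i * u (n - i)%N <= u n.
  rewrite /u (eq_wsum (h := fun s => (rho s + \sum_(i < n.+1)
      w (take i s) * PD (drop i s)) * (chi s)%:E)); last first.
    by move=> s sn; rewrite renewal sn.
  rewrite (eq_wsum (h := fun s => rho s * (chi s)%:E + \sum_(i < n.+1)
      (w (take i s) * PD (drop i s) * (chi s)%:E))); last first.
    move=> s _; rewrite ge0_muleDl//; last first.
      by apply: sume_ge0 => i _; rewrite mule_ge0.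
    by rewrite ge0_sume_distrl// => i _; rewrite mule_ge0.
  rewrite wsumD wsum_sum; apply: (@le_trans _ _ (0 + \sum_(i < n.+1) wsum n
     (fun s => w (take i s) * PD (drop i s) * (chi s)%:E))); last first.
    by rewrite leeD2r// wsum_ge0// => s; exact: t0.
  rewrite add0e; apply: lee_sum => i _.
  have lein : (i <= n)%N by rewrite -ltnS ltn_ord.
  rewrite -[X in _ <= wsum X _](subnKC lein) wsum_cat muleC -wsumZl => [|s]; last exact: t0.
  apply: le_wsum => a ai; rewrite muleC -wsumZl => [|s]; last exact: t0.
  apply: le_wsum => b _; rewrite -{1}ai take_size_cat// -{1}ai drop_size_cat//.
  by rewrite chiM EFinM muleACA.
have B1 : 0 < B 1%N.
  case: b1 b1sz wb1 => [//|z [|//]] _ wz; rewrite /B /= (bigD1 z)//=.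
  apply: (@lt_le_trans _ _ (w [:: z] * (chi [:: z])%:E)).
    by rewrite mule_gt0// lte_fin.
  by rewrite leeDl// sume_ge0// => i _; exact: t0.
(* The one-letter block reaches every length, which excludes periodicity. *)
have u_gt0 n : 0 < u n.
  elim: n => [|n IH]; first by rewrite /u/= mule_gt0// lte_fin.
  apply: lt_le_trans (uB n.+1).
  rewrite (bigD1 (Ordinal (isT : (1 < n.+2)%N)))//= subn1/=.
  apply: (@lt_le_trans _ _ (B 1%N * u n)); first by rewrite mule_gt0.
  by rewrite leeDl// sume_ge0// => i _; rewrite mule_ge0.
(* Blocks are nonempty, so the factor [e^(kap i)] raises the total mass from 1 to at least
   [e^kap > 1], and a finite partial sum reaches 1. *)
have [N hN] : exists N, 1 <= \sum_(0 <= i < N) B i * (expR (kap * i%:R))%:E.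
  apply: contrapT => /forallNP hN.
  have : \sum_(0 <= i <oo) B i * (expR (kap * i%:R))%:E <= 1.
    apply: lime_le.
      by apply: is_cvg_nneseries => i _ _; rewrite mule_ge0// lee_fin expR_ge0.
    by apply: nearW => N; rewrite leNgt; apply/negP => /ltW; exact: hN.
  apply/negP; rewrite -ltNge.
  apply: (@lt_le_trans _ _ (expR kap)%:E); first by rewrite lte_fin expR_gt1.
  rewrite -[leLHS]mule1 -hphi /bsum /csum -nneseriesZl//; last by move=> i _; exact: B0.
  apply: lee_nneseries => [i _ _|i _].
    by rewrite mule_ge0 ?lee_fin ?expR_ge0//; exact: B0.
  case: i => [|i]; first by rewrite /= /B /= w_nil !mul0e mule0.
  rewrite muleC -/(B i.+1) (lee_wpmul2l (B0 _))//.
  by rewrite lee_fin ler_expR ler_peMr ?(ltW kap0)// ler1n.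
have [c c0 hc] : exists2 c : R, (0 < c)%R & forall n, (n < N)%N -> c%:E <= u n.
  elim: (N) => [|k [c c0 IH]]; first by exists 1%R.
  have [r r0 ru] : exists2 r : R, (0 < r)%R & r%:E <= u k.
    have := u_gt0 k; case: (u k) => [r r0|_|//]; first by exists r.
    by exists 1%R => //; rewrite leey.
  exists (Num.min c r); first by rewrite lt_min c0.
  move=> n; rewrite ltnS leq_eqVlt => /predU1P[->|/IH cu].
    by apply: le_trans ru; rewrite lee_fin ge_min lexx orbT.
  by apply: le_trans cu; rewrite lee_fin ge_min lexx.
exists c => //; elim/ltn_ind => n IH.
have [nN|Nn] := ltnP n N.
  apply: le_trans (hc _ nN); rewrite lee_fin ler_piMr ?(ltW c0)//.
  by rewrite -[leRHS]expR0 ler_expR mulNr oppr_le0 mulr_ge0// ltW.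
apply: le_trans (uB n).
apply: (@le_trans _ _ ((c * expR (- kap * n%:R))%:E *
    \sum_(0 <= i < N) B i * (expR (kap * i%:R))%:E)).
  by rewrite lee_pemulr// lee_fin mulr_ge0 ?expR_ge0// ltW.
rewrite ge0_sume_distrr => [|i _]; last by rewrite mule_ge0// lee_fin expR_ge0.
apply: (@le_trans _ _ (\sum_(0 <= i < N) B i * u (n - i)%N)); last first.
  rewrite -(big_mkord xpredT (fun i => B i * u (n - i)%N)).
  by apply: lee_sum_nneg_natr => [i _ _|]; rewrite ?mule_ge0// (leq_trans Nn).
rewrite !big_nat; apply: lee_sum => i /andP[_ iN].
have [->|i0] := posnP i; first by rewrite /B /= w_nil !mul0e mule0.
rewrite muleCA lee_wpmul2l//.
have ni : (i <= n)%N by rewrite (leq_trans _ Nn)// ltnW.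
apply: le_trans (IH _ _); last by rewrite ltn_subrL i0 (leq_trans i0).
by rewrite -EFinM lee_fin -mulrA -expRD natrB// ler_pM2l// ler_expR; nra.
Qed.
End renewal_bounds.

(** * Functionals of block sequences *)

Section exp_moment.
Context {R : realType}.

(** Second-order bound whose remainder is controlled by an exponential moment; for [y >= 0] the
    inequality [e^y - 1 <= y e^y] is used twice. *)
Lemma expR_le_quadratic (y : R) : expR y <= 1 + y + y ^+ 2 * expR `|y|.
Proof.
have h1 : expR y - 1 <= y * expR y.
  have := @expR_ge1Dx R (- y); rewrite -(ler_pM2r (expR_gt0 y)).
  by rewrite -expRD addNr expR0; lra.
have h2 := @expR_ge1Dx R y.
have [y0|y0] := leP 0 y.
  rewrite ger0_norm//.
  have : y * (expR y - 1) <= y * (y * expR y) by rewrite ler_wpM2l.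
  by lra.
have : 1 <= expR `|y| by rewrite -[leLHS]expR0 ler_expR.
have : 0 <= y ^+ 2 by rewrite sqr_ge0.
move=> s e; have : y ^+ 2 <= y ^+ 2 * expR `|y| by rewrite ler_peMr.
nra.
Qed.

Lemma sqr_le_expR (x : R) : 0 <= x -> x ^+ 2 <= 4 * expR x.
Proof.
move=> x0; have h := @expR_ge1Dx R (x / 2).
have -> : expR x = expR (x / 2) ^+ 2 by rewrite expr2 -expRD; congr expR; lra.
have : x / 2 <= expR (x / 2) by lra.
rewrite -(@ler_sqr _ (x / 2)) ?nnegrE ?expR_ge0 ?divr_ge0// => hh.
have e : (x / 2) ^+ 2 = x ^+ 2 / 4 by field.
by rewrite e in hh; lra.
Qed.

Lemma small_scale (a b c e : R) : 0 < e -> 0 <= a -> 0 <= b -> 0 <= c ->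
  exists2 sig, 0 < sig & [/\ sig * a <= e, sig * b <= e / 2 & sig * c <= 1].
Proof.
move=> e0 a0 b0 c0; pose D := a + 2 * b + c + 1.
have D0 : 0 < D by rewrite /D; lra.
have m0 : 0 < Num.min e 1 by rewrite lt_min e0 ltr01.
have me : Num.min e 1 <= e by rewrite ge_min lexx.
have m1 : Num.min e 1 <= 1 by rewrite ge_min lexx orbT.
exists (Num.min e 1 / D); first by rewrite divr_gt0.
have : Num.min e 1 / D * D = Num.min e 1 by rewrite divfK// gt_eqF.
have : 0 < Num.min e 1 / D by rewrite divr_gt0.
move: (Num.min e 1) (Num.min e 1 / D) me m1 => m s me m1 s0.
rewrite /D => sD; split; nra.
Qed.

End exp_moment.

Lemma count_lt_leq n K : (\sum_(j < n) (j < K)%N <= K)%N.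
Proof.
have -> : (\sum_(j < n) (j < K)%N = minn n K)%N; last exact: geq_minr.
elim: n => [|n IH]; first by rewrite big_ord0 min0n.
rewrite big_ord_recr/= IH; have [nK|Kn] := ltnP n K.
  by rewrite addn1 !(minn_idPl _)// ltnW.
by rewrite addn0 !(minn_idPr _)// (leq_trans Kn).
Qed.

Section block_functional.
Local Open Scope ereal_scope.
Context {R : realType} {A : finType}.
Variable w : seq A -> \bar R.
Hypotheses (w0 : forall s, 0 <= w s) (w_nil : w [::] = 0).

Variables (g : seq A -> R) (M : R) (K : nat).
Hypothesis g_bound : forall s, (0 <= g s <= M)%R.
Hypothesis g_local : forall s t, (K <= size s)%N -> g (s ++ t) = g s.

(** Near the end of [s] the function is evaluated on suffixes shorter than [K]; there are fewer than
    [K] of these, and each costs at most [M]. *)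
Definition wordsum (s : seq A) : R := (\sum_(j < size s) g (drop j s))%R.

(** Only the positions in the first block are summed, but the letters read past its end come from
    the later blocks. When the blocks are nonempty, [K] further blocks determine the value. *)
Definition headsum (L : seq (seq A)) : R :=
  (\sum_(j < size (head [::] L)) g (drop j (flatten L)))%R.

Lemma g_ge0 s : (0 <= g s)%R. Proof. by case/andP: (g_bound s). Qed.
Lemma M_ge0 : (0 <= M)%R. Proof. by case/andP: (g_bound [::]) => h0; exact: le_trans. Qed.

Lemma wordsum_ge0 s : (0 <= wordsum s)%R.
Proof. by apply: sumr_ge0 => j _; exact: g_ge0. Qed.

Lemma headsum_ge0 s : (0 <= headsum s)%R.
Proof. by apply: sumr_ge0 => j _; exact: g_ge0. Qed.

Lemma wordsum_le s : (wordsum s <= M * (size s)%:R)%R.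
Proof.
apply: (@le_trans _ _ (\sum_(j < size s) M)%R).
  by apply: ler_sum => j _; case/andP: (g_bound (drop j s)).
by rewrite sumr_const card_ord mulr_natr.
Qed.

Lemma headsum_le L : (headsum L <= M * (size (head [::] L))%:R)%R.
Proof.
apply: (@le_trans _ _ (\sum_(j < size (head [::] L)) M)%R).
  by apply: ler_sum => j _; case/andP: (g_bound (drop j (flatten L))).
by rewrite sumr_const card_ord mulr_natr.
Qed.

Lemma wordsum_flatten b L :
  wordsum (flatten (b :: L)) = (headsum (b :: L) + wordsum (flatten L))%R.
Proof.
rewrite /wordsum /headsum /= size_cat big_split_ord/=; congr +%R.
apply: eq_bigr => j _; congr g.
by rewrite drop_cat ltnNge leq_addr/= addKn.
Qed.

(** Appending [t] changes [g] only at positions of [s] whose window crosses the cut, at most [K] of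
    them. *)
Lemma wordsum_cat s t : (wordsum (s ++ t) <= wordsum s + M * K%:R + wordsum t)%R.
Proof.
rewrite /wordsum size_cat big_split_ord/=.
have -> : (\sum_(i < size t) g (drop (size s + i) (s ++ t)) = wordsum t)%R.
  apply: eq_bigr => j _; congr g.
  by rewrite drop_cat ltnNge leq_addr/= addKn.
rewrite lerD2r.
have := M_ge0 => M0.
have h j : (j < size s)%N -> (g (drop j (s ++ t)) <= g (drop j s) +
    (if (size s < j + K)%N then M else 0))%R.
  move=> js; rewrite drop_cat js; case: ifPn => [_|].
    by case/andP: (g_bound (drop j s ++ t)) => _ ?; rewrite ler_wpDl// g_ge0.
  by rewrite -leqNgt => jK; rewrite addr0 g_local// size_drop leq_subRL// ltnW.
apply: (@le_trans _ _ (\sum_(j < size s) (g (drop j s) +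
    (if (size s < j + K)%N then M else 0)))%R).
  by apply: ler_sum => j _; exact: h.
rewrite big_split/= lerD2l.
apply: (@le_trans _ _ (M * (\sum_(j < size s) (j < K)%N)%:R)%R); last first.
  by rewrite ler_wpM2l// ler_nat count_lt_leq.
rewrite natr_sum mulr_sumr (reindex_inj rev_ord_inj)/=.
apply: ler_sum => j _; rewrite subnS; case: ifPn => [jK|_]; last by rewrite mulr_ge0.
suff -> : (j < K)%N by rewrite mulr1.
by have := ltn_ord j; lia.
Qed.

(* Far from the end of the list the block averages are stationary; the last K
   positions cost at most M K E|b|. *)
Lemma bsumn_wordsum (ell gam : R) (m : nat) : bsum w (fun=> 1) = 1 ->
  bsum w (fun b => (size b)%:R%:E) = ell%:E ->
  bsumn w K.+1 (fun L => (headsum L)%:E) = gam%:E ->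
  bsumn w m (fun L => (wordsum (flatten L))%:E) <= (m%:R * gam + M * (minn m K)%:R * ell)%:E.
Proof.
move=> w1 hell hgam; elim: m => [|m IH] /=.
  by rewrite min0n mulr0 !mul0r addr0 /wordsum big_ord0.
have M0 := M_ge0.
have head0 L : 0 <= (headsum L)%:E by rewrite lee_fin headsum_ge0.
have word0 s : 0 <= (wordsum s)%:E by rewrite lee_fin wordsum_ge0.
have -> : bsum w (fun b => bsumn w m (fun L => (wordsum (flatten (b :: L)))%:E)) =
    bsumn w m.+1 (fun L => (headsum L)%:E) +
    bsumn w m (fun L => (wordsum (flatten L))%:E).
  rewrite -[X in _ = _ + X](bsumn_cst w0 1 _ w1) ?bsumn_ge0//= -bsumD//; last 2 first.
  - by move=> b; apply: bsumn_ge0.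
  - by move=> b; apply: bsumn_ge0.
  apply: eq_bsum => b _; rewrite -bsumnD//.
  by apply: eq_bsumn => L _ _; rewrite wordsum_flatten EFinD.
have [mK|Km] := ltnP m K.
  have head_le : bsumn w m.+1 (fun L => (headsum L)%:E) <= (M * ell)%:E.
    apply: (@le_trans _ _ (bsum w (fun b => M%:E * (size b)%:R%:E))).
      apply: le_bsum => //= [b|b _]; first exact: bsumn_ge0.
      rewrite -(@bsumn_cst _ _ w w0 m (M%:E * _)) ?mule_ge0 ?lee_fin//.
      by apply: le_bsumn => // L _ _; rewrite -EFinM lee_fin headsum_le.
    by rewrite bsumZl ?lee_fin// hell.
  apply: le_trans (leeD head_le IH) _.
  rewrite -EFinD lee_fin !(minn_idPl _) ?(ltnW mK)//.
  have gam0 : (0 <= gam)%R by rewrite -lee_fin -hgam bsumn_ge0.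
  by rewrite -addn1 !natrD; lra.
have -> : bsumn w m.+1 (fun L => (headsum L)%:E) = gam%:E.
  rewrite -hgam -[in LHS](subnKC Km) -addSn bsumn_cat; apply: eq_bsumn => L LK wL.
  rewrite -[RHS](@bsumn_cst _ _ w w0 (m - K))//; apply: eq_bsumn => L' _ _.
  congr _%:E; case: L LK wL => // b L [LK] /=/andP[_ wL]; rewrite /headsum /=.
  apply: eq_bigr => j _; rewrite flatten_cat catA !drop_cat.
  rewrite size_cat (leq_trans (ltn_ord j) (leq_addr _ _)) ltn_ord g_local//.
  by rewrite size_cat -LK (leq_trans (size_flatten_charged w_nil wL)) ?leq_addl.
apply: le_trans (leeD (lexx _) IH) _.
rewrite -EFinD lee_fin !(minn_idPr _) ?(leq_trans Km)//.
by rewrite -addn1 !natrD; lra.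
Qed.

Lemma bsumn_size (ell : R) m : bsum w (fun=> 1) = 1 ->
  bsum w (fun b => (size b)%:R%:E) = ell%:E ->
  bsumn w m (fun L => (size (flatten L))%:R%:E) = (m%:R * ell)%:E.
Proof.
move=> w1 hell; elim: m => [|m IH] /=; first by rewrite mul0r.
have -> : (m.+1%:R * ell)%:E = ell%:E + (m%:R * ell)%:E.
  by rewrite -EFinD -addn1 natrD; congr _%:E; ring.
rewrite -hell -IH -[X in _ = _ + X](bsumn_cst w0 1 _ w1) ?bsumn_ge0//=.
rewrite -bsumD// => [|b]; last by apply: bsumn_ge0 => // L; rewrite lee_fin.
apply: eq_bsum => b _; rewrite -[X in _ = X + _](@bsumn_cst _ _ w w0 m) ?lee_fin//.
rewrite -bsumnD//.
by apply: eq_bsumn => L _ _; rewrite size_cat natrD EFinD.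
Qed.

(** Put [Y = F - mu N + M K - (eps / 2) N] for [l] blocks of total length [N] and total sum [F],
    with [mu = gam / ell]. The choice of [mu] cancels [l gam], so the mean of [Y] is at most
    [M K (ell + 1) - (eps / 2) l ell <= - 1] for large [l]. A second-order expansion then bounds the
    mean of [e^(sig Y)] by [1 - sig + sig^2 C3 V <= 1]. *)
Lemma block_exp_moment (eta phi ell gam eps : R) :
  bsum w (fun=> 1) = 1 -> (0 < eta)%R -> (0 < eps)%R -> (0 < ell)%R ->
  bsum w (fun b => (expR (eta * (size b)%:R))%:E) = phi%:E ->
  bsum w (fun b => (size b)%:R%:E) = ell%:E ->
  bsumn w K.+1 (fun L => (headsum L)%:E) = gam%:E ->
  exists l, (0 < l)%N /\ exists2 sig, (0 < sig)%R & (M * sig <= eta)%R /\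
    bsumn w l (fun L => (expR (sig * (wordsum (flatten L) -
      gam / ell * (size (flatten L))%:R + M * K%:R) -
      sig * eps / 2 * (size (flatten L))%:R))%:E) <= 1.
Proof.
move=> w1 eta0 eps0 ell0 hphi hell hgam.
have M0 := M_ge0.
have gam0 : (0 <= gam)%R by rewrite -lee_fin -hgam bsumn_ge0 ?lee_fin// => L; rewrite lee_fin headsum_ge0.
pose mu := (gam / ell)%R; have mu0 : (0 <= mu)%R by rewrite divr_ge0// ltW.
have [l l0 hl] : exists2 l, (0 < l)%N &
    (M * K%:R * (ell + 1) - eps / 2 * l%:R * ell <= - 1)%R.
  pose x := (((M * K%:R * (ell + 1)) + 1) / (eps / 2 * ell))%R.
  exists (Num.truncn x).+1 => //.
  have : (x < (Num.truncn x).+1%:R)%R by rewrite truncnS_gt.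
  rewrite /x ltr_pdivrMr; last by rewrite mulr_gt0// divr_gt0.
  by set y := (_.+1%:R)%R => ?; nra.
exists l; split => //.
pose C1 := (M + M * K%:R + mu + eps / 2)%R.
have C1p : (0 < C1)%R.
  by rewrite /C1 ltr_wpDl// ?divr_gt0// !addr_ge0// mulr_ge0.
(* From [|Y| <= C1 N] and [N^2 <= 4 (2 / eta)^2 e^(eta N / 2)]; the other half of the moment of
   order [eta] is spent on [e^|sig Y|]. *)
pose C3 := (C1 ^+ 2 * (4 * (2 / eta) ^+ 2))%R.
pose V := (phi ^+ l)%R.
have hV : bsumn w l (fun L => (expR (eta * (size (flatten L))%:R))%:E) = V%:E.
  apply: (@bsumn_mul _ _ w w0 (fun s => expR (eta * (size s)%:R))%R) => //.
  - by rewrite mulr0 expR0.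
  - by move=> s t; rewrite size_cat natrD mulrDr expRD.
have V0 : (0 <= V)%R by rewrite -lee_fin -hV bsumn_ge0 ?lee_fin// => L; rewrite lee_fin expR_ge0.
have C30 : (0 <= C3)%R by apply: mulr_ge0; rewrite ?sqr_ge0// mulr_ge0 ?sqr_ge0.
(* The three bounds on [sig] give in turn [M sig <= eta], [|sig Y| <= eta N / 2] and a quadratic
   term of at most [sig]. *)
have [sig sig0 [s1 s2 s3]] := small_scale eta0 M0 (ltW C1p) (mulr_ge0 C30 V0).
exists sig => //; split; first by rewrite mulrC.
pose N (L : seq (seq A)) : R := (size (flatten L))%:R.
pose F (L : seq (seq A)) : R := wordsum (flatten L).
pose E (L : seq (seq A)) : R := expR (sig * (F L - mu * N L + M * K%:R) - sig * eps / 2 * N L).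
rewrite -/mu -/(bsumn w l (fun L => (E L)%:E)).
have N0 L : (0 <= N L)%R by [].
have F0 L : (0 <= F L)%R by exact: wordsum_ge0.
have E0 L : (0 <= E L)%R by exact: expR_ge0.
(* The negative part of [Y] is moved to the left, because sums in [\bar R] are split only for
   nonnegative terms. *)
have key L : size L = l -> all (fun b => w b != 0) L ->
    (E L + sig * (mu + eps / 2) * N L <=
     (1 + sig * M * K%:R) + (sig * F L + sig ^+ 2 * C3 * expR (eta * N L)))%R.
  move=> Ll wL.
  have N1 : (1 <= N L)%R.
    by rewrite /N ler1n (leq_trans l0)// -Ll (size_flatten_charged w_nil).
  pose Y := (F L - mu * N L + M * K%:R - eps / 2 * N L)%R.
  have EY : E L = expR (sig * Y) by rewrite /E /Y; congr expR; field.
  have YC : (`|Y| <= C1 * N L)%R.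
    have FM : (F L <= M * N L)%R by exact: wordsum_le.
    have MK0 : (0 <= M * K%:R)%R by rewrite mulr_ge0.
    have MKN : (M * K%:R <= M * K%:R * N L)%R by rewrite ler_peMr.
    have muN : (0 <= mu * N L)%R by rewrite mulr_ge0.
    have eN : (0 <= eps * N L)%R by rewrite mulr_ge0// ltW.
    have MN : (0 <= M * N L)%R by rewrite mulr_ge0.
    have FL := F0 L; by rewrite ler_norml /Y /C1; apply/andP; split; lra.
  have := expR_le_quadratic (sig * Y); rewrite -EY.
  have absY : (`|sig * Y| <= sig * (C1 * N L))%R by rewrite normrM (gtr0_norm sig0) ler_pM2l.
  have e1 : (expR `|sig * Y| <= expR (eta / 2 * N L))%R.
    by rewrite ler_expR (le_trans absY)// mulrA ler_wpM2r.
  have e2 : ((sig * Y) ^+ 2 <= sig ^+ 2 * C1 ^+ 2 * N L ^+ 2)%R.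
    rewrite -real_normK ?num_real// -!exprMn ler_sqr ?nnegrE ?normr_ge0//.
      by rewrite -mulrA.
    by rewrite !mulr_ge0// ltW.
  have e3 : (N L ^+ 2 <= 4 * (2 / eta) ^+ 2 * expR (eta / 2 * N L))%R.
    have := @sqr_le_expR R (eta / 2 * N L).
    rewrite mulr_ge0 ?divr_ge0 ?(ltW eta0)// => /(_ isT); rewrite exprMn => h.
    have -> : (N L ^+ 2 = (2 / eta) ^+ 2 * ((eta / 2) ^+ 2 * N L ^+ 2))%R.
      by field; rewrite gt_eqF.
    by rewrite [leRHS]mulrAC [leRHS]mulrC ler_wpM2l ?sqr_ge0.
  have e4 : ((sig * Y) ^+ 2 * expR `|sig * Y| <= sig ^+ 2 * C3 * expR (eta * N L))%R.
    have -> : (expR (eta * N L) = expR (eta / 2 * N L) * expR (eta / 2 * N L))%R.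
      by rewrite -expRD; congr expR; field.
    rewrite mulrA; apply: ler_pM => //; rewrite ?sqr_ge0 ?expR_ge0//.
    apply: (le_trans e2).
    rewrite [leRHS](_ : _ = sig ^+ 2 * C1 ^+ 2 * (4 * (2 / eta) ^+ 2 * expR (eta / 2 * N L)))%R.
      by rewrite ler_wpM2l// mulr_ge0// sqr_ge0.
    by rewrite /C3; ring.
  by rewrite /Y in e4 *; lra.
have mup : (0 <= sig * (mu + eps / 2))%R.
  by rewrite mulr_ge0 ?(ltW sig0)// addr_ge0// divr_ge0// ltW.
have sum_key : bsumn w l (fun L => (E L)%:E + (sig * (mu + eps / 2))%:E * (N L)%:E) <=
    bsumn w l (fun L => (1 + sig * M * K%:R)%:E +
      (sig%:E * (F L)%:E + (sig ^+ 2 * C3)%:E * (expR (eta * N L))%:E)).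
  apply: le_bsumn => // L; by rewrite -EFinM -EFinD lee_fin addr_ge0// mulr_ge0.
have c1 : (0 <= 1 + sig * M * K%:R)%R by rewrite addr_ge0// !mulr_ge0// ltW.
have c2 : (0 <= sig ^+ 2 * C3)%R by rewrite mulr_ge0 ?sqr_ge0.
have p1 L : 0 <= (sig ^+ 2 * C3)%:E * (expR (eta * N L))%:E.
  by apply: mule_ge0; rewrite lee_fin// ?expR_ge0.
have p2 L : 0 <= sig%:E * (F L)%:E + (sig ^+ 2 * C3)%:E * (expR (eta * N L))%:E.
  by apply: adde_ge0 => //; apply: mule_ge0; rewrite lee_fin ?(ltW sig0)//.
have p3 L : 0 <= (sig * (mu + eps / 2))%:E * (N L)%:E by apply: mule_ge0; rewrite lee_fin.
have p4 L : 0 <= sig%:E * (F L)%:E by apply: mule_ge0; rewrite lee_fin ?(ltW sig0)//.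
move: sum_key; rewrite !bsumnD//.
rewrite !bsumnZl ?lee_fin ?(ltW sig0)//; try by move=> L; rewrite lee_fin ?expR_ge0.
rewrite bsumn_cst ?lee_fin// hV (bsumn_size l w1 hell).
have hF := bsumn_wordsum l w1 hell hgam.
have F0' : 0 <= bsumn w l (fun L => (F L)%:E) by apply: bsumn_ge0 => // L; rewrite lee_fin.
have hF' : bsumn w l (fun L => (F L)%:E) <= (l%:R * gam + M * K%:R * ell)%:E.
  apply: (le_trans hF); rewrite lee_fin lerD2l ler_wpM2r ?(ltW ell0)// ler_wpM2l// ler_nat.
  exact: geq_minr.
move=> hE; have {}hE := le_trans hE (leeD (lexx _) (leeD (lee_wpmul2l _ hF') (lexx _))).
have {hE} := hE (ltW sig0).
rewrite -!EFinM -!EFinD -leeBrDr// -EFinB => hE; apply: (le_trans hE).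
rewrite lee_fin.
have : (mu * ell = gam)%R by rewrite /mu divfK// gt_eqF.
move: hl s3 sig0 ell0; clear; nra.
Qed.
End block_functional.

(** * Upper bounds under a tilted block law *)

Section tilted_bounds.
Local Open Scope ereal_scope.
Context {R : realType} {A : finType}.
Variables w w1 PD p rho rho1 : seq A -> \bar R.
Hypotheses (w0 : forall s, 0 <= w s) (w10 : forall s, 0 <= w1 s)
  (PD0 : forall s, 0 <= PD s)
  (rho0 : forall s, 0 <= rho s) (rho10 : forall s, 0 <= rho1 s) (w_nil : w [::] = 0).
Hypothesis renewal : forall s,
  PD s = rho s + \sum_(i < (size s).+1) w (take i s) * PD (drop i s).
Hypothesis delayed : forall s,
  p s = rho1 s + \sum_(i < (size s).+1) w1 (take i s) * PD (drop i s).

Lemma bsumn_tilt (chi : seq A -> R) m (G : seq (seq A) -> \bar R) :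
  (forall s, 0 <= chi s)%R -> chi [::] = 1%R ->
  (forall s t, chi (s ++ t) = chi s * chi t)%R ->
  (forall L, 0 <= G L) ->
  bsumn (fun b => w b * (chi b)%:E) m G =
  bsumn w m (fun L => G L * (chi (flatten L))%:E).
Proof.
move=> chi0 chi1 chiM; elim: m G => [|m IH] G G0 /=; first by rewrite chi1 mule1.
apply: eq_csum => b; rewrite IH// -muleA /=; congr (w b * _).
rewrite -(bsumnZl w0) ?lee_fin// => [|L]; last by rewrite mule_ge0// lee_fin.
apply: eq_bsumn => L _ _.
by rewrite chiM EFinM muleCA.
Qed.

(** The first block has its own weight [w1] and is summed against the majorant [H]; what follows it
    obeys the plain equation at a shorter length, where the bound is smaller. *)
Lemma delayed_upper (h H : seq A -> R) (C C1 C' kap : R) :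
  (0 <= kap)%R -> (0 <= C')%R -> (forall s, 0 <= h s)%R -> (forall s, 0 <= H s)%R ->
  (forall n, wsum n (fun s => rho1 s * (h s)%:E) <= C%:E) ->
  bsum w1 (fun b => (H b)%:E) <= C1%:E ->
  (forall b s, h (b ++ s) <= H b * h s)%R ->
  (forall n, wsum n (fun s => PD s * (h s)%:E) <= (C' * n.+1%:R * expR (kap * n%:R))%:E) ->
  forall n, wsum n (fun s => p s * (h s)%:E) <=
    ((C + C1 * C') * n.+1%:R * expR (kap * n%:R))%:E.
Proof.
move=> kap0 C'0 h0 H0 hrho hH hcat hPD n.
have C0 : (0 <= C)%R.
  by rewrite -lee_fin; apply: le_trans (hrho 0%N); rewrite mule_ge0// lee_fin.
pose g s : \bar R := if size s == n then (h s)%:E else 0.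
have g0 s : 0 <= g s by rewrite /g; case: ifP; rewrite ?lee_fin.
have -> : wsum n (fun s => p s * (h s)%:E) = csum (fun s => p s * g s).
  by rewrite -csum_size; apply: eq_csum => s; rewrite /g; case: ifP; rewrite ?mule0.
rewrite (eq_csum (h := fun s => rho1 s * g s +
    (\sum_(i < (size s).+1) w1 (take i s) * PD (drop i s)) * g s)); last first.
  by move=> s; rewrite delayed ge0_muleDl// sume_ge0// => i _; exact: mule_ge0.
rewrite csumD => [|s|s]; last 2 first.
- by rewrite mule_ge0.
- by rewrite mule_ge0// sume_ge0// => i _; exact: mule_ge0.
rewrite csum_conv// mulrDl mulrDl EFinD.
have e1 : (1 <= n.+1%:R * expR (kap * n%:R) :> R)%R.
  by rewrite -[leLHS]mulr1 ler_pM// ?ler1n// -[leLHS]expR0 ler_expR mulr_ge0.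
apply: leeD.
  apply: (@le_trans _ _ C%:E); last by rewrite lee_fin -mulrA ler_peMr.
  rewrite (eq_csum (h := fun s => if size s == n then rho1 s * (h s)%:E else 0)).
    by rewrite csum_size.
  by move=> s; rewrite /g; case: ifP; rewrite ?mule0.
apply: (@le_trans _ _ (bsum w1 (fun b => (C' * n.+1%:R * expR (kap * n%:R))%:E * (H b)%:E))).
  apply: le_bsum => // [b|b _].
    by apply: csum_ge0 => t; rewrite mule_ge0.
  have [bn|nb] := leqP (size b) n; last first.
    rewrite csum0 => [|t]; first by rewrite -EFinM lee_fin !mulr_ge0// expR_ge0.
    by rewrite /g size_cat gtn_eqF ?mule0// (leq_trans nb) ?leq_addr.
  rewrite (eq_csum (h := fun t => if size t == (n - size b)%N then
      PD t * (h (b ++ t))%:E else 0)); last first.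
    move=> t; rewrite /g size_cat -{1}(subnKC bn) eqn_add2l.
    by case: ifP; rewrite ?mule0.
  rewrite csum_size; apply: (@le_trans _ _ (wsum (n - size b)
      (fun t => (H b)%:E * (PD t * (h t)%:E)))).
    by apply: le_wsum => t _; rewrite muleCA lee_wpmul2l// -EFinM lee_fin.
  rewrite wsumZl => [|t]; last by rewrite mule_ge0// lee_fin.
  rewrite muleC lee_wpmul2r ?lee_fin//; apply: (le_trans (hPD _)).
  rewrite lee_fin ler_pM//; rewrite ?mulr_ge0 ?expR_ge0//.
    by rewrite ler_wpM2l// ler_nat ltnS leq_subr.
  by rewrite ler_expR ler_wpM2l// ler_nat leq_subr.
rewrite bsumZl// ?lee_fin ?mulr_ge0 ?expR_ge0//.
rewrite [leRHS](_ : _ = (C' * n.+1%:R * expR (kap * n%:R))%:E * C1%:E).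
  by apply: lee_wpmul2l => //; rewrite lee_fin !mulr_ge0// expR_ge0.
by rewrite -EFinM; congr _%:E; ring.
Qed.

Section characters.
Variable chi : seq A -> R.
Hypotheses (chi_gt0 : forall s, (0 < chi s)%R) (chi_nil : chi [::] = 1%R)
  (chiM : forall s t, chi (s ++ t) = (chi s * chi t)%R).

Let chi0 s : (0 <= chi s)%R. Proof. exact: ltW. Qed.

(** The case [h = chi], [l = 1], [kap = 0] of the renewal bound: a tilted block mass of at most 1
    allows at most linear growth. *)
Lemma char_upper (C C1 : R) :
  bsum w (fun b => (chi b)%:E) <= 1 ->
  (forall n, wsum n (fun s => rho s * (chi s)%:E) <= C%:E) ->
  (forall n, wsum n (fun s => rho1 s * (chi s)%:E) <= C%:E) ->
  bsum w1 (fun b => (chi b)%:E) <= C1%:E ->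
  exists C', forall n, wsum n (fun s => p s * (chi s)%:E) <= (C' * n.+1%:R)%:E.
Proof.
move=> hw hrho hrho1 hw1.
have bge0 : 0 <= bsum w (fun b => (chi b)%:E) by apply: bsum_ge0 => // b; rewrite lee_fin.
have [phi hphi] : exists phi : R, bsum w (fun b => (chi b)%:E) = phi%:E.
  exists (fine (bsum w (fun b => (chi b)%:E))); rewrite fineK// ge0_fin_numE//.
  by apply: le_lt_trans hw _; rewrite ltry.
have [||||C' C'0 hC'] := @renewal_upper R A w PD rho w0 PD0 rho0 w_nil renewal
  chi chi (fun L => chi (flatten L)) 1%N 0%R C phi isT (lexx _) _ _ chi_nil chiM hphi hrho.
- by move=> s; rewrite lexx chi0.
- by move=> L; exact: chi0.
- by move=> L s _; rewrite chiM.
- apply: le_trans hw; rewrite /= le_eqVlt; apply/orP; left; apply/eqP.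
  by apply: eq_bsum => b _; rewrite /= cats0 oppr0 mul0r expR0 mulr1.
exists (C + C1 * C')%R => n.
have := @delayed_upper chi chi C C1 C' 0%R (lexx _) C'0 chi0 chi0 hrho1 hw1 _ hC' n.
by rewrite mul0r expR0 mulr1; apply => b s; rewrite chiM.
Qed.

Variables (g : seq A -> R) (M : R) (K : nat).
Hypothesis g_bound : forall s, (0 <= g s <= M)%R.
Hypothesis g_local : forall s t, (K <= size s)%N -> g (s ++ t) = g s.

(** The function [h = chi e^(sig (S - mu n))] is not multiplicative. Over full superblocks it is
    split by [G], in which [M K] pays for the cut; over the first block and an incomplete superblock
    it is dominated by the multiplicative [chie], which has finite mass because [M sig <= eta]. *)
Lemma functional_upper (eta C C1 phi ell gam eps : R) :
  (0 < eta)%R -> (0 < eps)%R -> (0 < ell)%R ->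
  bsum w (fun b => (chi b)%:E) = 1 ->
  bsum w (fun b => (chi b * expR (eta * (size b)%:R))%:E) = phi%:E ->
  (forall n, wsum n (fun s => rho s * (chi s * expR (eta * (size s)%:R))%:E) <= C%:E) ->
  (forall n, wsum n (fun s => rho1 s * (chi s * expR (eta * (size s)%:R))%:E) <= C%:E) ->
  bsum w1 (fun b => (chi b * expR (eta * (size b)%:R))%:E) <= C1%:E ->
  bsum w (fun b => ((size b)%:R * chi b)%:E) = ell%:E ->
  bsumn w K.+1 (fun L => (headsum g L * chi (flatten L))%:E) = gam%:E ->
  exists2 sig, (0 < sig)%R & exists C', forall n,
    wsum n (fun s => p s * (chi s * expR (sig * (wordsum g s - gam / ell * n%:R)))%:E) <=
    (C' * n.+1%:R * expR (sig * eps / 2 * n%:R))%:E.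
Proof.
move=> eta0 eps0 ell0 hchi hphi hrho hrho1 hw1 hell hgam.
have wc0 s : 0 <= w s * (chi s)%:E by rewrite mule_ge0// lee_fin.
have tilt1 (G : seq A -> R) : (forall s, 0 <= G s)%R ->
    bsum (fun b => w b * (chi b)%:E) (fun b => (G b)%:E) =
    bsum w (fun b => (G b * chi b)%:E).
  by move=> G0; apply: eq_csum => b; rewrite -muleA -EFinM mulrC.
have tiltn m (G : seq (seq A) -> R) : (forall L, 0 <= G L)%R ->
    bsumn (fun b => w b * (chi b)%:E) m (fun L => (G L)%:E) =
    bsumn w m (fun L => (G L * chi (flatten L))%:E).
  by move=> G0; rewrite bsumn_tilt// => L; rewrite lee_fin.
have M0 : (0 <= M)%R by case/andP: (g_bound [::]) => a b; exact: le_trans b.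
have gam0 : (0 <= gam)%R.
  rewrite -lee_fin -hgam bsumn_ge0// => L.
  by rewrite lee_fin mulr_ge0// (headsum_ge0 g_bound).
have [|||||l [l0 [sig sig0 [sM hsig]]]] := @block_exp_moment R A (fun b => w b * (chi b)%:E)
  wc0 _ g M K g_bound g_local eta phi ell gam eps _ eta0 eps0 ell0.
- by rewrite w_nil mul0e.
- by rewrite (tilt1 (fun=> 1%R))// -[RHS]hchi; apply: eq_bsum => b _; rewrite mul1r.
- rewrite (tilt1 (fun b => expR (eta * (size b)%:R)))// -hphi.
  by apply: eq_bsum => b _; rewrite mulrC.
- by rewrite (tilt1 (fun b => (size b)%:R)).
- by rewrite tiltn// => L; exact: (headsum_ge0 g_bound).
exists sig => //.
pose mu := (gam / ell)%R.
have mu0 : (0 <= mu)%R by rewrite /mu divr_ge0// ltW.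
pose h s := (chi s * expR (sig * (wordsum g s - mu * (size s)%:R)))%R.
pose chie s := (chi s * expR (eta * (size s)%:R))%R.
have h0 s : (0 <= h s)%R by rewrite mulr_ge0// expR_ge0.
have chie0 s : (0 <= chie s)%R by rewrite mulr_ge0// expR_ge0.
have hle s : (h s <= chie s)%R.
  rewrite /h /chie ler_wpM2l// ler_expR.
  have := wordsum_le g_bound s; have := wordsum_ge0 g_bound s.
  have : (0 <= mu * (size s)%:R)%R by rewrite mulr_ge0.
  move: (size s)%:R (ler0n R (size s)) (wordsum g s) => x x0 W mux W0 WM.
  apply: (@le_trans _ _ (sig * (M * x))%R); first by rewrite ler_wpM2l ?(ltW sig0)//; lra.
  by rewrite mulrA ler_wpM2r// mulrC.
have hcat b s : (h (b ++ s) <= chie b * h s)%R.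
  have -> : (chie b * h s = chi b * chi s * (expR (eta * (size b)%:R) *
      expR (sig * (wordsum g s - mu * (size s)%:R))))%R by rewrite /chie /h; ring.
  rewrite /h chiM ler_wpM2l ?mulr_ge0// -expRD ler_expR size_cat natrD.
  have := wordsum_le g_bound b; have := wordsum_ge0 g_bound b.
  have -> : (wordsum g (b ++ s) = \sum_(j < size b) g (drop j b ++ s) + wordsum g s)%R.
    have := wordsum_flatten g b [:: s]; rewrite /= cats0 => ->; congr +%R.
    apply: eq_bigr => j _ /=; rewrite cats0 drop_cat.
    by rewrite ltn_ord.
  have : (\sum_(j < size b) g (drop j b ++ s) <= M * (size b)%:R)%R.
    apply: (@le_trans _ _ (\sum_(j < size b) M)%R).
      by apply: ler_sum => j _; case/andP: (g_bound (drop j b ++ s)).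
    by rewrite sumr_const card_ord mulr_natr.
  have : (0 <= mu * (size b)%:R)%R by rewrite mulr_ge0.
  move: (size b)%:R (ler0n R (size b)) => x x0 mux S _ _.
  have : (sig * (\sum_(j < size b) g (drop j b ++ s)) <= eta * x)%R.
    apply: (@le_trans _ _ (sig * (M * x))%R); first by rewrite ler_wpM2l ?(ltW sig0).
    by rewrite mulrA ler_wpM2r// mulrC.
  have : (0 <= sig * (mu * x))%R by rewrite mulr_ge0// ltW.
  lra.
pose kap := (sig * eps / 2)%R.
have kap0 : (0 <= kap)%R by rewrite /kap divr_ge0// mulr_ge0// ltW.
pose G L := (chi (flatten L) * expR (sig * (wordsum g (flatten L) -
   mu * (size (flatten L))%:R + M * K%:R)))%R.
have G0 L : (0 <= G L)%R by rewrite mulr_ge0// expR_ge0.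
have [|||||C' C'0 hC'] := @renewal_upper R A w PD rho w0 PD0 rho0 w_nil renewal
  h chie G l kap C phi l0 kap0 _ G0 _ _ hphi hrho.
- by move=> s; rewrite h0 hle.
- by rewrite /chie chi_nil mulr0 expR0 mulr1.
- by move=> s t; rewrite /chie chiM size_cat natrD mulrDr expRD mulrACA.
- move=> L s _; rewrite /h /G chiM [leRHS]mulrACA ler_wpM2l ?mulr_ge0//.
  rewrite -expRD ler_expR -mulrDr ler_wpM2l ?(ltW sig0)//.
  by have := wordsum_cat g_bound g_local (flatten L) s; rewrite size_cat natrD; lra.
- apply: le_trans hsig; rewrite tiltn//.
  rewrite le_eqVlt; apply/orP; left; apply/eqP; apply: eq_bsumn => L _ _; congr _%:E.
  by rewrite /G -mulrA -expRD mulrC mulNr.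
exists (C + C1 * C')%R => n.
have := @delayed_upper h chie C C1 C' kap kap0 C'0 h0 chie0 _ hw1 hcat hC' n.
rewrite (eq_wsum (h := fun s => p s * (chi s * expR (sig * (wordsum g s - gam / ell * n%:R)))%:E)).
  apply => k; apply: le_trans (hrho1 k); apply: le_wsum => s _.
  by rewrite lee_wpmul2l// lee_fin hle.
by move=> s sn; rewrite /h sn.
Qed.

End characters.
End tilted_bounds.

(** * The tilting exponent *)

Section root.
Context {R : realType}.

Lemma expR_convex (t u v : R) : 0 <= t <= 1 ->
  expR ((1 - t) * u + t * v) <= (1 - t) * expR u + t * expR v.
Proof.
move=> /andP[t0 t1]; set y := (X in expR X).
have h z : expR y * (1 + (z - y)) <= expR z.
  by rewrite -[leRHS](_ : expR y * expR (z - y) = _) ?ler_wpM2l ?expR_ge0 ?expR_ge1Dx// -expRD addrC subrK.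
have hu : (1 - t) * (expR y * (1 + (u - y))) <= (1 - t) * expR u by rewrite ler_wpM2l ?h// subr_ge0.
have hv : t * (expR y * (1 + (v - y))) <= t * expR v by rewrite ler_wpM2l ?h.
have e : (1 - t) * (expR y * (1 + (u - y))) + t * (expR y * (1 + (v - y))) = expR y.
  by rewrite /y; set E := expR _; ring.
by rewrite -e lerD.
Qed.

(** The root is the infimum [c] of the points of [[a', b]] where [phi <= 1]. A chord from [a] to a
    nearby point of this set passes over [c] and gives [phi c <= 1]; if [phi c < 1], the chord from
    [c] towards [a'] yields a smaller point of the set. Convexity thus replaces continuity, at the
    price of a point [a] to the left of [a']. *)
Lemma convex_root (phi : R -> R) (a a' b : R) : a < a' -> a' < b ->
  (forall x y t, a <= x -> a <= y -> 0 <= t <= 1 ->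
    phi ((1 - t) * x + t * y) <= (1 - t) * phi x + t * phi y) ->
  1 < phi a' -> phi b <= 1 -> exists2 c, a' < c & phi c = 1.
Proof.
move=> aa' a'b cvx pa' pb.
pose S := [set x | a' <= x <= b /\ phi x <= 1].
have Sb : S b by split => //; rewrite lexx ltW.
have infS : has_inf S by split; [exists b | exists a' => x [/andP[]]].
pose c := inf S.
have a'c : a' <= c by apply: lb_le_inf; [exists b | move=> x [/andP[]]].
have lec x : S x -> c <= x by move=> Sx; apply: ge_inf => //; case: infS.
have ac : a < c by exact: lt_le_trans a'c.
have pc1 : phi c <= 1.
  rewrite leNgt; apply/negP => pc.
  pose D := `|phi a| + 1.
  have D0 : 0 < D by rewrite ltr_wpDl.
  have del0 : 0 < (c - a) * (phi c - 1) / D.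
    by rewrite divr_gt0// mulr_gt0// subr_gt0.
  have [x Sx xlt] := inf_adherent del0 infS; rewrite -/c in xlt.
  have cx := lec x Sx; case: Sx => /andP[a'x xb] px.
  have xa : 0 < x - a by lra.
  pose t := (c - a) / (x - a).
  have t01 : 0 <= t <= 1.
    by rewrite /t divr_ge0 ?ler_pdivrMr ?mul1r//=; lra.
  have tx : t * (x - a) = c - a by rewrite /t divfK// gt_eqF.
  have := cvx a x t (lexx _) _ t01.
  have -> : (1 - t) * a + t * x = c by lra.
  move=> /(_ ltac:(lra)) h.
  have : (1 - t) * phi a <= (1 - t) * `|phi a| by rewrite ler_wpM2l ?ler_norm//; lra.
  have : t * phi x <= t by rewrite ler_piMr//; lra.
  move=> h1 h2.
  have h3 : phi c - 1 <= (1 - t) * D by rewrite /D; lra.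
  have h4 : (1 - t) * (c - a) <= x - c.
    have : (1 - t) * (c - a) <= (1 - t) * (x - a) by rewrite ler_wpM2l//; lra.
    by lra.
  move: xlt; rewrite -ltrBlDl ltr_pdivlMr// => h5.
  have : (phi c - 1) * (c - a) <= (1 - t) * D * (c - a) by rewrite ler_wpM2r//; lra.
  have : (1 - t) * (c - a) * D <= (x - c) * D by rewrite ler_wpM2r// ltW.
  by lra.
have pc2 : 1 <= phi c.
  rewrite leNgt; apply/negP => pc.
  pose t := (1 - phi c) / (phi a' - phi c).
  have d0 : 0 < phi a' - phi c by lra.
  have tE : t * (phi a' - phi c) = 1 - phi c by rewrite /t divfK// gt_eqF.
  have t0 : 0 < t by rewrite /t divr_gt0//; lra.
  have t1 : t <= 1 by rewrite /t ler_pdivrMr//; lra.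
  have a'c' : a' < c.
    by rewrite lt_neqAle a'c andbT; apply/eqP => a'E; move: pa'; rewrite a'E; lra.
  have := cvx c a' t (ltW ac) (ltW aa'); rewrite (ltW t0) t1 => /(_ isT).
  set y := (X in phi X) => hy.
  have yc : y < c by rewrite /y; have : t * (c - a') > 0 by [rewrite mulr_gt0// subr_gt0]; lra.
  have cb : c <= b := lec _ Sb.
  suff : c <= y by lra.
  apply: lec; split; last by lra.
  have : 0 <= (1 - t) * (c - a') by rewrite mulr_ge0//; lra.
  by rewrite /y => h2; apply/andP; split; rewrite /y in yc; lra.
exists c; last by apply/eqP; rewrite eq_le pc1 pc2.
by rewrite lt_neqAle a'c andbT; apply/eqP => a'E; move: pa'; rewrite a'E; lra.
Qed.

Lemma ereal_convex_root (Phi : R -> \bar R) (a a' b : R) : a < a' -> a' < b ->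
  (forall x, 0 <= Phi x)%E -> (forall x y, x <= y -> (Phi y <= Phi x)%E) ->
  (Phi a < +oo)%E ->
  (forall x y t, 0 <= t <= 1 ->
    (Phi ((1 - t) * x + t * y)%R <= (1 - t)%:E * Phi x + t%:E * Phi y)%E) ->
  (1 < Phi a')%E -> (Phi b <= 1)%E -> exists2 c, a' < c & Phi c = 1%E.
Proof.
move=> aa' a'b Phi0 PhiM fin cvx pa' pb.
have phiE x : a <= x -> Phi x = (fine (Phi x))%:E.
  move=> ax; rewrite fineK// ge0_fin_numE//.
  exact: le_lt_trans (PhiM _ _ ax) fin.
have [|||c a'c pc] := @convex_root (fine \o Phi) a a' b aa' a'b.
- move=> x y t ax ay t01 /=; rewrite -lee_fin EFinD !EFinM -!phiE//; first exact: cvx.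
  have /andP[t0 t1] := t01.
  have h1 : 0 <= (1 - t) * (x - a) by rewrite mulr_ge0// subr_ge0.
  have h2 : 0 <= t * (y - a) by rewrite mulr_ge0// subr_ge0.
  by lra.
- by rewrite /= -lte_fin -phiE// ltW.
- by rewrite /= -lee_fin -phiE// ltW// (lt_trans aa').
by exists c => //; rewrite phiE ?(ltW (lt_trans aa' a'c))//; congr _%:E.
Qed.
End root.

Section block_root.
Local Open Scope ereal_scope.
Context {R : realType} {A : finType}.
Variable w : seq A -> \bar R.
Hypothesis w0 : forall s, 0 <= w s.
Variable base : seq A -> R.
Hypothesis base0 : forall s, (0 <= base s)%R.

Let Phi (lam : R) := bsum w (fun b => (base b * expR (- lam * (size b)%:R))%:E).

Lemma bsum_expR_root (lam0 lam1 : R) :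
  Phi lam0 < +oo -> 1 < Phi lam0 -> (lam0 < lam1)%R -> Phi lam1 <= 1 ->
  exists2 lam, (lam0 < lam)%R & Phi lam = 1.
Proof.
move=> fin0 gt1 lam01 le1.
have t0 lam b : 0 <= (base b * expR (- lam * (size b)%:R))%:E.
  by rewrite lee_fin mulr_ge0// expR_ge0.
have Phi0 lam : 0 <= Phi lam by apply: bsum_ge0.
have PhiM x y : (x <= y)%R -> Phi y <= Phi x.
  move=> xy; apply: le_bsum => // b _.
  by rewrite lee_fin ler_wpM2l// ler_expR ler_wpM2r// lerN2.
(* [Phi] may be infinite to the left of [lam0], so [lam0] itself has to be the outer point [a] of
   the root lemma. A finite partial sum exceeds 1 at [lam0], and raising the exponent by [del] costs
   it at most the factor [e^(- del (N + 1))]. *)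
have [lam' [lam0' lam'1 gt1']] : exists lam', [/\ (lam0 < lam')%R, (lam' < lam1)%R & 1 < Phi lam'].
  pose S lam N := \sum_(0 <= n < N) wsum n (fun b => w b * (base b * expR (- lam * (size b)%:R))%:E).
  have SP lam N : S lam N <= Phi lam.
    by apply: nneseries_lim_ge => n _ _; apply: wsum_ge0 => s; rewrite mule_ge0.
  have [N SN] : exists N, 1 < S lam0 N.
    apply: contrapT => /forallNP h; move: gt1; apply/negP; rewrite -leNgt.
    apply: lime_le.
      by apply: is_cvg_nneseries => n _ _; apply: wsum_ge0 => s; rewrite mule_ge0.
    by apply: nearW => N; rewrite leNgt; apply/negP; exact: h.
  have SNfin : S lam0 N \is a fin_num.
    rewrite ge0_fin_numE ?(le_lt_trans (SP _ _))//.
    by apply: sume_ge0 => n _; apply: wsum_ge0 => s; rewrite mule_ge0.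
  pose sN := fine (S lam0 N).
  have sNE : S lam0 N = sN%:E by rewrite fineK.
  have sN1 : (1 < sN)%R by move: SN; rewrite sNE lte_fin.
  pose del := (Num.min ((lam1 - lam0) / 2) (ln sN / 2 / N.+1%:R))%R.
  have lnsN : (0 < ln sN)%R by rewrite ln_gt0.
  have del0 : (0 < del)%R.
    by rewrite lt_min !divr_gt0// subr_gt0.
  have del1 : (del <= (lam1 - lam0) / 2)%R by rewrite ge_min lexx.
  have del2 : (del * N.+1%:R <= ln sN / 2)%R.
    by rewrite -ler_pdivlMr// ge_min lexx orbT.
  exists (lam0 + del)%R; split; [by lra | by lra |].
  apply: lt_le_trans (SP _ N).
  apply: (@lt_le_trans _ _ ((expR (- (del * N.+1%:R)))%:E * S lam0 N)).
    rewrite sNE -EFinM lte_fin.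
    have {1}-> : (1 = expR 0 :> R)%R by rewrite expR0.
    rewrite -[X in (_ < _ * X)%R](@lnK R sN) ?posrE ?(lt_trans _ sN1)// -expRD ltr_expR.
    by lra.
  rewrite ge0_sume_distrr => [|n _]; last by apply: wsum_ge0 => s; rewrite mule_ge0.
  rewrite /S !big_nat; apply: lee_sum => n /andP[_ nN].
  rewrite -wsumZl => [|s]; last by rewrite mule_ge0.
  apply: le_wsum => s sn; rewrite muleCA lee_wpmul2l// -EFinM lee_fin mulrCA ler_wpM2l//.
  rewrite -expRD ler_expR sn.
  have : (n%:R <= N.+1%:R :> R)%R by rewrite ler_nat ltnW// ltnS ltnW.
  by move=> nN'; have : (del * n%:R <= del * N.+1%:R)%R; [rewrite ler_wpM2l// ltW | lra].
have cvx x y t : (0 <= t <= 1)%R ->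
    Phi ((1 - t) * x + t * y)%R <= (1 - t)%:E * Phi x + t%:E * Phi y.
  move=> /andP[t0' t1'].
  have s0 : (0 <= 1 - t)%R by lra.
  have p0 (r z : R) s : (0 <= r)%R ->
      0 <= r%:E * (base s * expR (- z * (size s)%:R))%:E.
    by move=> r0; apply: mule_ge0 => //; rewrite lee_fin.
  rewrite /Phi -!bsumZl ?lee_fin// -bsumD// => [|s|s]; try exact: p0.
  apply: le_bsum => // b _; rewrite -!EFinM -EFinD lee_fin.
  have := @expR_convex R t (- x * (size b)%:R) (- y * (size b)%:R).
  rewrite t0' t1' => /(_ isT) h.
  rewrite [leRHS](_ : _ = base b * ((1 - t) * expR (- x * (size b)%:R) + t * expR (- y * (size b)%:R)))%R; last by ring.
  rewrite ler_wpM2l//; apply: le_trans h; rewrite ler_expR.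
  by rewrite le_eqVlt; apply/orP; left; apply/eqP; ring.
have [c cl pc] := ereal_convex_root lam0' lam'1 Phi0 PhiM fin0 cvx gt1' le1.
by exists c => //; exact: lt_trans cl.
Qed.
End block_root.

(** * Words, characters and elementary estimates *)

Section layers.
Local Open Scope ereal_scope.
Context {R : realType} {dT : measure_display} {T : measurableType dT} (P : probability T R).

Let lay (g : R -> R) (m k : nat) : set R := [set y | k.+1%:R <= m%:R * g y]%R.

Lemma layer_approx (x : R) (m : nat) : (0 <= x <= 1)%R -> (0 < m)%N ->
  (m%:R^-1 * (\sum_(k < m) (k.+1%:R <= m%:R * x)%R%:R) <= x <=
   m%:R^-1 * (\sum_(k < m) (k.+1%:R <= m%:R * x)%R%:R) + m%:R^-1)%R.
Proof.
move=> /andP[x0 x1] m0.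
have mp : (0 < m%:R :> R)%R by rewrite ltr0n.
pose N := Num.truncn (m%:R * x)%R.
have mx0 : (0 <= m%:R * x)%R by rewrite mulr_ge0.
have Nm : (N <= m)%N.
  rewrite -(@ler_nat R); apply: (@le_trans _ _ (m%:R * x)%R); first by rewrite truncn_le.
  by rewrite ler_piMr// ltW.
have -> : (\sum_(k < m) (k.+1%:R <= m%:R * x)%R%:R = N%:R :> R)%R.
  rewrite (eq_bigr (fun k : 'I_m => (k < N)%N%:R)%R); last first.
    by move=> k _; congr (nat_of_bool _)%:R; rewrite truncn_ge_nat.
  rewrite -natr_sum; congr (_%:R).
  have -> : (\sum_(k < m) (k < N)%N = minn m N)%N; last by apply/minn_idPr.
  elim: (m) => [|k IH]; first by rewrite big_ord0 min0n.
  rewrite big_ord_recr/= IH; have [kN|Nk] := ltnP k N.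
    by rewrite addn1 !(minn_idPl _)// ltnW.
  by rewrite addn0 !(minn_idPr _)// (leq_trans Nk).
apply/andP; split; first by rewrite mulrC ler_pdivrMr// mulrC truncn_le.
have -> : (m%:R^-1 * N%:R + m%:R^-1 = N.+1%:R / m%:R :> R)%R by rewrite -addn1 natrD; ring.
by rewrite ler_pdivlMr// mulrC ltW// truncnS_gt.
Qed.

(** Up to [1 / m], [g] is the average of the [m] indicators of [k + 1 <= m g]. The hypothesis
    applies to each of them, and [m] is arbitrary. *)
Lemma layer_eq (V V' h h' : T -> R) (c : R) (g : R -> R) :
  measurable_fun setT V -> measurable_fun setT V' ->
  measurable_fun setT h -> measurable_fun setT h' ->
  (forall w, 0 <= h w <= 1)%R -> (forall w, 0 <= h' w <= 1)%R -> (0 <= c <= 1)%R ->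
  measurable_fun setT g -> (forall y, 0 <= g y <= 1)%R ->
  (forall B, measurable B ->
     \int[P]_w (\1_B (V w) * h w)%:E = c%:E * \int[P]_w (\1_B (V' w) * h' w)%:E) ->
  \int[P]_w (g (V w) * h w)%:E = c%:E * \int[P]_w (g (V' w) * h' w)%:E.
Proof.
move=> mV mV' mh mh' hb h'b /andP[c0 c1] mg gb HB.
have integralc (r : R) : \int[P]_w (cst r%:E w) = r%:E.
  by rewrite integral_cst// -[RHS]mule1; congr (_ * _); exact: probability_setT.
have mlay m k : measurable (lay g m k).
  rewrite /lay -[X in measurable X]setTI.
  have mf : measurable_fun setT (fun y => m%:R * g y)%R by apply: measurable_funM.
  have := mf measurableT `[k.+1%:R, +oo[%classic (measurable_itv _).
  by congr (measurable (_ `&` _)); apply/seteqP; split=> y /=; rewrite in_itv/= andbT.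
pose D (W k' : T -> R) m w := (m%:R^-1 * (\sum_(k < m) \1_(lay g m k) (W w)) * k' w)%R.
have DE (W k' : T -> R) m (mW : measurable_fun setT W) (mk : measurable_fun setT k') (kb : (forall w, 0 <= k' w <= 1)%R) :
    \int[P]_w (D W k' m w)%:E =
    (m%:R^-1)%:E * \sum_(k < m) \int[P]_w (\1_(lay g m k) (W w) * k' w)%:E.
  have mm k : measurable_fun setT (fun w => (\1_(lay g m k) (W w) * k' w)%:E).
    apply/measurable_EFinP; apply: measurable_funM => //.
    by apply: measurableT_comp => //; exact: measurable_indic.
  have k0 w : (0 <= k' w)%R by case/andP: (kb w).
  rewrite -ge0_integral_sum//; last by move=> k w _; rewrite lee_fin mulr_ge0.
  have s0 w : 0 <= \sum_(k < m) (\1_(lay g m k) (W w) * k' w)%:E.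
    by apply: sume_ge0 => k _; rewrite lee_fin mulr_ge0.
  rewrite -ge0_integralZl//; last exact: emeasurable_sum.
  apply: eq_integral => w _; rewrite sumEFin -EFinM; congr _%:E.
  by rewrite /D -mulrA; congr (_ * _)%R; rewrite mulr_suml.
have sandwich (W k' : T -> R) m (mW : measurable_fun setT W) (mk : measurable_fun setT k')
   (kb : (forall w, 0 <= k' w <= 1)%R) : (0 < m)%N ->
   \int[P]_w (D W k' m w)%:E <= \int[P]_w (g (W w) * k' w)%:E <=
   \int[P]_w (D W k' m w)%:E + (m%:R^-1)%:E.
  move=> m0.
  have b w : (D W k' m w <= g (W w) * k' w <= D W k' m w + m%:R^-1)%R.
    have /andP[l1 l2] := layer_approx (gb (W w)) m0.
    have -> : D W k' m w = (m%:R^-1 * (\sum_(k < m) (k.+1%:R <= m%:R * g (W w))%R%:R) * k' w)%R.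
      congr (_ * _ * _)%R; apply: eq_bigr => k _; rewrite indicE; congr (nat_of_bool _)%:R.
      by apply/idP/idP; rewrite inE.
    case/andP: (kb w) => k0 k1; apply/andP; split; first by rewrite ler_wpM2r.
    apply: (@le_trans _ _ ((m%:R^-1 * (\sum_(k < m) (k.+1%:R <= m%:R * g (W w))%R%:R) + m%:R^-1) * k' w)%R).
      by rewrite ler_wpM2r.
    by rewrite mulrDl lerD2l ler_piMr.
  have D0 w : (0 <= D W k' m w)%R.
    rewrite !mulr_ge0// ?sumr_ge0//; last by case/andP: (kb w).
  have mD : measurable_fun setT (D W k' m).
    apply: measurable_funM => //; apply: measurable_funM => //; apply: measurable_sum => k.
    by apply: measurableT_comp => //; exact: measurable_indic.
  have mgk : measurable_fun setT (fun w => (g (W w) * k' w)%R).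
    by apply: measurable_funM => //; exact: measurableT_comp.
  have g0 w : (0 <= g (W w) * k' w)%R by case/andP: (b w) => + _; exact: le_trans.
  apply/andP; split.
    apply: ge0_le_integral => //; [by move=> w _; rewrite lee_fin|exact/measurable_EFinP|exact/measurable_EFinP|].
    by move=> w _; rewrite lee_fin; case/andP: (b w).
  rewrite [leRHS](_ : _ = \int[P]_w ((D W k' m w)%:E + (m%:R^-1)%:E)); last first.
    rewrite ge0_integralD//; [|by move=> w _; rewrite lee_fin|exact/measurable_EFinP].
    by rewrite integralc.
  apply: ge0_le_integral => //; [by move=> w _; rewrite lee_fin|exact/measurable_EFinP| |].
    by apply: emeasurable_funD => //; exact/measurable_EFinP.
  by move=> w _; rewrite -EFinD lee_fin; case/andP: (b w).
have fin (W k' : T -> R) (mW : measurable_fun setT W) (mk : measurable_fun setT k')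
   (kb : (forall w, 0 <= k' w <= 1)%R) : exists2 r : R, (0 <= r <= 1)%R &
   \int[P]_w (g (W w) * k' w)%:E = r%:E.
  have i0 : 0 <= \int[P]_w (g (W w) * k' w)%:E.
    apply: integral_ge0 => w _; rewrite lee_fin mulr_ge0//.
      by case/andP: (gb (W w)).
    by case/andP: (kb w).
  have i1 : \int[P]_w (g (W w) * k' w)%:E <= 1.
    apply: (@le_trans _ _ (\int[P]_w (cst 1 w))); last first.
      by rewrite integralc.
    apply: ge0_le_integral => //.
    - move=> w _; rewrite lee_fin mulr_ge0//.
        by case/andP: (gb (W w)).
      by case/andP: (kb w).
    - apply/measurable_EFinP; apply: measurable_funM => //; exact: measurableT_comp.
    move=> w _; rewrite lee_fin.
    case/andP: (gb (W w)) => ? ?; case/andP: (kb w) => ? ?.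
    by rewrite mulr_ile1.
  exists (fine (\int[P]_w (g (W w) * k' w)%:E)).
    by rewrite fine_ge0//= -lee_fin fineK// ge0_fin_numE// (le_lt_trans i1)// ltry.
  by rewrite fineK// ge0_fin_numE// (le_lt_trans i1)// ltry.
have [r r01 rE] := fin V h mV mh hb; have [r' r'01 r'E] := fin V' h' mV' mh' h'b.
rewrite rE r'E -EFinM; congr _%:E.
have DD m : \int[P]_w (D V h m w)%:E = c%:E * \int[P]_w (D V' h' m w)%:E.
  rewrite !DE// muleCA; congr (_ * _); rewrite ge0_sume_distrr; last first.
    move=> k _; apply: integral_ge0 => w _; rewrite lee_fin mulr_ge0//.
    by case/andP: (h'b w).
  by apply: eq_bigr => k _; exact: HB.
suff dist m : (0 < m)%N -> (`|r - c * r'| <= m%:R^-1)%R.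
  apply/eqP; rewrite -subr_eq0 -normr_le0 leNgt; apply/negP => n0.
  pose m := (Num.truncn (`|r - c * r'|^-1)%R).+1.
  have := dist m isT; rewrite leNgt => /negP; apply.
  rewrite -[ltRHS]invrK ltf_pV2 ?posrE ?invr_gt0//; exact: truncnS_gt.
move=> m0.
have := sandwich V h m mV mh hb m0; have := sandwich V' h' m mV' mh' h'b m0.
rewrite DD rE r'E => /andP[a1 a2] /andP[].
have a0 : 0 <= \int[P]_w (D V' h' m w)%:E.
  apply: integral_ge0 => w _; rewrite lee_fin !mulr_ge0// ?sumr_ge0//.
  by case/andP: (h'b w).
have : \int[P]_w (D V' h' m w)%:E \is a fin_num.
  by rewrite ge0_fin_numE// (le_lt_trans a1)// ltry.
move: a0 a1 a2; case: (\int[P]_w (D V' h' m w)%:E) => // a a0 + + _.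
rewrite -!EFinM -!EFinD !lee_fin => a1 a2 a3 a4.
have mi : (0 <= m%:R^-1 :> R)%R by rewrite invr_ge0.
rewrite lee_fin in a0.
have b1 : (c * a <= c * r')%R by rewrite ler_wpM2l.
have b2 : (c * r' <= c * (a + m%:R^-1))%R by rewrite ler_wpM2l.
have b3 : (c * m%:R^-1 <= m%:R^-1)%R by rewrite ler_piMl.
by rewrite ler_norml; apply/andP; split; lra.
Qed.
End layers.

Section words.
Context {R : realType} {d : nat}.
Implicit Types (s t : seq (dir d)) (x y : site d).

Definition wpos s : site d := \sum_(z <- s) vec z.

Lemma wpos_nil : wpos [::] = 0. Proof. by rewrite /wpos big_nil. Qed.

Lemma wpos_cat s t : wpos (s ++ t) = wpos s + wpos t.
Proof. by rewrite /wpos big_cat. Qed.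

Lemma wpos_cons z s : wpos (z :: s) = vec z + wpos s.
Proof. by rewrite /wpos big_cons. Qed.

(** The transition probabilities which the quenched weight of a path multiplies. Repetitions are
    kept, since a revisited site contributes a power. *)
Fixpoint visits x s : seq (site d * dir d) :=
  if s is z :: s' then (x, z) :: visits (x + vec z) s' else [::].

Lemma visits_cat x s t : visits x (s ++ t) = visits x s ++ visits (x + wpos s) t.
Proof.
elim: s x => [|z s IH] x /=; first by rewrite wpos_nil addr0.
by rewrite IH wpos_cons addrA.
Qed.

Lemma visits_shift y s : visits y s = [seq (a.1 + y, a.2) | a <- visits 0 s].
Proof.
have gen x : visits (x + y) s = [seq (a.1 + y, a.2) | a <- visits x s].
  elim: s x => //= z s IH x; congr (_ :: _).
  by rewrite -IH addrAC.
by rewrite -gen add0r.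
Qed.

Lemma mem_visits y s a : a \in visits y s ->
  exists2 i, (i < size s)%N & a.1 = y + wpos (take i s).
Proof.
elim: s y => //= z s IH y; rewrite inE => /predU1P[->|/IH[i si ->]].
  by exists 0%N => //=; rewrite wpos_nil addr0.
by exists i.+1 => //=; rewrite wpos_cons addrA.
Qed.

Definition site_height (u : 'rV[R]_d) x : R := dotR (toR R x) u.

Lemma site_heightD u x y : site_height u (x + y) = site_height u x + site_height u y.
Proof.
rewrite /site_height /dotR -big_split/=; apply: eq_bigr => i _.
by rewrite !mxE intrD mulrDl.
Qed.

Lemma site_height0 u : site_height u 0 = 0.
Proof. by rewrite /site_height /dotR big1// => i _; rewrite !mxE mul0r. Qed.

Definition height u s : R := site_height u (wpos s).

Lemma height_nil u : height u [::] = 0.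
Proof. by rewrite /height wpos_nil site_height0. Qed.

Lemma height_cat u s t : height u (s ++ t) = height u s + height u t.
Proof. by rewrite /height wpos_cat site_heightD. Qed.

(** A cut of the path is a regeneration when the part before it satisfies [top] and the part after
    it satisfies [stay] over every horizon. *)
Definition top u s := all (fun i => height u (take i s) < height u s) (iota 0 (size s)).
Definition stay u s := all (fun i => 0 <= height u (take i s)) (iota 0 (size s).+1).

Lemma topP u s : reflect (forall i, (i < size s)%N -> height u (take i s) < height u s) (top u s).
Proof.
apply: (iffP allP) => h i; first by move=> si; apply: h; rewrite mem_iota.
by rewrite mem_iota => /andP[_ si]; exact: h.
Qed.

Lemma stayP u s : reflect (forall i, 0 <= height u (take i s)) (stay u s).
Proof.
apply: (iffP allP) => h i; last by move=> _; exact: h.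
have [si|si] := leqP i (size s); first by apply: h; rewrite mem_iota.
by rewrite take_oversize ?(ltnW si)// -[s]take_size; apply: h; rewrite mem_iota ltnS leqnn.
Qed.

End words.

Section wsum_integral.
Local Open Scope ereal_scope.
Context {R : realType} {A : finType}.

Lemma wsum_pick (r : seq A) (g : seq A -> \bar R) :
  wsum (size r) (fun s => if s == r then g s else 0) = g r.
Proof.
elim: r g => /= [|z r IH] g; first by rewrite ?eqxx.
rewrite (bigD1 z)//= -[RHS](IH (fun s => g (z :: s))) [X in _ + X]big1 ?adde0.
  by apply: eq_wsum => s _; rewrite eqseq_cons eqxx.
by move=> z' /negbTE nz; apply: wsum0 => s _; rewrite eqseq_cons nz.
Qed.

Lemma integral_wsum {dT : measure_display} {T : measurableType dT}
    (mu : {measure set T -> \bar R}) n (F : seq A -> T -> \bar R) :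
  (forall s, measurable_fun setT (F s)) -> (forall s w, 0 <= F s w) ->
  \int[mu]_w wsum n (F ^~ w) = wsum n (fun s => \int[mu]_w F s w) /\
  measurable_fun setT (fun w => wsum n (F ^~ w)).
Proof.
elim: n F => [|n IH] F mF F0 /=; first by split.
split; last by apply: emeasurable_sum => z; have [] := IH (fun s => F (z :: s)).
rewrite ge0_integral_sum//.
- by apply: eq_bigr => z _; have [] := IH (fun s => F (z :: s)).
- by move=> z; have [] := IH (fun s => F (z :: s)).
- by move=> z w _; exact: wsum_ge0.
Qed.
End wsum_integral.

Section csum_integral.
Local Open Scope ereal_scope.
Context {R : realType} {A : finType}.

Lemma csum_pick (r : seq A) (g : seq A -> \bar R) :
  csum (fun s => if s == r then g s else 0) = g r.
Proof.
rewrite -[RHS](wsum_pick r g) -csum_size; apply: eq_csum => s.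
by case: (eqVneq s r) => [->|]; rewrite ?eqxx ?if_same.
Qed.

Lemma integral_csum {dT : measure_display} {T : measurableType dT}
    (mu : {measure set T -> \bar R}) (F : seq A -> T -> \bar R) :
  (forall s, measurable_fun setT (F s)) -> (forall s w, 0 <= F s w) ->
  \int[mu]_w csum (F ^~ w) = csum (fun s => \int[mu]_w F s w) /\
  measurable_fun setT (fun w => csum (F ^~ w)).
Proof.
move=> mF F0; have m n := (integral_wsum mu n mF F0).2.
split; last first.
  by apply: ge0_emeasurable_sum => [n w _ _|n _]; [exact: wsum_ge0 | exact: m].
rewrite /csum integral_nneseries//; last by move=> n w _; exact: wsum_ge0.
by apply: eq_eseriesr => n _; have [] := integral_wsum mu n mF F0.
Qed.

(** Taken from the definition of the integral as a supremum over simple functions, so that it covers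
    majorants whose measurability is not established, such as the supremum in the nestling
    moment. *)
Lemma ge0_integral_dom {dT : measure_display} {T : measurableType dT}
    (mu : {measure set T -> \bar R}) (f g : T -> \bar R) :
  (forall w, 0 <= f w) -> (forall w, f w <= g w) ->
  \int[mu]_w f w <= \int[mu]_w g w.
Proof.
move=> f0 fg; have g0 w : 0 <= g w by exact: le_trans (fg w).
rewrite !ge0_integralTE//; apply: le_ereal_sup => x [h hf <-].
by exists h => // w; exact: le_trans (hf w) (fg w).
Qed.
End csum_integral.

Section character.
Context {R : realType} {d : nat}.
Implicit Types (t : 'rV[R]_d) (s : seq (dir d)).

Lemma dotRDr t (x y : 'rV[R]_d) : dotR t (x + y) = dotR t x + dotR t y.
Proof. by rewrite /dotR -big_split/=; apply: eq_bigr => i _; rewrite mxE mulrDr. Qed.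

Lemma toRD (x y : site d) : toR R (x + y) = toR R x + toR R y.
Proof. by apply/rowP => i; rewrite !mxE intrD. Qed.

Lemma dot_nil t : dotR t (toR R (wpos [::])) = 0.
Proof. by rewrite wpos_nil /dotR big1// => i _; rewrite !mxE mulr0. Qed.

Definition chi t (lam : R) s : R := expR (dotR t (toR R (wpos s)) - lam * (size s)%:R).

Lemma chi_gt0 t lam s : 0 < chi t lam s. Proof. exact: expR_gt0. Qed.

Lemma chi_nil t lam : chi t lam [::] = 1.
Proof. by rewrite /chi dot_nil mulr0 subrr expR0. Qed.

Lemma chi_cat t lam s s' : chi t lam (s ++ s') = chi t lam s * chi t lam s'.
Proof.
rewrite /chi wpos_cat toRD dotRDr size_cat natrD -expRD; congr expR; ring.
Qed.

(** Finiteness of a block sum at [lam - eta] is therefore an exponential moment of order [eta] of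
    the length under the tilt at [lam]. *)
Lemma chi_shift t lam eta s :
  chi t (lam - eta) s = chi t lam s * expR (eta * (size s)%:R).
Proof. by rewrite /chi -expRD; congr expR; ring. Qed.

End character.

Section euclid.
Context {R : realType} {d : nat}.
Implicit Types (a b : 'rV[R]_d) (s : seq (dir d)).

Lemma enorm_ge0 a : 0 <= enorm a. Proof. exact: sqrtr_ge0. Qed.

Lemma enorm_sqr a : enorm a ^+ 2 = \sum_(i < d) a 0 i ^+ 2.
Proof. by rewrite sqr_sqrtr// sumr_ge0// => i _; rewrite sqr_ge0. Qed.

Lemma coord_le_enorm a i : `|a 0 i| <= enorm a.
Proof.
rewrite -(@ler_sqr _ `|a 0 i|) ?nnegrE ?enorm_ge0// enorm_sqr real_normK ?num_real//.
by rewrite (bigD1 i)//= lerDl sumr_ge0// => j _; rewrite sqr_ge0.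
Qed.

Lemma enorm_eq0 a : enorm a = 0 -> a = 0.
Proof.
move=> a0; apply/rowP => i; rewrite mxE; apply/eqP; rewrite -normr_le0 -a0.
exact: coord_le_enorm.
Qed.

(** Cauchy-Schwarz, by expanding the sum of the squares of [a_i |b| - b_i |a|]. *)
Lemma dotR_le_enorm a b : dotR a b <= enorm a * enorm b.
Proof.
have [a0|an] := eqVneq (enorm a) 0.
  rewrite a0 mul0r /dotR (enorm_eq0 a0) big1// => i _; by rewrite mxE mul0r.
have [b0|bn] := eqVneq (enorm b) 0.
  rewrite b0 mulr0 /dotR (enorm_eq0 b0) big1// => i _; by rewrite mxE mulr0.
have ap : 0 < enorm a by rewrite lt_neqAle eq_sym an enorm_ge0.
have bp : 0 < enorm b by rewrite lt_neqAle eq_sym bn enorm_ge0.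
have : 0 <= \sum_(i < d) (a 0 i * enorm b - b 0 i * enorm a) ^+ 2.
  by apply: sumr_ge0 => i _; rewrite sqr_ge0.
have -> : \sum_(i < d) (a 0 i * enorm b - b 0 i * enorm a) ^+ 2 =
    (enorm a ^+ 2) * enorm b ^+ 2 + (enorm b ^+ 2) * enorm a ^+ 2
    - 2 * (enorm a * enorm b) * dotR a b.
  rewrite {1}[enorm a ^+ 2]enorm_sqr {2}[enorm b ^+ 2]enorm_sqr !mulr_suml /dotR mulr_sumr.
  rewrite -sumrN -!big_split/=; apply: eq_bigr => i _; ring.
move=> h; rewrite -(ler_pM2l (mulr_gt0 ap bp)); lra.
Qed.

Lemma abs_dotR_le a b : `|dotR a b| <= enorm a * enorm b.
Proof.
rewrite ler_norml dotR_le_enorm andbT lerNl.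
have -> : - dotR a b = dotR (- a) b.
  by rewrite /dotR -sumrN; apply: eq_bigr => i _; rewrite mxE mulNr.
have -> : enorm a = enorm (- a); last exact: dotR_le_enorm.
by congr Num.sqrt; apply: eq_bigr => i _; rewrite mxE sqrrN.
Qed.

Lemma dotRC a b : dotR a b = dotR b a.
Proof. by apply: eq_bigr => i _; rewrite mulrC. Qed.

Lemma dot_vec a (z : dir d) : dotR a (toR R (vec z)) = (if z.2 then 1 else -1) * a 0 z.1.
Proof.
rewrite /dotR (bigD1 z.1)//= big1 ?addr0 => [|i iz].
  by rewrite !mxE !eqxx/=; case: z.2 => /=; rewrite ?mulr1 ?mulr1z ?mulrN1 ?mulrN1z; ring.
by rewrite !mxE (negbTE iz) /= mulr0 mulr0.
Qed.

Lemma abs_dot_vec a (z : dir d) : `|dotR a (toR R (vec z))| <= enorm a.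
Proof.
rewrite dot_vec.
by rewrite normrM; case: z.2; rewrite ?normrN normr1 mul1r coord_le_enorm.
Qed.

Lemma abs_dot_wpos a s : `|dotR a (toR R (wpos s))| <= enorm a * (size s)%:R.
Proof.
elim: s => [|z s IH]; first by rewrite dot_nil normr0 mulr0.
rewrite wpos_cons toRD dotRDr /= -add1n natrD mulrDr mulr1.
by rewrite (le_trans (ler_normD _ _))// lerD ?abs_dot_vec.
Qed.

End euclid.

Section growth_rates.
Context {R : realType}.

Lemma expR_not_linear (a C : R) (N : nat) : 0 < a ->
  ~ (forall n, (N <= n)%N -> expR (a * n%:R) <= C * n.+1%:R).
Proof.
move=> a0 h.
have C0 : 0 < C.
  have := h N (leqnn _) => hN; have : 0 < C * N.+1%:R by apply: lt_le_trans hN; exact: expR_gt0.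
  by rewrite pmulr_lgt0.
pose n := maxn N (Num.truncn (8 * C / a ^+ 2)).+1.
have := h n (leq_maxl _ _) => hn.
have n1 : 1 <= n%:R :> R by rewrite ler1n leq_max orbT.
have := @sqr_le_expR R (a * n%:R); rewrite mulr_ge0 ?(ltW a0)// => /(_ isT) h1.
have h2 : 8 * C / a ^+ 2 < n%:R.
  by apply: (lt_le_trans (truncnS_gt _)); rewrite ler_nat leq_maxr.
rewrite ltr_pdivrMr ?exprn_gt0// in h2.
rewrite -addn1 natrD in hn.
have h3 : C * (n%:R + 1) <= C * (2 * n%:R) by rewrite ler_pM2l//; lra.
have h4 : a ^+ 2 * n%:R ^+ 2 <= 8 * C * n%:R by rewrite -exprMn; lra.
have : 8 * C * n%:R < n%:R * a ^+ 2 * n%:R by rewrite ltr_pM2r//; lra.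
by rewrite expr2 in h4 *; move: (n%:R) (a ^+ 2) h4 => x y; nra.
Qed.

Lemma cvg_div_nat (x : nat -> R) (lam : R) :
  (forall kap, 0 < kap -> exists K, forall n, `|x n - lam * n%:R| <= K + kap * n%:R) ->
  (fun n => x n / n%:R) @ \oo --> lam.
Proof.
move=> h; apply/cvgrPdist_le => e e0.
have e2 : 0 < e / 2 by rewrite divr_gt0.
have [K hK] := h _ e2.
exists (Num.truncn (`|K| / (e / 2))).+1 => //= n Nn.
have n0 : 0 < n%:R :> R by rewrite ltr0n (leq_trans _ Nn).
have -> : lam - x n / n%:R = - ((x n - lam * n%:R) / n%:R) by field; rewrite gt_eqF.
rewrite normrN normrM normfV (gtr0_norm n0) ler_pdivrMr//.
apply: (le_trans (hK n)).
have : `|K| / (e / 2) < n%:R by apply: (lt_le_trans (truncnS_gt _)); rewrite ler_nat.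
rewrite ltr_pdivrMr// => h1; have := ler_norm K; lra.
Qed.

Lemma linear_le_expR (kap : R) : 0 < kap ->
  exists2 D, 0 < D & forall n : nat, n.+1%:R <= D * expR (kap * n%:R).
Proof.
move=> k0; exists (1 + kap^-1); first by rewrite addr_gt0 ?invr_gt0.
move=> n; have h := @expR_ge1Dx R (kap * n%:R).
have kn : kap^-1 * (kap * n%:R) = n%:R by rewrite mulrA mulVf ?mul1r// gt_eqF.
have ki : 0 < kap^-1 by rewrite invr_gt0.
have h1 : kap^-1 * (1 + kap * n%:R) <= kap^-1 * expR (kap * n%:R) by rewrite ler_pM2l.
have : 1 <= expR (kap * n%:R) by rewrite -[leLHS]expR0 ler_expR mulr_ge0// ltW.
rewrite mulrDr kn mulr1 in h1.
by rewrite -addn1 natrD mulrDl mul1r => h2; lra.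
Qed.
End growth_rates.

Section directional.
Context {R : realType}.

Lemma directional_increment (V : normedModType R) (L : V -> R) (t v : V) (l e : R) :
  is_derive t v L l -> 0 < e ->
  exists2 r, 0 < r & forall h, 0 < `|h| < r -> `|L (t + h *: v) - L t - h * l| <= e * `|h|.
Proof.
move=> [dl vl] e0; have /cvgrPdist_le/(_ _ e0) := dl.
rewrite -[lim _]/('D_v L t) vl => -[r /= r0 hr]; exists r => // h /andP[h0 hlt].
have := hr h; rewrite /= sub0r normrN => /(_ hlt).
rewrite -normr_gt0 => /(_ h0) {}hr.
have hn : h != 0 by rewrite -normr_gt0.
have -> : L (t + h *: v) - L t - h * l = - h * (l - h^-1 *: (L (h *: v + t) - L t)).
  by rewrite mulNr mulrBr [h *: v + t]addrC -[h^-1 *: _]/(h^-1 * _) mulVKf//; ring.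
by rewrite normrM normrN mulrC ler_wpM2r.
Qed.

Lemma expR_decay (a eta : R) : 0 < a -> 0 < eta ->
  exists N, forall n, (N <= n)%N -> expR (- (a * n%:R)) <= eta.
Proof.
move=> a0 eta0; exists (Num.bound (a * eta)^-1) => n Nn.
have b : (a * eta)^-1 < n%:R.
  apply: lt_le_trans (archi_boundP _) _; last by rewrite ler_nat.
  by rewrite invr_ge0 mulr_ge0// ltW.
rewrite expRN invf_ple ?posrE ?expR_gt0//.
apply: le_trans (expR_ge1Dx _).
by move: b; rewrite -(ltr_pM2l a0) invfM mulrA mulfV ?gt_eqF// mul1r => b; lra.
Qed.

Context {d : nat}.
Implicit Types a b : 'rV[R]_d.

Lemma enormD a b : enorm (a + b) <= enorm a + enorm b.
Proof.
rewrite -ler_sqr ?nnegrE ?addr_ge0 ?enorm_ge0// sqrrD !enorm_sqr.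
have -> : \sum_(i < d) (a + b) 0 i ^+ 2 =
    \sum_(i < d) a 0 i ^+ 2 + 2 * dotR a b + \sum_(i < d) b 0 i ^+ 2.
  by rewrite mulr_sumr -!big_split/=; apply: eq_bigr => i _; rewrite mxE; ring.
by rewrite lerD2r lerD2l; have := dotR_le_enorm a b; lra.
Qed.

Lemma enormZ (h : R) a : 0 <= h -> enorm (h *: a) = h * enorm a.
Proof.
move=> h0; rewrite /enorm -{2}(ger0_norm h0) -sqrtr_sqr -sqrtrM ?sqr_ge0// mulr_sumr.
by congr Num.sqrt; apply: eq_bigr => i _; rewrite mxE exprMn.
Qed.

Lemma enorm_vec (z : dir d) : enorm (toR R (vec z)) <= 1.
Proof.
set e := toR R (vec z); have [->|n0] := eqVneq (enorm e) 0; first by [].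
have e0 : 0 < enorm e by rewrite lt_neqAle eq_sym n0 enorm_ge0.
rewrite -(ler_pM2l e0) mulr1 -expr2 enorm_sqr.
have -> : \sum_(i < d) e 0 i ^+ 2 = dotR e (toR R (vec z)).
  by apply: eq_bigr => i _; rewrite expr2.
exact: le_trans (ler_norm _) (abs_dot_vec _ _).
Qed.

Lemma dotRDl a b v : dotR (a + b) v = dotR a v + dotR b v.
Proof. by rewrite !(dotRC _ v) dotRDr. Qed.

Lemma dotRZl (h : R) a v : dotR (h *: a) v = h * dotR a v.
Proof. by rewrite /dotR mulr_sumr; apply: eq_bigr => i _; rewrite mxE mulrA. Qed.

Lemma enorm_le_coord (x : R) a : 0 <= x ->
  (forall i, `|a 0 i| <= x / d.+1%:R) -> enorm a <= x.
Proof.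
move=> x0 h; rewrite -ler_sqr ?nnegrE ?enorm_ge0// enorm_sqr.
apply: (@le_trans _ _ (\sum_(i < d) (x / d.+1%:R) ^+ 2)).
  apply: ler_sum => i _; rewrite -[leLHS]real_normK ?num_real// ler_sqr ?nnegrE//.
  by rewrite divr_ge0.
rewrite sumr_const card_ord -[leLHS]mulr_natl expr_div_n mulrCA ler_piMr ?sqr_ge0//.
rewrite ler_pdivrMr ?exprn_gt0// mul1r -natrX ler_nat; lia.
Qed.

End directional.

Section exponents.
Context {R : realType}.
Implicit Types b e eps k kap l m n sig x y : R.

(** Bookkeeping for the final exponents: [l] stands for [Lambda_a(theta)], [b] for [<theta,xi>], [e]
    for [|theta| del], [y] for [<theta,X_n>], [x] for the sum of [f] along the path, [m] for its
    mean under mu_xi and [k] for the boundary error [2 M K]. *)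
Lemma exponent_ge0 b e eps k l m n sig x y :
  sig * (eps * n - k) <= sig * (x - m * n) -> b * n - e * n <= y ->
  0 <= (l - b + e - sig * eps) * n + sig * k + (y - l * n + sig * (x - m * n)).
Proof. lra. Qed.

Lemma exponent_half b e eps k l n sig :
  (l - b + e - sig * eps) * n + sig * k + sig * eps / 2 * n =
  sig * k + (l - b + e - sig * eps / 2) * n.
Proof. by field. Qed.

Lemma exponent_le0 b e n y : y <= b * n + e * n -> (- b - e) * n + y <= 0.
Proof. lra. Qed.

Lemma exponent_final b e kap l : 2 * e <= kap / 8 ->
  (kap + kap) / 8 + (l - b + e - kap) <= - (kap / 2) + (l - kap / 8 - b - e).
Proof. lra. Qed.

End exponents.

Section limsup.
Context {R : realType}.

Lemma le_lne_expR (r x : R) : r <= expR x -> (lne r%:E <= x%:E)%E.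
Proof.
move=> rx; rewrite /lne; case: ifPn => [_|]; first exact: leNye.
rewrite -ltNge => r0; rewrite lee_fin -(expRK x) ler_ln ?posrE ?expR_gt0//.
Qed.

Lemma limsup0_decay (r : R -> nat -> R) (b del0 : R) : 0 < del0 ->
  (forall del, 0 < del < del0 ->
    exists N, forall n, (N <= n)%N -> r del n <= expR (- b * n%:R)) ->
  (limsup0 (fun del => limn_esup (fun n => (n%:R^-1)%:E * lne (r del n)%:E)) <= (- b)%:E)%E.
Proof.
move=> d0 h; rewrite /limsup0.
apply: (@le_trans _ _ (ereal_sup [set limn_esup (fun n => ((n%:R^-1)%:E * lne (r x n)%:E)%E)
   | x in [set x | 0 < x < del0]])).
  by apply: ereal_inf_lbound; exists del0.
apply: ge_ereal_sup => _ [del dd <-]; have [N hN] := h del dd.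
(* The strict inequality excludes [n = 0], where the inverse of [n] is 0. *)
apply: (@le_trans _ _ (ereal_sup [set ((n%:R^-1)%:E * lne (r del n)%:E)%E
   | n in [set n | (N < n)%N]])).
  by apply: ereal_inf_lbound; exists [set n | (N < n)%N] => //; exists N.+1.
apply: ge_ereal_sup => _ [n /= Nn <-].
have n0 : 0 < n%:R :> R by rewrite ltr0n (leq_trans _ Nn).
have := le_lne_expR (hN n (ltnW Nn)).
rewrite -(@lee_pmul2l _ (n%:R^-1)%:E) ?lte_fin ?invr_gt0// => /le_trans; apply.
by rewrite -EFinM lee_fin mulrC mulfK ?gt_eqF.
Qed.

End limsup.

(** * The averaged walk and its regeneration structure *)

Section random_walk.
Local Open Scope ereal_scope.
Context {R : realType} {d : nat} {dT : measure_display} {T : measurableType dT}.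
Variables (P : probability T R) (pi : T -> site d -> dir d -> R) (Zs : T -> nat -> dir d)
  (u : 'rV[R]_d).
Hypothesis pi_meas : forall x z, measurable_fun setT (fun w => pi w x z).
Hypothesis Z_meas : forall k z, measurable [set w | Zs w k = z].
Hypothesis envP : forall w x, ((forall z, 0 <= pi w x z) /\ \sum_(z : dir d) pi w x z = 1)%R.
Hypothesis iid : forall (S : seq (site d)) (B : site d -> dir d -> set R),
  uniq S -> (forall x z, measurable (B x z)) ->
  P (envcyl pi S B) = \prod_(x <- S) P (envcyl pi [:: 0%R] (fun _ => B x)).
Hypothesis law : forall (S : seq (site d)) (B : site d -> dir d -> set R)
    (n : nat) (s : n.-tuple (dir d)), (forall x z, measurable (B x z)) ->
  P (envcyl pi S B `&` [set w | forall i : 'I_n, Zs w i = tnth s i])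
  = \int[P]_(w in envcyl pi S B) (qpath (pi w) s)%:E.

(** * Independence of the environment at distinct sites *)

Section environment.

Let dirs : seq (dir d) := index_enum ('I_d * bool)%type.

Let Phi S (G : site d -> dir d -> R -> R) :=
  \int[P]_w (\prod_(x <- S) \prod_(z : dir d) G x z (pi w x z))%:E.
Let Psi S (G : site d -> dir d -> R -> R) :=
  \prod_(x <- S) \int[P]_w (\prod_(z : dir d) G x z (pi w 0%R z))%:E.

Lemma prod_ge0_le1 (I : Type) (r : seq I) (Q : pred I) (F : I -> R) :
  (forall i, 0 <= F i <= 1)%R -> (0 <= \prod_(i <- r | Q i) F i <= 1)%R.
Proof.
move=> F01; elim/big_ind : _ => [|x y /andP[x0 x1] /andP[y0 y1]|i _]//.
  by rewrite ler01 lexx.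
by rewrite mulr_ge0 ?mulr_ile1.
Qed.

Lemma eprod_ge0_le1 (I : Type) (r : seq I) (Q : pred I) (F : I -> \bar R) :
  (forall i, 0 <= F i <= 1) -> 0 <= \prod_(i <- r | Q i) F i <= 1.
Proof.
move=> F01; elim/big_ind : _ => [|x y /andP[x0 x1] /andP[y0 y1]|i _]//.
  by rewrite lee01 lexx.
by rewrite mule_ge0//= -[leRHS]mule1 lee_pmul.
Qed.

Lemma integral_01 (X : T -> R) : measurable_fun setT X -> (forall w, 0 <= X w <= 1)%R ->
  0 <= \int[P]_w (X w)%:E <= 1.
Proof.
move=> mX X01; apply/andP; split.
  by apply: integral_ge0 => w _; rewrite lee_fin; case/andP: (X01 w).
rewrite [leRHS](_ : _ = \int[P]_w (cst 1 w)); last first.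
  by rewrite integral_cst// -[LHS]mule1; congr (_ * _); exact/esym/probability_setT.
apply: ge0_le_integral => //; [|exact/measurable_EFinP|].
  by move=> w _; rewrite lee_fin; case/andP: (X01 w).
by move=> w _; rewrite lee_fin; case/andP: (X01 w).
Qed.

Lemma mprod (I : eqType) (r : seq I) (Q : pred I) (F : I -> T -> R) :
  (forall i, measurable_fun setT (F i)) ->
  measurable_fun setT (fun w => \prod_(i <- r | Q i) F i w)%R.
Proof.
move=> mF; under eq_fun do rewrite -big_filter.
exact: measurable_prod.
Qed.

Let indicator_fun (g : R -> R) := exists2 B : set R, measurable B & g = \1_B.

Let upd (G : site d -> dir d -> R -> R) x0 z0 g x z :=
  if (x == x0) && (z == z0) then g else G x z.

(* The product hypothesis only concerns events: the factors are replaced by indicator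
   functions one coordinate at a time, by means of [layer_eq]. *)
Lemma env_prod (S : seq (site d)) (G : site d -> dir d -> R -> R) : uniq S ->
  (forall x z, measurable_fun setT (G x z)) ->
  (forall x z y, 0 <= G x z y <= 1)%R ->
  Phi S G = Psi S G.
Proof.
move=> uS; pose l := [seq (x, z) | x <- S, z <- dirs].
(* Induction on [l], the list of coordinates whose factor need not yet be an indicator. It starts
   with all of them; for the empty list the claim is the product hypothesis for events. *)
have : forall x z, x \in S -> (x, z) \notin l -> indicator_fun (G x z).
  by move=> x z xS /negP[]; rewrite allpairs_f// mem_index_enum.
elim: l G => [|[x0 z0] l IH] G Gl mG G01.
  have {}Gl x z : x \in S -> indicator_fun (G x z) by move=> xS; exact: Gl.
  pose B x z := if x \in S then [set y | G x z y = 1%R] else set0.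
  have GB x z : x \in S -> G x z = \1_(B x z) /\ measurable (B x z).
    move=> xS; have [B' mB' GB'] := Gl x z xS; rewrite /B xS.
    suff -> : [set y | G x z y = 1%R] = B' by rewrite GB'.
    rewrite GB'; apply/seteqP; split => y /=; rewrite indicE.
      by case: (boolP (y \in B')) => [/set_mem//|_ /eqP]; rewrite eq_sym oner_eq0.
    by move=> /mem_set ->.
  have mB x z : measurable (B x z).
    by have [/(GB _ z)[]//|nS] := boolP (x \in S); rewrite /B (negbTE nS).
  have indE (S' : seq (site d)) (B' : site d -> dir d -> set R) (Y : T -> site d -> dir d -> R) w :
      (\prod_(x <- S') \prod_(z : dir d) \1_(B' x z) (Y w x z) =
      \1_[set w | forall x, x \in S' -> forall z, B' x z (Y w x z)] w :> R)%R.
    rewrite indicE; case: (boolP (w \in _)) => [/set_mem/= h|/negP h].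
      rewrite big_seq big1// => x xS; rewrite big1// => z _.
      by rewrite indicE mem_set//; exact: h.
    have [x [xS [z nz]]] : exists x, x \in S' /\ exists z, ~ B' x z (Y w x z).
      apply: contrapT => h'; apply: h; apply: mem_set => x xS z.
      by apply: contrapT => h2; apply: h'; exists x; split => //; exists z.
    rewrite (big_rem x)//= (bigD1 z)//= indicE memNset// !mul0r//.
  have mcyl (S' : seq (site d)) (B' : site d -> dir d -> set R) (y : site d -> site d) :
      (forall x z, measurable (B' x z)) ->
      measurable [set w | forall x, x \in S' -> forall z, B' x z (pi w (y x) z)].
    move=> mB'.
    have -> : [set w | forall x, x \in S' -> forall z, B' x z (pi w (y x) z)] =
        \bigcap_(x in [set x | x \in S']) \bigcap_(z in [set: dir d])
          ((fun w => pi w (y x) z) @^-1` B' x z).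
      by apply/seteqP; split => w /= h x xS => [z _|z]; [exact: h|exact: (h x xS z)].
    apply: fin_bigcap_measurable => [|x _]; first exact: finite_seq.
    apply: fin_bigcap_measurable => [|z _]; first exact: finite_finset.
    by rewrite -[X in measurable X]setTI; exact: pi_meas.
  transitivity (P (envcyl pi S B)).
    rewrite /Phi.
    transitivity (\int[P]_w (\1_(envcyl pi S B) w)%:E).
      apply: eq_integral => w _; rewrite -(indE S B pi); congr _%:E.
      by apply: eq_big_seq => x xS; apply: eq_bigr => z _; case: (GB x z xS) => ->.
    by rewrite integral_indic ?setIT//; exact: (mcyl S B id).
  rewrite iid// /Psi; apply: eq_big_seq => x xS.
  transitivity (\int[P]_w (\1_(envcyl pi [:: 0%R] (fun=> B x)) w)%:E).
    by rewrite integral_indic ?setIT//; exact: (mcyl [:: 0%R] (fun=> B x) id).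
  apply: eq_integral => w _; rewrite -(indE _ (fun=> B x) pi) big_seq1; congr _%:E.
  by apply: eq_bigr => z _; case: (GB x z xS) => ->.
have [x0S|nx0S] := boolP (x0 \in S); last first.
  apply: IH => // x z xS nl; apply: Gl => //; rewrite inE negb_or nl andbT.
  by apply: contraNneq nx0S => -[<-].
pose h w := ((\prod_(z : dir d | z != z0) G x0 z (pi w x0 z)) *
   \prod_(x <- S | x != x0) \prod_(z : dir d) G x z (pi w x z))%R.
pose h' w := (\prod_(z : dir d | z != z0) G x0 z (pi w 0 z))%R.
pose C := \prod_(x <- S | x != x0) \int[P]_w (\prod_(z : dir d) G x z (pi w 0%R z))%:E.
have mGpi x y z : measurable_fun setT (fun w => G x z (pi w y z)).
  exact: measurableT_comp.
have /andP[C0 C1] : 0 <= C <= 1.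
  by apply: eprod_ge0_le1 => x; apply: integral_01 => [|w]; [exact: mprod|exact: prod_ge0_le1].
have Cfin : C = (fine C)%:E by rewrite fineK// ge0_fin_numE// (le_lt_trans C1)// ltry.
have PhiE g : Phi S (upd G x0 z0 g) = \int[P]_w (g (pi w x0 z0) * h w)%:E.
  apply: eq_integral => w _; congr _%:E; rewrite (bigD1_seq x0)//= (bigD1 z0)//=.
  rewrite /upd !eqxx/= -mulrA; congr (_ * (_ * _))%R.
    by apply: eq_bigr => z /negbTE ->.
  by apply: eq_bigr => x /negbTE -> /=.
have PsiE g : Psi S (upd G x0 z0 g) = C * \int[P]_w (g (pi w 0%R z0) * h' w)%:E.
  rewrite /Psi (bigD1_seq x0)//= muleC; congr (_ * _).
    by apply: eq_bigr => x /negbTE nx; rewrite /upd nx.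
  apply: eq_integral => w _; congr _%:E; rewrite (bigD1 z0)//= /upd !eqxx/=.
  by congr (_ * _)%R; apply: eq_bigr => z /negbTE ->.
have updG : upd G x0 z0 (G x0 z0) = G.
  by apply/funext => x; apply/funext => z; rewrite /upd; case: andP => // -[/eqP-> /eqP->].
(* As functions of the single factor at [(x0, z0)] both sides have the form treated by [layer_eq];
   an indicator in that place removes the pair from the list. *)
rewrite -updG PhiE PsiE Cfin.
apply: layer_eq => //.
- by apply: measurable_funM; apply: mprod => // x; exact: mprod.
- exact: mprod.
- move=> w; have /andP[a0 a1] := prod_ge0_le1 dirs (fun z => z != z0) (fun z => G01 x0 z (pi w x0 z)).
  have /andP[b0 b1] := prod_ge0_le1 S (fun x => x != x0)
    (fun x => prod_ge0_le1 dirs predT (fun z => G01 x z (pi w x z))).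
  by rewrite /h mulr_ge0 ?mulr_ile1.
- by move=> w; exact: prod_ge0_le1.
- by rewrite -!lee_fin -Cfin C0.
move=> B mB; rewrite -Cfin -(PhiE \1_B) -(PsiE \1_B); apply: IH.
- move=> x z xS nl; rewrite /upd; case: ifPn => [_|nxz]; first by exists B.
  by apply: Gl => //; rewrite inE negb_or nl andbT xpair_eqE.
- by move=> x z; rewrite /upd; case: ifP => // _; exact: measurable_indic.
- move=> x z y; rewrite /upd; case: ifP => // _; rewrite indicE.
  by case: (_ \in _); rewrite !lexx ler01.
Qed.

End environment.

(** * Averaged path probabilities *)

Section annealed_weight.
Implicit Types (A B : seq (site d * dir d)).

Definition mono A := \int[P]_w (\prod_(a <- A) pi w a.1 a.2)%:E.

Lemma pi01 w x z : (0 <= pi w x z <= 1)%R.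
Proof.
have [p0 p1] := envP w x; rewrite p0/= -p1 (bigD1 z)//= lerDl.
by apply: sumr_ge0.
Qed.

Lemma prod_count (F : site d -> dir d -> R) (S : seq (site d)) A : uniq S ->
  {subset map fst A <= S} ->
  (\prod_(a <- A) F a.1 a.2 =
   \prod_(x <- S) \prod_(z : dir d) F x z ^+ count_mem (x, z) A)%R.
Proof.
move=> uS; elim: A => [_|[x0 z0] A IH AS] /=.
  by rewrite big_nil big1// => x _; rewrite big1.
rewrite big_cons IH; last by move=> x xA; apply: AS; rewrite inE xA orbT.
have x0S : x0 \in S by apply: AS; rewrite inE eqxx.
under [RHS]eq_bigr do under eq_bigr do rewrite exprD.
under [RHS]eq_bigr do rewrite big_split/=.
rewrite big_split/=; congr (_ * _)%R.
rewrite (bigD1_seq x0)//= (bigD1 z0)//= eqxx expr1 big1 => [|z nz].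
  rewrite mulr1 big1 ?mulr1// => x nx; rewrite big1// => z _.
  by rewrite xpair_eqE eq_sym (negbTE nx).
by rewrite xpair_eqE eqxx eq_sym (negbTE nz).
Qed.

(** The product formula asks for factors bounded by 1 on the whole line, whereas powers are so only
    on [[0, 1]]; [clamp] is the identity at all values of [pi]. *)
Let clamp (y : R) : R := Num.min (Num.max y 0%R) 1%R.

Lemma clampE (y : R) : (0 <= y <= 1)%R -> clamp y = y.
Proof. by case/andP => y0 y1; rewrite /clamp (max_idPl y0) (min_idPl y1). Qed.

Lemma monoE (S : seq (site d)) A : uniq S -> {subset map fst A <= S} ->
  mono A = \prod_(x <- S) \int[P]_w (\prod_(z : dir d) pi w 0%R z ^+ count_mem (x, z) A)%:E.
Proof.
move=> uS AS; pose G x z y := (clamp y ^+ count_mem (x, z) A)%R.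
have mclamp : measurable_fun setT clamp.
  by apply: measurable_minr => //; exact: measurable_maxr.
have clamp01 y : (0 <= clamp y <= 1)%R.
  by rewrite /clamp le_min ler01 le_max lexx orbT ge_min lexx orbT.
have mG x z : measurable_fun setT (G x z) by exact: measurable_funX.
have G01 x z y : (0 <= G x z y <= 1)%R.
  by case/andP: (clamp01 y) => a b; rewrite exprn_ge0//= exprn_ile1.
have h := env_prod uS mG G01.
transitivity (\int[P]_w (\prod_(x <- S) \prod_(z : dir d) G x z (pi w x z))%:E).
  apply: eq_integral => w _; congr _%:E; rewrite (prod_count (pi w) uS AS).
  by apply: eq_bigr => x _; apply: eq_bigr => z _; rewrite /G clampE ?pi01.
rewrite h; apply: eq_bigr => x _; apply: eq_integral => w _; congr _%:E.
by apply: eq_bigr => z _; rewrite /G clampE ?pi01.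
Qed.

Lemma mono_cat A B : (forall a b, a \in A -> b \in B -> a.1 != b.1) ->
  mono (A ++ B) = mono A * mono B.
Proof.
move=> AB; pose SA := undup (map fst A); pose SB := undup (map fst B).
have uS : uniq (SA ++ SB).
  rewrite cat_uniq !undup_uniq andbT/=; apply/hasPn => x.
  rewrite mem_undup => /mapP[b bB ->]; change (b.1 \notin SA); rewrite mem_undup.
  by apply/mapP => -[a aA /esym/eqP]; apply/negP; exact: AB.
rewrite (@monoE (SA ++ SB))//; last first.
  by move=> x; rewrite map_cat !mem_cat !mem_undup.
rewrite (@monoE SA) ?undup_uniq//; last by move=> x; rewrite mem_undup.
rewrite (@monoE SB) ?undup_uniq//; last by move=> x; rewrite mem_undup.
have cnt0 x z (C : seq (site d * dir d)) : (forall c, c \in C -> c.1 != x) -> count_mem (x, z) C = 0%N.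
  move=> Cx; apply/count_memPn; apply/negP => xC.
  by have := Cx _ xC; rewrite eqxx.
rewrite big_cat/=; congr (_ * _); apply: eq_big_seq => x; rewrite mem_undup => /mapP[c cC ->];
  apply: eq_integral => w _; congr _%:E; apply: eq_bigr => z _; congr (_ ^+ _)%R;
  rewrite count_cat.
- by rewrite [X in (_ + X)%N]cnt0 ?addn0// => b bB; rewrite eq_sym AB.
- by rewrite [X in (X + _)%N]cnt0 ?add0n// => a aA; rewrite AB.
Qed.

Lemma mono_shift (y : site d) A : mono [seq (a.1 + y, a.2)%R | a <- A] = mono A.
Proof.
pose S := undup (map fst A); pose sh (x : site d) := (x + y)%R.
have shI : injective sh by move=> a b; exact: addIr.
rewrite (@monoE S A) ?undup_uniq//; last by move=> x; rewrite mem_undup.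
rewrite (@monoE (map sh S)) ?map_inj_uniq ?undup_uniq//; last first.
  move=> x /mapP[a /mapP[b bA ->] ->] /=; apply: map_f; rewrite mem_undup.
  exact: map_f.
rewrite big_map; apply: eq_bigr => x _; apply: eq_integral => w _; congr _%:E.
apply: eq_bigr => z _; congr (_ ^+ _)%R; rewrite count_map; apply: eq_count => -[x' z'] /=.
by rewrite !xpair_eqE (inj_eq shI).
Qed.

Definition pw (s : seq (dir d)) := mono (visits (0 : site d)%R s).

Lemma pw_ge0 s : 0 <= pw s.
Proof.
apply: integral_ge0 => w _; rewrite lee_fin; apply: prodr_ge0 => a _.
by case/andP: (pi01 w a.1 a.2).
Qed.

(** Every site left during [s] lies strictly below the end of [s], every site left during [t] lies
    at or above it. The two parts read disjoint environments, and the second is shifted back to the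
    origin. *)
Lemma pw_cat s t : top u s -> stay u t -> pw (s ++ t) = pw s * pw t.
Proof.
move=> /topP tops /stayP stayt.
rewrite /pw visits_cat add0r mono_cat => [|a b /mem_visits[i si ->]].
  by rewrite [visits (wpos s) t]visits_shift mono_shift.
move=> /mem_visits[j jt ->]; rewrite add0r; apply/eqP => /(congr1 (site_height u)).
rewrite site_heightD; have := tops i si; have := stayt j; rewrite /height.
by move=> a1 a2 a3; lra.
Qed.

Definition cyl (s : seq (dir d)) : set T := [set w | mkseq (Zs w) (size s) = s].

Lemma sum_take (z0 : dir d) (s : seq (dir d)) j :
  (\sum_(i < size s | (i < j)%N) vec (nth z0 s i) = wpos (take j s))%R.
Proof.
elim: s j => [|z s IH] [|j] /=; rewrite /wpos ?big_ord0 ?big_nil//.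
  by rewrite big_pred0.
rewrite big_cons -[X in _ = (_ + X)%R]/(wpos (take j s)) -IH big_mkcond big_ord_recl/=.
by congr +%R; rewrite -big_mkcond.
Qed.

Lemma xposE n (s : n.-tuple (dir d)) (j : nat) : xpos s j = wpos (take j s).
Proof.
case: n s => [|n] s.
  by rewrite tuple0/= /xpos big_ord0 /wpos big_nil.
rewrite -(sum_take (thead s)) /xpos size_tuple.
by apply: eq_bigr => i _; rewrite (tnth_nth (thead s)).
Qed.

Lemma prod_visits (z0 : dir d) (F : site d -> dir d -> R) (s : seq (dir d)) x :
  (\prod_(a <- visits x s) F a.1 a.2 =
   \prod_(i < size s) F (x + wpos (take i s)) (nth z0 s i))%R.
Proof.
elim: s x => [|z s IH] x /=; first by rewrite big_nil big_ord0.
rewrite big_cons big_ord_recl/= wpos_nil addr0 IH; congr (_ * _)%R.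
by apply: eq_bigr => i _; rewrite wpos_cons addrA.
Qed.

Lemma cyl_pw s : P (cyl s) = pw s.
Proof.
have := @law [::] (fun _ _ => setT) (size s) (in_tuple s) (fun _ _ => measurableT).
have -> : envcyl pi [::] (fun _ _ => setT) = setT by apply/seteqP; split.
rewrite setTI => h; transitivity (\int[P]_w (qpath (pi w) (in_tuple s))%:E).
  rewrite -h; congr (P _); apply/seteqP; split => w /=.
    move=> ws i; rewrite (tnth_nth (Zs w i)) /=.
    by have := congr1 (fun l => nth (Zs w i) l i) ws; rewrite nth_mkseq.
  move=> ws; case: s {h} ws => // z s ws.
  apply: (@eq_from_nth _ z); rewrite ?size_mkseq// => i si.
  by rewrite nth_mkseq// (ws (Ordinal si)) (tnth_nth z).
apply: eq_integral => w _; congr _%:E; rewrite /qpath.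
case: (s) => [|z t]; first by rewrite big_ord0 big_nil.
rewrite (prod_visits z); apply: eq_bigr => i _.
by rewrite xposE add0r (tnth_nth z).
Qed.

Lemma cyl_measurable s : measurable (cyl s).
Proof.
have -> : cyl s = \bigcap_(i in [set: 'I_(size s)]) [set w | Zs w i = tnth (in_tuple s) i].
  apply/seteqP; split => w /=.
    move=> ws i _ /=; rewrite (tnth_nth (Zs w i)) /=.
    by have := congr1 (fun l => nth (Zs w i) l i) ws; rewrite nth_mkseq.
  move=> ws; case: s ws => // z s ws.
  apply: (@eq_from_nth _ z); rewrite ?size_mkseq// => i si.
  by rewrite nth_mkseq// (ws (Ordinal si))//= (tnth_nth z).
by apply: fin_bigcap_measurable => //; exact: finite_finset.
Qed.

Lemma pw_step (c1 : R) z : (forall z, P [set w | (c1 <= pi w 0%R z)%R] = 1) ->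
  c1%:E <= pw [:: z].
Proof.
move=> h; have mB : measurable [set w | (c1 <= pi w 0%R z)%R].
  have -> : [set w | (c1 <= pi w 0%R z)%R] = (fun w => pi w 0%R z) @^-1` `[c1, +oo[%classic.
    by apply/seteqP; split => w /=; rewrite in_itv/= andbT.
  by rewrite -[X in measurable X]setTI; exact: pi_meas.
have [c0|c0] := leP 0%R c1; last by apply: le_trans (pw_ge0 _); rewrite lee_fin ltW.
have -> : pw [:: z] = \int[P]_w (pi w 0%R z)%:E.
  by apply: eq_integral => w _; rewrite /= big_seq1.
rewrite -[leLHS]mule1 -(h z) -integral_cst//.
have mpi : measurable_fun setT (fun w => (pi w 0%R z)%:E) by exact/measurable_EFinP.
apply: (@le_trans _ _ (\int[P]_(w in [set w | (c1 <= pi w 0%R z)%R]) (pi w 0%R z)%:E)).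
  apply: ge0_le_integral => //.
  exact: measurable_funS mpi.
apply: ge0_subset_integral => // w _; rewrite lee_fin.
by case/andP: (pi01 w 0%R z).
Qed.

End annealed_weight.

(** * Regeneration times as conditions on finite paths *)

Section regeneration.
Implicit Types (s t a b : seq (dir d)) (w : T).

(* [firstw]: trajectories up to the first regeneration time; [blockw]: trajectories
   between two consecutive regeneration times. *)
Definition firstw a := [&& (0 < size a)%N, top u a &
  all (fun j => ~~ (top u (take j a) && stay u (drop j a))) (iota 1 (size a).-1)].

Definition blockw a := firstw a && stay u a.

Definition pfx w n := mkseq (Zs w) n.
Definition stayD k : set T := [set w | forall m, (height u (pfx w k) <= height u (pfx w (k + m)))%R].

Lemma size_pfx w n : size (pfx w n) = n. Proof. exact: size_mkseq. Qed.

Lemma take_pfx w i n : (i <= n)%N -> take i (pfx w n) = pfx w i.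
Proof. by move=> le_in; rewrite /pfx /mkseq -map_take take_iota (minn_idPl le_in). Qed.

Lemma height_drop w i n : (i <= n)%N ->
  height u (drop i (pfx w n)) = (height u (pfx w n) - height u (pfx w i))%R.
Proof.
move=> le_in; rewrite -[in X in (X - _)%R](cat_take_drop i (pfx w n)) height_cat take_pfx//.
by rewrite addrC addKr.
Qed.

Lemma height_take_drop w i j n : (i + j <= n)%N ->
  height u (take j (drop i (pfx w n))) = (height u (pfx w (i + j)) - height u (pfx w i))%R.
Proof.
move=> ijn; rewrite take_drop addnC take_pfx// height_drop//.
by rewrite leq_addr.
Qed.

Lemma hgtE w k : hgt Zs u w k = height u (pfx w k).
Proof.
rewrite /hgt /height /site_height /walk /wpos /pfx /mkseq big_map.
by rewrite -[k in iota 0 k]subn0 -/(index_iota 0 k) big_mkord.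
Qed.

Lemma DinfE : Dinf Zs u = stayD 0.
Proof. by apply/seteqP; split => w /= h m; have := h m; rewrite !hgtE. Qed.

Lemma top_pfxP w k : reflect (forall i, (i < k)%N -> (height u (pfx w i) < height u (pfx w k))%R)
  (top u (pfx w k)).
Proof.
apply: (iffP (topP u _)); rewrite size_pfx => h i ik; have := h i ik;
  by rewrite take_pfx// ltnW.
Qed.

Lemma stay_dropP w k n : (k <= n)%N ->
  reflect (forall m, (k + m <= n)%N -> (height u (pfx w k) <= height u (pfx w (k + m)))%R)
  (stay u (drop k (pfx w n))).
Proof.
move=> kn; apply: (iffP (stayP u _)) => h m.
  by move=> kmn; have := h m; rewrite height_take_drop// subr_ge0.
have [kmn|] := leqP (k + m) n; first by rewrite height_take_drop// subr_ge0 h.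
move=> nkm; rewrite take_oversize ?height_drop// ?subr_ge0; last first.
  by rewrite size_drop size_pfx leq_subLR ltnW.
by have := h (n - k)%N; rewrite subnKC// => /(_ (leqnn _)).
Qed.

Lemma stayD_stay w k n : stayD k w -> stay u (drop k (pfx w n)).
Proof.
move=> wk; have [kn|nk] := leqP k n; first by apply/stay_dropP => // m _; exact: wk.
rewrite drop_oversize ?size_pfx 1?ltnW//.
by apply/stayP => i; rewrite height_nil.
Qed.

Lemma regenE w j : regen Zs u w j <-> top u (pfx w j) /\ stayD j w.
Proof.
split => [[h1 h2]|[/top_pfxP h1 h2]]; split.
- by apply/top_pfxP => i ij; have := h1 i ij; rewrite !hgtE.
- move=> m; case: m => [|m]; first by rewrite addn0.
  by have := h2 (j + m.+1)%N; rewrite !hgtE addnS ltnS leq_addr => /(_ isT).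
- by move=> i ij; rewrite !hgtE; exact: h1.
- by move=> k jk; rewrite !hgtE -(subnKC (ltnW jk)); exact: h2.
Qed.

Lemma stayD_trans w i j : (i <= j)%N -> stay u (drop i (pfx w j)) -> stayD j w -> stayD i w.
Proof.
move=> ij /(stay_dropP _ ij) h wj m.
have [imj|jim] := leqP (i + m) j; first exact: h.
apply: (@le_trans _ _ (height u (pfx w j))).
  by have := h (j - i)%N; rewrite subnKC// => /(_ (leqnn _)).
by rewrite -(subnKC (ltnW jim)); exact: wj.
Qed.

Section after.
Variables (w : T) (k : nat).
Hypothesis below : forall i j, (i < k)%N -> (k <= j)%N -> (height u (pfx w i) < height u (pfx w j))%R.

(** The section hypothesis makes [k] a separating time: earlier positions are beaten by all later
    ones, so records after [k] are records of the shifted path. It is vacuous for [k = 0] and holds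
    when [k] is a regeneration time. *)
Lemma top_after j : (k <= j)%N -> top u (pfx w j) = top u (drop k (pfx w j)).
Proof.
move=> kj; apply/top_pfxP/topP => h i.
  rewrite size_drop size_pfx => ijk; rewrite height_take_drop ?height_drop//; last first.
    by rewrite -leq_subRL// ltnW.
  by rewrite ltrD2r; apply: h; rewrite -ltn_subRL.
move=> ij; have [ik|ki] := ltnP i k; first exact: below.
have := h (i - k)%N; rewrite size_drop size_pfx ltn_sub2rE// => /(_ ij).
by rewrite height_take_drop ?subnKC ?(ltnW ij)// height_drop// ltrD2r.
Qed.

(** Once the path stays above its level at [j], it stays above an earlier level forever as soon as
    it does so up to [j]. Whether an earlier time is a regeneration is then decided by the finite
    word between [k] and [j]. *)
Lemma first_regen_afterP j : (k < j)%N ->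
  (regen Zs u w j /\ forall i, (k < i)%N -> (i < j)%N -> ~ regen Zs u w i) <->
  (firstw (drop k (pfx w j)) /\ stayD j w).
Proof.
move=> kj; have lekj := ltnW kj.
have reg i : (k < i)%N -> (i < j)%N -> stayD j w -> (regen Zs u w i <->
    top u (take (i - k) (drop k (pfx w j))) && stay u (drop (i - k) (drop k (pfx w j)))).
  move=> ki ij wj; rewrite regenE (@top_after i) ?(ltnW ki)//.
  rewrite take_drop subnK ?(ltnW ki)// take_pfx ?(ltnW ij)//.
  rewrite drop_drop subnK ?(ltnW ki)//; split => [[-> /stayD_stay->//]|/andP[-> st]].
  by split => //; apply: (stayD_trans (ltnW ij)).
rewrite /firstw size_drop size_pfx subn_gt0 kj/= -top_after//.
split=> [[/regenE[tj wj] h]|[/andP[tj /allP h] wj]].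
  split => //; rewrite tj/=; apply/allP => i; rewrite mem_iota => /andP[i0 ij].
  have ikj : (i + k < j)%N by rewrite -ltn_subRL addnC in ij *; lia.
  have ki : (k < i + k)%N by rewrite -[X in (X < _)%N]add0n ltn_add2r.
  have r := reg (i + k)%N ki ikj wj; rewrite addnK in r.
  by apply/negP => /r; exact: h.
split; first exact/regenE.
move=> i ki ij /(reg i ki ij wj); apply/negP/h; rewrite mem_iota; lia.
Qed.

Lemma next_regenP j : next_regen Zs u w k = Some j <->
  [/\ (k < j)%N, firstw (drop k (pfx w j)) & stayD j w].
Proof.
rewrite /next_regen; case: pselect => [ex|nex]; last first.
  split => // -[kj fj wj]; exfalso; apply: nex; exists j; split => //.
  by have [] := (first_regen_afterP kj).2 (conj fj wj).
pose Q := [set j | [/\ (k < j)%N, regen Zs u w j &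
   forall i, (k < i)%N -> regen Zs u w i -> (j <= i)%N]].
have Qj i : Q i <-> [/\ (k < i)%N, firstw (drop k (pfx w i)) & stayD i w].
  split=> [[ki ri h]|[ki fi wi]].
    have h' l : (k < l)%N -> (l < i)%N -> ~ regen Zs u w l.
      by move=> kl li rl; have := h l kl rl; rewrite leqNgt li.
    by have [] := (first_regen_afterP ki).1 (conj ri h').
  have [ri h] := (first_regen_afterP ki).2 (conj fi wi); split => // l kl rl.
  by rewrite leqNgt; apply/negP => li; exact: (h l kl li).
have Quniq i l : Q i -> Q l -> i = l.
  by move=> [ki ri hi] [kl rl hl]; apply/eqP; rewrite eqn_leq hi// hl.
rewrite -Qj -/Q; split => [[<-]|Qjj].
  apply: (@xgetPex _ 0%N Q).
  have exb : exists l, `[< (k < l)%N /\ regen Zs u w l >] by case: ex => l h; exists l; apply/asboolP.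
  case: (ex_minnP exb) => l /asboolP[kl rl] hl; exists l; split => // i ki ri.
  by apply: hl; apply/asboolP.
congr Some; apply: (Quniq _ _ _ Qjj).
by apply: (@xgetPex _ 0%N Q); exists j.
Qed.
End after.
End regeneration.

(** * Renewal equations of the averaged walk *)

Section renewal_structure.
Implicit Types (s t a b : seq (dir d)) (w : T) (E : set T).

Let mcyl s : measurable (cyl s). Proof. exact: cyl_measurable. Qed.
Local Hint Resolve mcyl : core.

Lemma cyl_pfx w n : cyl (pfx w n) w.
Proof. by rewrite /cyl/= size_pfx. Qed.

Lemma cyl_cat_pfx s r w : cyl (s ++ r) w <-> cyl s w /\ r = drop (size s) (pfx w (size s + size r)).
Proof.
rewrite /cyl/= size_cat -!/(pfx w _); split=> [h|[h ->]].
  rewrite h drop_size_cat//; split => //.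
  by rewrite -(take_pfx w (leq_addr (size r) (size s))) h take_size_cat.
rewrite size_drop size_pfx addKn -[LHS](cat_take_drop (size s)).
by rewrite take_pfx ?leq_addr// h.
Qed.

Lemma cyl_extend E k s : measurable E ->
  P (E `&` cyl s) = wsum k (fun r => P (E `&` cyl (s ++ r))).
Proof.
move=> mE.
have PE (X : set T) : measurable X -> P X = \int[P]_w (\1_X w)%:E.
  by move=> mX; rewrite integral_indic// setIT.
rewrite PE; last exact: measurableI.
transitivity (\int[P]_w wsum k (fun r => (\1_(E `&` cyl (s ++ r)) w : R)%:E)).
  apply: eq_integral => w _.
  pose r0 := drop (size s) (pfx w (size s + k)).
  have sr0 : size r0 = k by rewrite size_drop size_pfx addKn.
  transitivity (wsum (size r0) (fun r => if r == r0 then (\1_(E `&` cyl s) w : R)%:E else 0)).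
    by rewrite wsum_pick.
  rewrite sr0; apply: eq_wsum => r rk; rewrite !indicE.
  have cr : cyl (s ++ r) w <-> cyl s w /\ r = r0 by rewrite cyl_cat_pfx rk.
  case: eqP => [rr0|nr].
    congr (nat_of_bool _)%:R%:E; apply/idP/idP => /set_mem[Ew cw]; apply/mem_set; split => //.
      exact/cr.
    by have [] := cr.1 cw.
  by rewrite memNset// => -[_ /cr[]].
have mF r : measurable_fun setT (fun w => (\1_(E `&` cyl (s ++ r)) w : R)%:E).
  by apply/measurable_EFinP; apply: measurable_indic; exact: measurableI.
have F0 r w : 0 <= (\1_(E `&` cyl (s ++ r)) w : R)%:E by rewrite lee_fin.
have [-> _] := integral_wsum P k mF F0.
by apply: eq_wsum => r _; rewrite -PE//; exact: measurableI.
Qed.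

(** Finite-horizon version of [stayD], decided by finitely many steps and hence computable from path
    weights; [stayD] is its decreasing limit. *)
Definition stayDm k m : set T :=
  [set w | forall j, (j <= m)%N -> (height u (pfx w k) <= height u (pfx w (k + j)))%R].

Lemma measurable_pfx n (Q : pred (seq (dir d))) : measurable [set w | Q (pfx w n)].
Proof.
have -> : [set w | Q (pfx w n)] = \bigcup_(t in [set t : n.-tuple (dir d) | Q t]) cyl t.
  apply/seteqP; split => w /=.
    move=> Qw; exists (Tuple (introT eqP (size_pfx w n))) => //.
    exact: cyl_pfx.
  by move=> [t Qt wt]; rewrite -[n](size_tuple t) /pfx wt.
by apply: fin_bigcup_measurable => [|t _]; [exact: finite_finset | exact: mcyl].
Qed.

Lemma stayDmE k m : stayDm k m =
  \bigcap_(j in [set j | (j <= m)%N]) [set w | (height u (pfx w k) <= height u (pfx w (k + j)))%R].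
Proof. by apply/seteqP; split => w /= h j; exact: h. Qed.

Lemma measurable_height k l : measurable [set w | (height u (pfx w k) <= height u (pfx w l))%R].
Proof.
have -> : [set w | (height u (pfx w k) <= height u (pfx w l))%R] =
    [set w | (fun s => height u (take k s) <= height u (take l s))%R (pfx w (maxn k l))].
  by apply/seteqP; split => w /=; rewrite !take_pfx ?leq_maxl ?leq_maxr.
exact: (@measurable_pfx _ (fun s => height u (take k s) <= height u (take l s))%R).
Qed.

Lemma measurable_stayDm k m : measurable (stayDm k m).
Proof.
by rewrite stayDmE; apply: bigcap_measurableType => j _; exact: measurable_height.
Qed.

Lemma stayDE k : stayD k = \bigcap_m stayDm k m.
Proof.
apply/seteqP; split => w /= h; first by move=> m _ j _; exact: h.
by move=> m; exact: (h m I m).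
Qed.

Lemma measurable_stayD k : measurable (stayD k).
Proof. by rewrite stayDE; apply: bigcapT_measurable => m; exact: measurable_stayDm. Qed.

Lemma cvg_stayDm k C : measurable C -> forall l,
  P (stayDm k (l + n)%N `&` C) @[n --> \oo] --> P (stayD k `&` C).
Proof.
move=> mC l.
have -> : stayD k `&` C = \bigcap_n (stayDm k (l + n) `&` C).
  apply/seteqP; split => w /=.
    by move=> [h Cw] n _; split => // j _; exact: h.
  move=> h; split; last by case: (h 0%N I).
  by move=> m; have [/(_ m (leq_addl _ _))] := h m I.
apply: nonincreasing_cvg_mu => //.
- rewrite (le_lt_trans (probability_le1 _ _))// ?ltry//.
  by apply: measurableI => //; exact: measurable_stayDm.
- by move=> i; apply: measurableI => //; exact: measurable_stayDm.
- by apply: bigcapT_measurable => i; apply: measurableI => //; exact: measurable_stayDm.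
- move=> m n mn; apply/subsetPset => w [h Cw]; split => // j jm; apply: h.
  by rewrite (leq_trans jm)// leq_add2l.
Qed.

(** Over a finite horizon the event is a disjoint union of cylinders, and [pw_cat] factorises each
    of those that satisfy [stay]. *)
Lemma P_stayDm_cyl s t k : top u s ->
  P (stayDm (size s) (size t + k) `&` cyl (s ++ t)) =
  pw s * wsum k (fun r => if stay u (t ++ r) then pw (t ++ r) else 0).
Proof.
move=> tops; rewrite (@cyl_extend _ k); last exact: measurable_stayDm.
rewrite -wsumZl => [|r]; last by case: ifP => // _; exact: pw_ge0.
apply: eq_wsum => r rk; rewrite -catA.
have pre w : cyl (s ++ t ++ r) w -> pfx w (size s + (size t + k)) = s ++ t ++ r.
  by rewrite /cyl /= !size_cat rk.
case: ifPn => [st|nst].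
  rewrite -(pw_cat tops st) -cyl_pw.
  congr (P _); apply/seteqP; split => w; first by case.
  move=> cw; split => //; have h := pre w cw => j jm.
  move: st; rewrite -(drop_size_cat (t ++ r) (erefl (size s))) -h.
  by move=> /stay_dropP; apply; rewrite ?leq_addr ?leq_add2l.
rewrite mule0 -(measure0 P); congr (P _); apply/seteqP; split => // w [h cw].
apply/negP: nst; rewrite -(drop_size_cat (t ++ r) (erefl (size s))) -(pre w cw).
apply/negPn/(stay_dropP _ (leq_addr _ _)).
by move=> m; rewrite leq_add2l; exact: h.
Qed.

Lemma top_nil : top u [::]. Proof. by []. Qed.

Lemma pw_nil : pw [::] = 1.
Proof.
rewrite -cyl_pw -(probability_setT P); congr (P _).
by apply/seteqP; split.
Qed.

(* The environments visited below and above the level [height u s] are independent. *)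
Lemma P_stayD_cyl s t : top u s ->
  P (stayD (size s) `&` cyl (s ++ t)) = pw s * P (stayD 0 `&` cyl t).
Proof.
move=> tops.
have c1 := @cvg_stayDm (size s) _ (mcyl (s ++ t)) (size t).
have c2 := @cvg_stayDm 0 _ (mcyl t) (size t).
have pwfin : pw s \is a fin_num.
  by rewrite -cyl_pw fin_num_measure.
have c3 := cvgeZl pwfin c2.
have e : (fun k => P (stayDm (size s) (size t + k) `&` cyl (s ++ t))) =
    (fun k => pw s * P (stayDm 0 (size t + k) `&` cyl t)).
  apply/funext => k; rewrite P_stayDm_cyl//.
  by have := P_stayDm_cyl t k top_nil; rewrite /= => ->; rewrite pw_nil mul1e.
rewrite e in c1.
exact: (cvg_unique _ c1 c3).
Qed.

Definition PD s := P (stayD 0 `&` cyl s).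
(** Time 0 is left out, in accordance with [tau_1 > 0]. *)
Definition noregen k : set T := [set w | forall i, (0 < i <= k)%N -> ~ regen Zs u w i].
Definition firstregen k : set T := [set w | regen Zs u w k /\
  forall i, (0 < i)%N -> (i < k)%N -> ~ regen Zs u w i].
Definition rho1 s := P (noregen (size s) `&` cyl s).
Definition rho s := P (noregen (size s) `&` stayD 0 `&` cyl s).
Definition firstweight a := if firstw a then pw a else 0.
Definition blockweight a := if blockw a then pw a else 0.

Lemma measurable_regen k : measurable [set w | regen Zs u w k].
Proof.
have -> : [set w | regen Zs u w k] = [set w | (top u) (pfx w k)] `&` stayD k.
  by apply/seteqP; split => w /=; rewrite regenE.
by apply: measurableI; [exact: measurable_pfx|exact: measurable_stayD].
Qed.

Lemma measurable_noregen k : measurable (noregen k).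
Proof.
have -> : noregen k = \bigcap_(i in [set i | (0 < i <= k)%N]) ~` [set w | regen Zs u w i].
  by apply/seteqP; split => w /= h i; exact: h.
by apply: bigcap_measurableType => i _; apply: measurableC; exact: measurable_regen.
Qed.

Lemma measurable_firstregen k : measurable (firstregen k).
Proof.
have -> : firstregen k = [set w | regen Zs u w k] `&`
    \bigcap_(i in [set i | (0 < i)%N && (i < k)%N]) ~` [set w | regen Zs u w i].
  apply/seteqP; split => w /= [h1 h2]; split => // i; first by move=> /andP[]; exact: h2.
  by move=> i0 ik; apply: h2; rewrite /= i0.
apply: measurableI; first exact: measurable_regen.
by apply: bigcap_measurableType => i _; apply: measurableC; exact: measurable_regen.
Qed.

Lemma first_regen_split C k : measurable C ->
  P C = P (noregen k `&` C) + \sum_(i < k) P (firstregen i.+1 `&` C).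
Proof.
move=> mC; elim: k => [|k IH].
  rewrite big_ord0 adde0; congr (P _); apply/seteqP; split => w; last by case.
  by move=> Cw; split => // i; case: i.
rewrite IH big_ord_recr/= addeCA [LHS]addeC; congr (_ + _).
rewrite -measureU//; last 3 first.
- by apply: measurableI => //; exact: measurable_noregen.
- by apply: measurableI => //; exact: measurable_firstregen.
- apply/seteqP; split => // w [[h _] [[h' _] _]]; by have := h k.+1; rewrite leqnn => /(_ isT) /(_ h').
congr (P _); apply/seteqP; split => w.
  move=> [h Cw]; have [rk|nrk] := pselect (regen Zs u w k.+1).
    right; split => //; split => // i i0 ik; apply: h; rewrite i0 -ltnS//.
  left; split => // i /andP[i0]; rewrite leq_eqVlt => /predU1P[->//|ik].
  by apply: h; rewrite i0.
by case=> -[h Cw]; split => // i /andP[i0 ik]; [apply: h; rewrite i0 ltnW|case: h => _; apply].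
Qed.

Lemma firstregenE k w : (0 < k)%N ->
  firstregen k w <-> firstw (pfx w k) /\ stayD k w.
Proof.
move=> k0; have := @first_regen_afterP w 0%N _ k k0.
by rewrite drop0; apply => i j.
Qed.

Lemma sum_ord_shift (F : nat -> \bar R) n : F 0%N = 0 ->
  \sum_(i < n) F i.+1 = \sum_(i < n.+1) F i.
Proof. by move=> F0; rewrite big_ord_recl/= F0 add0e. Qed.

(** Split according to the first regeneration time within [s], if there is one, and factorise there.
    The term [i = 0] vanishes because blocks are nonempty. *)
Lemma delayed_renewal s :
  pw s = rho1 s + \sum_(i < (size s).+1) firstweight (take i s) * PD (drop i s).
Proof.
rewrite -cyl_pw (first_regen_split (size s) (mcyl s)); congr (_ + _).
rewrite -(@sum_ord_shift (fun i => firstweight (take i s) * PD (drop i s))); last first.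
  by rewrite take0 /firstweight /= mul0e.
apply: eq_bigr => i _; have is_ := ltn_ord i.
have sz : size (take i.+1 s) = i.+1 by rewrite size_takel.
have pre w : cyl s w -> pfx w i.+1 = take i.+1 s.
  by rewrite /cyl /= => /(congr1 (take i.+1)) <-; rewrite take_pfx.
rewrite /firstweight; case: ifPn => [fi|nf].
  have tp : top u (take i.+1 s) by case/and3P: fi.
  rewrite -(P_stayD_cyl _ tp) cat_take_drop sz; congr (P _).
  apply/seteqP; split => w [h cw]; split => //.
    by have [] := (firstregenE w (ltn0Sn i)).1 h.
  by apply/firstregenE => //; rewrite pre.
rewrite mul0e -(measure0 P); congr (P _); apply/seteqP; split => // w [/firstregenE h cw].
by have [] := h (ltn0Sn _); rewrite pre// (negbTE nf).
Qed.

(** As in the delayed equation, but on [D = oo]: given a regeneration at [i], this event only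
    requires the first [i] steps to satisfy [stay], which turns [firstw] into [blockw]. *)
Lemma block_renewal s :
  PD s = rho s + \sum_(i < (size s).+1) blockweight (take i s) * PD (drop i s).
Proof.
have mD : measurable (stayD 0 `&` cyl s) by apply: measurableI => //; exact: measurable_stayD.
rewrite {1}/PD (first_regen_split (size s) mD) setIA; congr (_ + _).
rewrite -(@sum_ord_shift (fun i => blockweight (take i s) * PD (drop i s))); last first.
  by rewrite take0 /blockweight /= mul0e.
apply: eq_bigr => i _; have is_ := ltn_ord i.
have sz : size (take i.+1 s) = i.+1 by rewrite size_takel.
have pre w : cyl s w -> pfx w i.+1 = take i.+1 s.
  by rewrite /cyl /= => /(congr1 (take i.+1)) <-; rewrite take_pfx.
rewrite /blockweight; case: ifPn => [/andP[fi st]|nf].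
  have tp : top u (take i.+1 s) by case/and3P: fi.
  rewrite -(P_stayD_cyl _ tp) cat_take_drop sz; congr (P _).
  apply/seteqP; split => w.
    move=> [h [_ cw]]; split => //.
    by have [] := (firstregenE w (ltn0Sn i)).1 h.
  move=> [h cw]; split; first by apply/firstregenE => //; rewrite pre.
  split => //; apply: (stayD_trans (leq0n i.+1)) => //.
  by rewrite drop0 pre.
rewrite mul0e -(measure0 P); congr (P _); apply/seteqP; split => // w [/firstregenE h [w0 cw]].
have [] := h (ltn0Sn _); rewrite pre// => fi _; move/negP: nf; apply.
rewrite /blockw fi/= -(pre w)// -[pfx w i.+1]drop0; exact: stayD_stay.
Qed.

End renewal_structure.

Local Notation delta := (PD [::]).
Local Notation bw := blockweight.
Local Notation fw := firstweight.

(** * Decomposition of integrals over blocks *)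

Section blocks.
Implicit Types (s t a b : seq (dir d)) (w : T) (L : seq (seq (dir d))).

Let mcyl s : measurable (cyl s). Proof. exact: cyl_measurable. Qed.
Let mstayD k : measurable (stayD k). Proof. exact: measurable_stayD. Qed.
Lemma integral_pfx n (g : seq (dir d) -> R) : (forall s, 0 <= g s)%R ->
  \int[P]_w (g (pfx w n))%:E = wsum n (fun s => pw s * (g s)%:E).
Proof.
move=> g0.
transitivity (\int[P]_w wsum n (fun s => (g s * \1_(cyl s) w)%:E)).
  apply: eq_integral => w _; rewrite -(wsum_pick (pfx w n) (fun s => (g s)%:E)) size_pfx.
  apply: eq_wsum => s sn; rewrite indicE; case: eqVneq => [->|nsw].
    by rewrite mem_set ?mulr1//; exact: cyl_pfx.
  rewrite memNset ?mulr0// => h; move/eqP: nsw; apply; rewrite -h /=.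
  by rewrite sn.
have mF s : measurable_fun setT (fun w => (g s * \1_(cyl s) w)%:E).
  by apply/measurable_EFinP; apply: measurable_funM => //; exact: measurable_indic.
have [|-> _] := integral_wsum P n mF.
  by move=> s w; rewrite lee_fin mulr_ge0.
apply: eq_wsum => s _; under eq_integral do rewrite EFinM.
rewrite ge0_integralZl ?lee_fin//; last by apply/measurable_EFinP; exact: measurable_indic.
by rewrite integral_indic// setIT muleC; congr (_ * _); exact: cyl_pw.
Qed.

(** For a nonempty [s] with [top u s]: the path begins with [s] and regenerates at its end. For the
    empty word it is the event [D = oo]. *)
Definition Ev s : set T := stayD (size s) `&` cyl s.

Lemma measurable_Ev s : measurable (Ev s).
Proof. exact: measurableI. Qed.

Lemma P_Ev s : top u s -> P (Ev s) = pw s * PD [::].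
Proof.
move=> ts; have := P_stayD_cyl [::] ts.
by rewrite cats0.
Qed.

Lemma firstw_top a : firstw a -> top u a. Proof. by case/and3P. Qed.
Lemma firstw_size a : firstw a -> (0 < size a)%N. Proof. by case/and3P. Qed.
Lemma blockw_top a : blockw a -> top u a. Proof. by case/andP => /firstw_top. Qed.
Lemma blockw_stay a : blockw a -> stay u a. Proof. by case/andP. Qed.

Lemma top_cat s b : top u s -> stay u b -> top u b -> b != [::] -> top u (s ++ b).
Proof.
move=> /topP ts /stayP st tb bn; have bpos : (0 < height u b)%R.
  by move/topP: tb => /(_ 0%N); rewrite take0 height_nil; apply; case: b bn {st}.
apply/topP => i; rewrite size_cat => isb; rewrite take_cat height_cat.
case: ltnP => [lt_is|le_si]; first by have := ts i lt_is; lra.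
by rewrite height_cat ltrD2l; move/topP: tb; apply; rewrite ltn_subLR.
Qed.

Lemma stay_cat s t : stay u s -> stay u t -> stay u (s ++ t).
Proof.
move=> /stayP hs /stayP ht; apply/stayP => i; rewrite take_cat.
case: ltnP => _; first exact: hs.
by rewrite height_cat addr_ge0//; have := hs (size s); rewrite take_size.
Qed.

Lemma stay_flatten L : all blockw L -> stay u (flatten L).
Proof.
elim: L => [_|b L IH /andP[/blockw_stay sb /IH sL]].
  by apply/stayP => i; rewrite height_nil.
exact: stay_cat.
Qed.

Lemma blockw_nil b : blockw b -> b != [::].
Proof. by move=> /andP[/firstw_size]; case: b. Qed.

Lemma Ev_below s w : top u s -> Ev s w -> forall i j, (i < size s)%N -> (size s <= j)%N ->
  (height u (pfx w i) < height u (pfx w j))%R.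
Proof.
move=> /topP ts [wst ws] i j is_ sj.
have e : pfx w (size s) = s by exact: ws.
apply: (@lt_le_trans _ _ (height u (pfx w (size s)))).
  by rewrite -(take_pfx w (ltnW is_)) e; exact: ts.
by rewrite -(subnKC sj); exact: wst.
Qed.

Lemma Ev_next s b w : top u s -> Ev s w ->
  (blockw b /\ Ev (s ++ b) w) <->
  (next_regen Zs u w (size s) = Some (size s + size b)%N /\
   b = drop (size s) (pfx w (size s + size b))).
Proof.
move=> ts sw; have bel := Ev_below ts sw; case: (sw) => wst ws.
split => [[bb [wst' cw]]|[nx be]].
  have e : b = drop (size s) (pfx w (size s + size b)) by case/cyl_cat_pfx: cw.
  split => //; apply/(next_regenP bel); rewrite -e -size_cat; split => //.
    rewrite size_cat -[X in (X < _)%N]addn0 ltn_add2l.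
    by case/andP: bb => /firstw_size.
  by case/andP: bb.
have [_ fb wst'] := (next_regenP bel _).1 nx; rewrite -be in fb.
split.
  by rewrite /blockw fb/= be; exact: stayD_stay.
split; first by rewrite size_cat.
exact/cyl_cat_pfx.
Qed.

Lemma Ev_prefix s L w : all blockw L -> Ev (s ++ flatten L) w -> Ev s w.
Proof.
move=> bL [wst cw]; have /cyl_cat_pfx[ws e] := cw; split => //.
rewrite size_cat in wst.
apply: (stayD_trans (leq_addr (size (flatten L)) (size s))) => //.
by rewrite -e; exact: stay_flatten.
Qed.

Lemma delta_ge0 : 0 <= delta. Proof. exact: measure_ge0. Qed.

Lemma Ev_uniq s b b' w : top u s -> blockw b -> blockw b' ->
  Ev (s ++ b) w -> Ev (s ++ b') w -> b = b'.
Proof.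
move=> ts bb bb' h h'.
have sw : Ev s w by apply: (@Ev_prefix s [:: b]); rewrite /= ?cats0 ?bb.
have [n1 ->] := (Ev_next b ts sw).1 (conj bb h).
have [n2 ->] := (Ev_next b' ts sw).1 (conj bb' h').
by move: n2; rewrite n1 => -[->].
Qed.

(** Induction on [J]: on [Ev s] the next block is unique, so [Y] is a sum over that block of its
    restrictions to [Ev (s ++ b)], and the path weight factorises at the cut. The factor [delta] is
    the probability of staying above the last cut. Measurability of the restricted [Y] is a
    by-product of the series. *)
Lemma integral_blocks J s (Y : T -> \bar R) (val : seq (seq (dir d)) -> \bar R) :
  top u s -> (forall L, 0 <= val L) -> (forall w, 0 <= Y w) ->
  (forall L w, size L = J -> all blockw L -> Ev (s ++ flatten L) w -> Y w = val L) ->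
  (forall w, Ev s w -> Y w != 0 ->
     exists L, [/\ size L = J, all blockw L & Ev (s ++ flatten L) w]) ->
  measurable_fun setT (Y \_ (Ev s)) /\
  \int[P]_w (Y \_ (Ev s)) w = pw s * (delta * bsumn blockweight J val).
Proof.
move=> + + Yge0; elim: J s val => [|J IH] s val ts val0 Yval Y0.
  have -> : Y \_ (Ev s) = (fun w => val [::] * (\1_(Ev s) w)%:E).
    apply/funext => w; rewrite patchE indicE; case: ifPn => [/set_mem sw|_].
      by rewrite mule1 (Yval [::])//= cats0.
    by rewrite mule0.
  have m1 : measurable_fun setT (fun w => (\1_(Ev s) w : R)%:E).
    by apply/measurable_EFinP; apply: measurable_indic; exact: measurable_Ev.
  split; first exact: emeasurable_funM.
  rewrite ge0_integralZl//.
  rewrite integral_indic ?setIT//; last exact: measurable_Ev.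
  by transitivity (val [::] * P (Ev s)); rewrite // P_Ev//= muleC muleA.
have dec w : (Y \_ (Ev s)) w =
    csum (fun b => if blockw b then (Y \_ (Ev (s ++ b))) w else 0).
  have [sw|nsw] := pselect (Ev s w); last first.
    rewrite patchE memNset// csum0// => b; case: ifP => // bb.
    rewrite patchE memNset// => h; apply: nsw.
    by apply: (@Ev_prefix s [:: b]); rewrite /= ?cats0 ?bb.
  rewrite patchE mem_set//.
  have [[b0 [bb0 sb0]]|nob] := pselect (exists b, blockw b /\ Ev (s ++ b) w).
    rewrite -[LHS](csum_pick b0 (fun=> Y w)); apply: eq_csum => b.
    case: eqVneq => [->|nb]; first by rewrite bb0 patchE mem_set.
    case: ifP => // bb; rewrite patchE memNset// => sb.
    by move/eqP: nb; apply; exact: (Ev_uniq ts bb bb0 sb sb0).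
  rewrite csum0 => [|b]; last first.
    by case: ifP => // bb; rewrite patchE memNset// => sb; apply: nob; exists b.
  apply/eqP/negPn/negP => /(Y0 w sw) [L [LJ bL h]]; case: L LJ bL h => [//|b L] _ /= /andP[bb bL] h.
  apply: nob; exists b; split => //; apply: (@Ev_prefix (s ++ b) L) => //.
  by rewrite -catA.
have IHb b : blockw b -> measurable_fun setT (Y \_ (Ev (s ++ b))) /\
    \int[P]_w (Y \_ (Ev (s ++ b))) w =
    pw (s ++ b) * (delta * bsumn blockweight J (fun L => val (b :: L))).
  move=> bb; apply: IH => //.
  - by apply: top_cat => //; [exact: blockw_stay|exact: blockw_top|exact: blockw_nil].
  - by move=> L w LJ bL h; apply: Yval; rewrite /= ?LJ ?bb// catA.
  move=> w h Yw.
  have sw : Ev s w by apply: (@Ev_prefix s [:: b]); rewrite /= ?cats0 ?bb.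
  have [L [LJ bL h']] := Y0 w sw Yw; case: L LJ bL h' => [//|b' L] [LJ] /= /andP[bb' bL] h'.
  exists L; split => //.
  have -> : b = b'; last by rewrite -catA.
  apply: (Ev_uniq ts bb bb' h); apply: (@Ev_prefix (s ++ b') L) => //.
  by rewrite -catA.
pose F b w : \bar R := if blockw b then (Y \_ (Ev (s ++ b))) w else 0.
have mF b : measurable_fun setT (F b).
  rewrite /F; case: (boolP (blockw b)) => [/IHb[]//|_]; exact: measurable_cst.
have F0 b w : 0 <= F b w.
  by rewrite /F; case: ifP => // _; rewrite patchE; case: ifP.
have [iF mFs] := integral_csum P mF F0.
have -> : Y \_ (Ev s) = (fun w => csum (F ^~ w)) by apply/funext => w; exact: dec.
split => //; rewrite iF.
have pw0 a : 0 <= pw a by exact: pw_ge0.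
have bw0 a : 0 <= blockweight a by rewrite /blockweight; case: ifP.
transitivity (csum (fun b => pw s * (delta * (blockweight b *
    bsumn blockweight J (fun L => val (b :: L)))))); last first.
  rewrite csumZl// => [|b]; last by rewrite !mule_ge0 ?delta_ge0 ?bsumn_ge0.
  rewrite csumZl ?delta_ge0// => b.
  by rewrite mule_ge0 ?bsumn_ge0.
apply: eq_csum => b; rewrite /F /blockweight; case: (boolP (blockw b)) => [bb|_].
  rewrite (IHb b bb).2 (pw_cat ts (blockw_stay bb)) -muleA.
  by congr (_ * _); rewrite muleCA.
by rewrite integral0 mul0e !mule0.
Qed.

Lemma tau_blocks L w : all blockw L -> Ev (flatten L) w ->
  forall m, (m <= size L)%N -> tau Zs u w m = Some (size (flatten (take m L))).
Proof.
move=> bL Lw; elim=> [_|m IH mL]; first by rewrite take0.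
rewrite /= IH ?(ltnW mL)//= (take_nth [::] mL) flatten_rcons size_cat.
have bLm : all blockw (take m L) by apply/allP => b /mem_take; move/allP: bL; exact.
have bLd : all blockw (drop m.+1 L) by apply/allP => b /mem_drop; move/allP: bL; exact.
have bb : blockw (nth [::] L m) by move/allP: bL; apply; exact: mem_nth.
have tm : top u (flatten (take m L)).
  elim/last_ind: (take m L) bLm => [//|M b IHM]; rewrite all_rcons flatten_rcons => /andP[bb' bM].
  have [->|Mn] := eqVneq M [::]; first by rewrite /=; exact: blockw_top.
  by apply: top_cat; [exact: IHM|exact: blockw_stay|exact: blockw_top|exact: blockw_nil].
have e : L = take m L ++ nth [::] L m :: drop m.+1 L.
  by rewrite -(drop_nth [::] mL) cat_take_drop.
have h1 : Ev (flatten (take m L) ++ nth [::] L m) w.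
  apply: (@Ev_prefix _ (drop m.+1 L)) => //.
  by move: Lw; rewrite {1}e flatten_cat /= -catA.
have h0 : Ev (flatten (take m L)) w.
  by apply: (@Ev_prefix _ [:: nth [::] L m]); rewrite /= ?cats0 ?bb.
by have [] := (Ev_next (nth [::] L m) tm h0).1 (conj bb h1).
Qed.

Lemma tau_Some_blocks J w n : stayD 0 w -> tau Zs u w J = Some n ->
  exists L, [/\ size L = J, all blockw L, Ev (flatten L) w & top u (flatten L)] /\
    size (flatten L) = n.
Proof.
move=> w0; elim: J n => [|J IH] n /=.
  by move=> [<-]; exists [::]; split.
case e : (tau Zs u w J) => [k|//] /= nx.
have [L [[LJ bL Lw tL] sL]] := IH _ e.
have [kn _ _] := (next_regenP (Ev_below tL Lw) n).1 (eq_trans (congr1 (next_regen Zs u w) sL) nx).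
have en : n = (size (flatten L) + (n - size (flatten L)))%N by rewrite subnKC// ltnW.
pose b := drop (size (flatten L)) (pfx w n).
have sb : size b = (n - size (flatten L))%N by rewrite size_drop size_pfx.
have [bb h] : blockw b /\ Ev (flatten L ++ b) w.
  apply/Ev_next => //; rewrite sb -en; split => //.
  by rewrite sL.
exists (rcons L b); rewrite flatten_rcons size_rcons LJ all_rcons bb bL size_cat sb -en.
by split => //; split => //; apply: top_cat => //; [exact: blockw_stay|exact: blockw_top|exact: blockw_nil].
Qed.

End blocks.

(** * The limit measure in terms of blocks *)

Section mu_formula.
Implicit Types (s a b : seq (dir d)) (w : T) (L : seq (seq (dir d))).
Variables (z0 : dir d) (t : 'rV[R]_d) (K : nat).

Lemma walkE w n : walk Zs w n = wpos (pfx w n).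
Proof.
rewrite /walk /wpos /pfx /mkseq big_map.
by rewrite -[n in iota 0 n]subn0 -/(index_iota 0 n) big_mkord.
Qed.

Definition on_words (h : (nat -> dir d) -> R) s : R := h (nth z0 s).

Lemma on_words_local h s s' : (forall a b : nat -> dir d,
    (forall k, (k < K)%N -> a k = b k) -> h a = h b) ->
  (K <= size s)%N -> on_words h (s ++ s') = on_words h s.
Proof. by move=> hK Ks; apply: hK => k kK; rewrite nth_cat (leq_trans kK). Qed.

Lemma on_words_path h w j n : (forall a b : nat -> dir d,
    (forall k, (k < K)%N -> a k = b k) -> h a = h b) ->
  (j + K <= n)%N -> h (fun k => Zs w (j + k)%N) = on_words h (drop j (pfx w n)).
Proof.
move=> hK jn; apply: hK => k kK.
by rewrite nth_drop nth_mkseq// (leq_trans _ jn)// ltn_add2l.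
Qed.

Lemma EvnilE : Ev [::] = Dinf Zs u.
Proof. by rewrite DinfE; apply/seteqP; split => [w []|w h]//; split. Qed.

(** Integrand of the numerator of [mu_int]; for [h = 1] and [J = 1] it is that of the
    denominator. *)
Definition num (h : (nat -> dir d) -> R) (lam : R) (J : nat) w : \bar R :=
  match tau Zs u w 1, tau Zs u w J with
  | Some t1, Some tK => ((\sum_(j < t1) h (fun k => Zs w (j + k)%N)) *
       expR (dotR t (toR R (walk Zs w tK)) - lam * tK%:R))%:E
  | _, _ => 0 end.

Lemma flatten_rest_size b L : all blockw L -> (size b + size L <= size (flatten (b :: L)))%N.
Proof.
rewrite /= size_cat leq_add2l; elim: L => //= c L IH /andP[bc /IH h].
by rewrite size_cat -add1n leq_add// firstw_size//; case/andP: bc.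
Qed.

(** The [K] nonempty blocks after the first supply the letters that [h] reads past the end of the
    first block, hence [K.+1] blocks. *)
Lemma num_integral (h : (nat -> dir d) -> R) lam : (forall z, 0 <= h z)%R -> (forall a b : nat -> dir d,
    (forall k, (k < K)%N -> a k = b k) -> h a = h b) ->
  measurable_fun setT (num h lam K.+1 \_ (Dinf Zs u)) /\
  \int[P]_(w in Dinf Zs u) num h lam K.+1 w =
  delta * bsumn bw K.+1 (fun L => (headsum (on_words h) L * chi t lam (flatten L))%:E).
Proof.
move=> h0 hK; rewrite integral_mkcond -EvnilE.
pose val L := (headsum (on_words h) L * chi t lam (flatten L))%:E.
have num0 w : 0 <= num h lam K.+1 w.
  rewrite /num; case: (tau _ _ _ 1) => // t1; case: (tau _ _ _ _) => // tK.
  by rewrite lee_fin mulr_ge0 ?expR_ge0// sumr_ge0.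
have val0 L : 0 <= val L.
  by rewrite lee_fin mulr_ge0 ?(ltW (chi_gt0 _ _ _))// sumr_ge0// => j _; exact: h0.
have [] := @integral_blocks K.+1 [::]
  (num h lam K.+1) val top_nil val0 num0.
- move=> L w LK bL Lw; rewrite /num.
  have tL := tau_blocks bL Lw.
  rewrite (tL 1%N) ?LK// (tL K.+1) ?LK// -LK take_size.
  case: L LK bL Lw {tL} => [//|b L] [LK] bL Lw.
  have cw : pfx w (size (flatten (b :: L))) = flatten (b :: L) by case: Lw.
  rewrite /val /headsum /chi; congr (_ * _)%:E.
    rewrite /= take0 /= cats0; apply: eq_bigr => j _.
    rewrite (@on_words_path h w j (size (flatten (b :: L))))// ?cw//.
    rewrite (leq_trans _ (flatten_rest_size b _))//; last by case/andP: bL.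
    by rewrite LK leq_add2r ltnW.
  by rewrite walkE cw.
- move=> w w0; rewrite /num; case: (tau Zs u w 1) => [t1|]; last by rewrite eqxx.
  case e : (tau Zs u w K.+1) => [n|]; last by rewrite eqxx.
  move=> _; rewrite EvnilE DinfE in w0.
  by have [L [[LK bL Lw _] _]] := tau_Some_blocks w0 e; exists L.
move=> m ->; split => //.
by rewrite pw_nil mul1e.
Qed.

End mu_formula.

Section mu_value.
Implicit Types (s : seq (dir d)) (w : T) (L : seq (seq (dir d))).
Variables (z0 : dir d) (t : 'rV[R]_d) (K : nat).

Lemma delta_fin : delta \is a fin_num.
Proof.
rewrite fin_num_measure//; apply: measurableI; first exact: measurable_stayD.
exact: cyl_measurable.
Qed.

Lemma bw_ge0 b : 0 <= bw b.
Proof. by rewrite /blockweight; case: ifP => // _; exact: pw_ge0. Qed.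

(** The [K] blocks after the first have tilted mass 1 each. *)
Lemma integral_headsize lam ell : bsum bw (fun b => (chi t lam b)%:E) = 1 ->
  bsum bw (fun b => ((size b)%:R * chi t lam b)%:E) = ell%:E ->
  bsumn bw K.+1 (fun L => ((size (head [::] L))%:R * chi t lam (flatten L))%:E) = ell%:E.
Proof.
move=> h1 hell; rewrite /= -hell; apply: eq_bsum => b _.
have c0 s : (0 <= chi t lam s)%R by exact/ltW/chi_gt0.
transitivity (bsumn bw K (fun L => ((size b)%:R * chi t lam b)%:E * (chi t lam (flatten L))%:E)).
  by apply: eq_bsumn => L _ _; rewrite /= chi_cat mulrA EFinM.
rewrite (bsumnZl bw_ge0); [|by rewrite lee_fin mulr_ge0|by move=> L; rewrite lee_fin].
rewrite (bsumn_mul (phi := 1) bw_ge0 _ c0 (chi_nil _ _) (chi_cat t lam))//.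
by rewrite expr1n mule1.
Qed.

(** Block sums take nonnegative functions, so [f + M] is integrated and [M] times the integral for
    [h = 1] is subtracted. The factor [delta] cancels between numerator and denominator. *)
Lemma mu_intE f M ell gam : 0 < delta -> (forall z : nat -> dir d, `|f z| <= M)%R ->
  (forall a b : nat -> dir d, (forall k, (k < K)%N -> a k = b k) -> f a = f b) ->
  (0 < ell)%R -> bsum bw (fun b => (chi t (Lambda_a P Zs t) b)%:E) = 1 ->
  bsum bw (fun b => ((size b)%:R * chi t (Lambda_a P Zs t) b)%:E) = ell%:E ->
  bsumn bw K.+1 (fun L => (headsum (on_words z0 (fun z => (f z + M)%R)) L *
     chi t (Lambda_a P Zs t) (flatten L))%:E) = gam%:E ->
  mu_int P Zs u t f K.+1 = (gam / ell - M)%R.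
Proof.
set lam := Lambda_a P Zs t => delta0 fM fK ell0 h1 hell hgam.
have M0 : (0 <= M)%R by apply: le_trans (fM (fun=> z0)); rewrite normr_ge0.
have fM0 z : (0 <= f z + M)%R by have := fM z; rewrite ler_norml => /andP[? _]; lra.
have num_int0 := @num_integral z0 t.
have [mg ig] := num_int0 K (fun z => (f z + M)%R) lam fM0
  (fun x y h => congr1 (fun r => (r + M)%R) (fK x y h)).
have [m1 i1] := num_int0 K (fun=> 1%R) lam (fun=> ler01) (fun _ _ _ => erefl).
have [_ i2] := num_int0 0%N (fun=> 1%R) lam (fun=> ler01) (fun _ _ _ => erefl).
have PD0 : P (Dinf Zs u) = delta.
  by rewrite -EvnilE P_Ev// pw_nil mul1e.
have c0 s : (0 <= chi t lam s)%R by exact/ltW/chi_gt0.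
have [dd ddE dd0] : exists2 r : R, delta = r%:E & (0 < r)%R.
  by exists (fine delta); rewrite ?fineK ?delta_fin// -lte_fin fineK ?delta_fin.
rewrite hgam ddE in ig.
have {}i1 : \int[P]_(w in Dinf Zs u) num t (fun=> 1%R) lam K.+1 w = (dd * ell)%:E.
  rewrite i1 ddE EFinM -(integral_headsize h1 hell); congr (_ * _).
  apply: eq_bsumn => L _ _; congr (_ * _)%:E.
  by rewrite /headsum /on_words sumr_const card_ord.
have mD : measurable (Dinf Zs u) by rewrite -EvnilE; exact: measurable_Ev.
have int_ge0 (h : (nat -> dir d) -> R) w : (forall z, 0 <= h z)%R -> 0 <= num t h lam K.+1 w.
  move=> h0; rewrite /num; case: (tau _ _ _ 1) => // t1; case: (tau _ _ _ _) => // tK.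
  by rewrite lee_fin mulr_ge0 ?expR_ge0// sumr_ge0.
have mkint (h : (nat -> dir d) -> R) (r : R) : (forall z, 0 <= h z)%R ->
    measurable_fun setT (num t h lam K.+1 \_ (Dinf Zs u)) ->
    \int[P]_(w in Dinf Zs u) num t h lam K.+1 w = r%:E ->
    P.-integrable (Dinf Zs u) (num t h lam K.+1).
  move=> h0 mh ih; apply/integrableP; split.
    by apply/(measurable_restrictT _ mD).
  under eq_integral do rewrite gee0_abs ?int_ge0//.
  by rewrite ih ltry.
have num_int : \int[P]_(w in Dinf Zs u) num t f lam K.+1 w = (dd * (gam - M * ell))%:E.
  transitivity (\int[P]_(w in Dinf Zs u) (num t (fun z => (f z + M)%R) lam K.+1 w -
      M%:E * num t (fun=> 1%R) lam K.+1 w)).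
    apply: eq_integral => w _; rewrite /num; case: (tau _ _ _ 1) => [t1|]; last by rewrite mule0 sube0.
    case: (tau _ _ _ _) => [tK|]; last by rewrite mule0 sube0.
    rewrite -EFinM -EFinB; congr _%:E; rewrite big_split/= !sumr_const card_ord -mulr_natr.
    ring.
  rewrite integralB//; first last.
  - apply: integrableZl => //; apply: (mkint _ _ _ m1 i1) => //.
  - exact: (mkint _ _ fM0 mg ig).
  rewrite integralZl//; last by apply: (mkint _ _ _ m1 i1).
  by rewrite ig i1 -!EFinM -EFinB; congr _%:E; ring.
have den_int : \int[P]_(w in Dinf Zs u) (match tau Zs u w 1 with
     | Some t1 => (t1%:R * expR (dotR t (toR R (walk Zs w t1)) - lam * t1%:R))%:E
     | None => 0%E end) = (dd * ell)%:E.
  have e L : size L = 1%N -> headsum (on_words z0 (fun=> 1%R)) L = (size (flatten L))%:R :> R.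
    by case: L => [//|b [|//]] _; rewrite /headsum /on_words sumr_const card_ord /= cats0.
  rewrite EFinM -ddE -hell; transitivity (delta * bsumn bw 1
    (fun L => (headsum (on_words z0 (fun=> 1%R)) L * chi t lam (flatten L))%:E)).
    rewrite -i2; apply: eq_integral => w _; rewrite /num.
    by case: (tau _ _ _ 1) => // t1; rewrite sumr_const card_ord.
  apply: (congr1 (mule delta)); apply: eq_bsum => b _.
  by rewrite e//= cats0.
rewrite /mu_int /condE -/lam PD0 ddE.
rewrite (_ : (\int[P]_(w in Dinf Zs u) _) = (dd * (gam - M * ell))%:E)//.
rewrite den_int /=; field.
by rewrite !gt_eqF.
Qed.

End mu_value.

Let pw0 s : 0 <= pw s. Proof. exact: pw_ge0. Qed.
Let fw0 s : 0 <= fw s. Proof. by rewrite /firstweight; case: ifP. Qed.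
Let bw0 s : 0 <= bw s. Proof. by rewrite /blockweight; case: ifP. Qed.
Let bw_le_fw s : bw s <= fw s.
Proof. by rewrite /blockweight /firstweight /blockw; case: (firstw s) => //=; case: ifP. Qed.
Let bw_nil : bw [::] = 0. Proof. by []. Qed.
Let PD0 s : 0 <= PD s. Proof. exact: measure_ge0. Qed.
Let rho0 s : 0 <= rho s. Proof. exact: measure_ge0. Qed.
Let rho10 s : 0 <= rho1 s. Proof. exact: measure_ge0. Qed.
Let chi0 t lam (s : seq (dir d)) : (0 <= chi t lam s :> R)%R. Proof. exact/ltW/chi_gt0. Qed.

(** * Exponential moments and the growth rate *)

Section growth.
Implicit Types (s a b : seq (dir d)) (w : T) (t : 'rV[R]_d).

Let rho1_le s : rho s <= rho1 s.
Proof.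
apply: le_measure; rewrite ?inE; [| |by move=> w [[? ?] ?]].
- apply: measurableI; last exact: cyl_measurable.
  by apply: measurableI; [exact: measurable_noregen|exact: measurable_stayD].
- by apply: measurableI; [exact: measurable_noregen|exact: cyl_measurable].
Qed.

(** One variable [Y] dominates the tilt at the first regeneration time and at all times before it.
    The events [Ev b] for distinct first blocks are disjoint, so their contributions add up to at
    most the mean of [Y]; each has probability [pw b * delta]. *)
Lemma dominated_moments t lam (Y : T -> \bar R) :
  (forall w, 0 <= Y w) -> \int[P]_w Y w < +oo ->
  (forall k w, (0 < k)%N -> firstregen k w -> (chi t lam (pfx w k))%:E <= Y w) ->
  (forall n w, noregen n w -> (chi t lam (pfx w n))%:E <= Y w) ->
  exists2 C : R, (0 <= C)%R & [/\
    delta * bsum fw (fun b => (chi t lam b)%:E) <= C%:E,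
    (forall n, wsum n (fun s => rho1 s * (chi t lam s)%:E) <= C%:E) &
    (forall n, wsum n (fun s => rho s * (chi t lam s)%:E) <= C%:E)].
Proof.
move=> Y0 Yfin hfirst hno.
have iY0 : 0 <= \int[P]_w Y w by exact: integral_ge0.
have CE : \int[P]_w Y w = (fine (\int[P]_w Y w))%:E by rewrite fineK// ge0_fin_numE.
have h1 n : wsum n (fun s => rho1 s * (chi t lam s)%:E) <= \int[P]_w Y w.
  have mF s : measurable_fun setT (fun w => (chi t lam s * \1_(noregen (size s) `&` cyl s) w)%:E).
    apply/measurable_EFinP; apply: measurable_funM => //; apply: measurable_indic.
    by apply: measurableI; [exact: measurable_noregen|exact: cyl_measurable].
  have F0 s w : 0 <= (chi t lam s * \1_(noregen (size s) `&` cyl s) w)%:E.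
    by rewrite lee_fin mulr_ge0.
  have [e _] := integral_wsum P n mF F0.
  apply: (@le_trans _ _ (\int[P]_w wsum n (fun s =>
      (chi t lam s * \1_(noregen (size s) `&` cyl s) w)%:E))).
    rewrite e; apply: le_wsum => s _; under eq_integral do rewrite EFinM.
    have mi : measurable (noregen (size s) `&` cyl s).
      by apply: measurableI; [exact: measurable_noregen|exact: cyl_measurable].
    rewrite ge0_integralZl ?lee_fin//; last by apply/measurable_EFinP; exact: measurable_indic.
    by rewrite integral_indic// setIT muleC.
  apply: ge0_integral_dom => w; first exact: wsum_ge0.
  apply: (@le_trans _ _ (wsum n (fun s => if s == pfx w n then
      (chi t lam s * \1_(noregen n) w)%:E else 0))).
    apply: le_wsum => s sn; case: eqVneq => [_|nsw].
      rewrite lee_fin ler_wpM2l// !indicE ler_nat sn.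
      by case: (boolP (w \in _ `&` _)) => // /set_mem[/mem_set ->].
    rewrite lee_fin indicE memNset ?mulr0// => -[_ cw].
    by move/eqP: nsw; apply; rewrite -sn -[LHS]cw.
  have := wsum_pick (pfx w n) (fun s => (chi t lam s * \1_(noregen n) w)%:E).
  rewrite size_pfx => ->; rewrite indicE; case: (boolP (w \in _)) => [/set_mem nw|_].
    by rewrite mulr1; exact: hno.
  by rewrite mulr0.
exists (fine (\int[P]_w Y w)); first exact: fine_ge0.
rewrite -CE; split => //; last first.
  move=> n; apply: le_trans (h1 n); apply: le_wsum => s _.
  by rewrite lee_wpmul2r ?lee_fin.
pose F b w : \bar R := if firstw b then (chi t lam b * \1_(Ev b) w)%:E else 0.
have mEv b : measurable (Ev b) by exact: measurable_Ev.
have mF b : measurable_fun setT (F b).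
  rewrite /F; case: (firstw b); last exact: measurable_cst.
  by apply/measurable_EFinP; apply: measurable_funM => //; exact: measurable_indic.
have F0 b w : 0 <= F b w by rewrite /F; case: ifP => // _; rewrite lee_fin mulr_ge0.
have [e _] := integral_csum P mF F0.
apply: (@le_trans _ _ (\int[P]_w csum (F ^~ w))).
  rewrite e /bsum -csumZl ?measure_ge0//; last by move=> s; rewrite mule_ge0 ?lee_fin.
  apply: le_csum => [s|s]; first by rewrite !mule_ge0 ?measure_ge0 ?lee_fin.
  rewrite /F /firstweight; case: ifPn => [fs|_]; last by rewrite mul0e mule0 integral0.
  under eq_integral do rewrite EFinM.
  rewrite ge0_integralZl ?lee_fin//; last by apply/measurable_EFinP; exact: measurable_indic.
  rewrite integral_indic// setIT [X in _ <= _ * X](P_Ev (firstw_top fs)).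
  by rewrite muleA (muleC delta) muleC.
apply: ge0_integral_dom => w; first exact: csum_ge0.
have [[b0 [fb0 wb0]]|nob] := pselect (exists b, firstw b /\ Ev b w); last first.
  rewrite csum0// => b; rewrite /F; case: ifP => // fb.
  by rewrite indicE memNset ?mulr0// => wb; apply: nob; exists b.
have reg b : firstw b -> Ev b w -> (0 < size b)%N /\ firstregen (size b) w.
  move=> fb [wb cb]; have b0' := firstw_size fb; split => //.
  by apply/(firstregenE w b0'); rewrite /pfx [mkseq _ _]cb.
have uniq b : firstw b -> Ev b w -> b = b0.
  move=> fb wb; have [sb [rb hb]] := reg b fb wb; have [sb0 [rb0 hb0]] := reg b0 fb0 wb0.
  have sz : size b = size b0.
    have [lt|gt|//] := ltngtP (size b) (size b0).
      by case: (hb0 _ sb lt rb).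
    by case: (hb _ sb0 gt rb0).
  by case: wb => _ <-; case: wb0 => _; rewrite /cyl /= -sz => ->.
rewrite (eq_csum (h := fun b => if b == b0 then (chi t lam b)%:E else 0)).
  rewrite csum_pick; have [sb0 rb0] := reg b0 fb0 wb0.
  by have := hfirst _ _ sb0 rb0; case: wb0 => _; rewrite /cyl /= /pfx => ->.
move=> b; rewrite /F; case: eqVneq => [->|nb].
  by rewrite fb0 indicE mem_set// mulr1.
case: ifP => // fb; rewrite indicE memNset ?mulr0// => wb.
by move/eqP: nb; apply; exact: uniq.
Qed.

End growth.

Section elliptic.
Variable c1 : R.
Hypotheses (c1_gt0 : (0 < c1)%R) (elliptic : forall z, P [set w | (c1 <= pi w 0%R z)%R] = 1)
  (u_unit : enorm u = 1%R).

Section log_mgf.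
Implicit Types (s a b : seq (dir d)) (w : T) (t : 'rV[R]_d).

Definition mgf t n : R := fine (\int[P]_w (expR (dotR t (toR R (walk Zs w n))))%:E).

Lemma mgf_integral t n :
  \int[P]_w (expR (dotR t (toR R (walk Zs w n))))%:E =
  wsum n (fun s => pw s * (expR (dotR t (toR R (wpos s))))%:E).
Proof.
have e := @integral_pfx n
  (fun s => expR (dotR t (toR R (wpos s)))) (fun=> expR_ge0 _).
by apply: (eq_trans _ e); apply: eq_integral => w _; rewrite walkE.
Qed.

Lemma wsum_pw n : wsum n pw = 1.
Proof.
have := @integral_pfx n (fun=> 1%R) (fun=> ler01).
rewrite (eq_wsum (h := pw)) => [<-|s _]; last by rewrite mule1.
rewrite (_ : \int[P]_w _ = \int[P]_w (cst 1 w))// integral_cst// mul1e.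
exact: probability_setT.
Qed.

Lemma mgf_bounds t n :
  ((expR (- enorm t * n%:R))%:E <= wsum n (fun s => pw s * (expR (dotR t (toR R (wpos s))))%:E) <=
   (expR (enorm t * n%:R))%:E).
Proof.
have cst_sum (r : R) : (0 <= r)%R -> wsum n (fun s => r%:E * pw s) = r%:E.
  by move=> r0; rewrite wsumZl// wsum_pw mule1.
apply/andP; split.
  rewrite -[leLHS]cst_sum ?expR_ge0//; apply: le_wsum => s sn.
  rewrite muleC lee_wpmul2l// lee_fin ler_expR mulNr -sn.
  by have := abs_dot_wpos t s; rewrite ler_norml => /andP[].
rewrite -[leRHS]cst_sum ?expR_ge0//; apply: le_wsum => s sn.
rewrite muleC lee_wpmul2r// lee_fin ler_expR -sn.
by have := abs_dot_wpos t s; rewrite ler_norml => /andP[].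
Qed.

Lemma mgfE t n :
  wsum n (fun s => pw s * (expR (dotR t (toR R (wpos s))))%:E) = (mgf t n)%:E.
Proof.
rewrite /mgf mgf_integral fineK//; have /andP[h1 h2] := mgf_bounds t n.
rewrite ge0_fin_numE; first by rewrite (le_lt_trans h2)// ltry.
by apply: le_trans h1; rewrite lee_fin expR_ge0.
Qed.

Lemma mgf_ge t n : (expR (- enorm t * n%:R) <= mgf t n)%R.
Proof. by rewrite -lee_fin -mgfE; case/andP: (mgf_bounds t n). Qed.

Lemma mgf_gt0 t n : (0 < mgf t n)%R.
Proof. by apply: lt_le_trans (mgf_ge t n); exact: expR_gt0. Qed.

Lemma wsum_chi t lam n :
  wsum n (fun s => pw s * (chi t lam s)%:E) = (mgf t n * expR (- lam * n%:R))%:E.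
Proof.
rewrite mulrC EFinM -mgfE -wsumZl => [|s]; last by rewrite mule_ge0 ?lee_fin ?expR_ge0.
apply: eq_wsum => s sn; rewrite muleCA -EFinM; congr (_ * _%:E).
by rewrite /chi -expRD sn addrC mulNr.
Qed.

(** A step along a coordinate where [u] does not vanish, with the sign of that coordinate, raises
    the height; ellipticity gives it positive weight. This is the aperiodicity used in the lower
    renewal bound. *)
Lemma unit_block : exists2 b, size b = 1%N & 0 < bw b.
Proof.
have [i ui] : exists i, (u 0 i != 0)%R.
  apply: contrapT => /forallNP h; have : (enorm u ^+ 2 = 0)%R.
    rewrite enorm_sqr big1// => i _; have /negP := h i; rewrite negbK => /eqP ->.
    by rewrite expr0n.
  by move/eqP; rewrite u_unit expr1n oner_eq0.
pose z : dir d := (i, (0 < u 0 i)%R).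
have hz : (0 < height u [:: z])%R.
  rewrite /height /site_height wpos_cons wpos_nil addr0 dotRC dot_vec /z /=.
  case: (ltrP 0%R (u 0%R i)) => h; first by rewrite /= mul1r.
  by rewrite /= mulN1r oppr_gt0 lt_neqAle ui.
exists [:: z] => //; rewrite /blockweight.
have -> : blockw [:: z].
  rewrite /blockw /firstw /=; apply/andP; split; last first.
    by apply/stayP => -[|j] /=; rewrite ?height_nil// ltW.
  by rewrite andbT; apply/topP => -[|//] _ /=; rewrite height_nil.
apply: lt_le_trans (pw_step z elliptic).
by rewrite lte_fin.
Qed.

Lemma PD_le_pw s : PD s <= pw s.
Proof.
rewrite -cyl_pw; apply: le_measure; rewrite ?inE; [| |by move=> w []].
  by apply: measurableI; [exact: measurable_stayD|exact: cyl_measurable].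
exact: cyl_measurable.
Qed.

Let renewal := @block_renewal.
Let delayed := @delayed_renewal.

Lemma chi_le_chi t (lam lam' : R) s : (lam <= lam')%R -> (chi t lam' s <= chi t lam s)%R.
Proof. by move=> ll; rewrite /chi ler_expR lerD2l lerN2 ler_wpM2r. Qed.

(** Exponential growth at [lam0] excludes a linear bound there. If [delta] vanished, [pw] would
    equal [rho1], whose tilted sums are bounded; if the block mass were at most 1, growth would be
    at most linear. So the mass exceeds 1 at [lam0] and equals 1 at some larger [lam], where the two
    renewal bounds enclose the growth rate within every [kap]. *)
Lemma growth_root t lam0 (C a : R) (N : nat) : (0 < a)%R ->
  delta * bsum fw (fun b => (chi t lam0 b)%:E) <= C%:E ->
  (forall n, wsum n (fun s => rho1 s * (chi t lam0 s)%:E) <= C%:E) ->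
  (forall n, wsum n (fun s => rho s * (chi t lam0 s)%:E) <= C%:E) ->
  (forall n, (N <= n)%N -> expR (a * n%:R) <= mgf t n * expR (- lam0 * n%:R))%R ->
  [/\ 0 < delta, bsum fw (fun b => (chi t lam0 b)%:E) < +oo &
    exists lam, [/\ (lam0 < lam)%R, bsum bw (fun b => (chi t lam b)%:E) = 1 &
     (fun n => ln (mgf t n) / n%:R)%R @ \oo --> lam]].
Proof.
move=> a0 hfw hrho1 hrho hgrow.
have no_lin C' : ~ (forall n, wsum n (fun s => pw s * (chi t lam0 s)%:E) <= (C' * n.+1%:R)%:E).
  move=> h; apply: (@expR_not_linear R a C' N a0) => n Nn.
  by apply: (le_trans (hgrow n Nn)); rewrite -lee_fin -wsum_chi.
have dfin : delta \is a fin_num by exact: delta_fin.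
have d0 : 0 < delta.
  rewrite lt_neqAle PD0 andbT; apply/negP => /eqP d0.
  have PDz s : PD s = 0.
    apply/eqP; rewrite eq_le PD0 andbT d0; apply: le_measure; rewrite ?inE.
    - by apply: measurableI; [exact: measurable_stayD|exact: cyl_measurable].
    - by apply: measurableI; [exact: measurable_stayD|exact: cyl_measurable].
    - by move=> w [].
  apply: (no_lin C) => n; apply: (@le_trans _ _ C%:E).
    apply: le_trans (hrho1 n); apply: le_wsum => s _; rewrite {1}delayed big1 ?adde0//.
    by move=> i _; rewrite PDz mule0.
  have C0 : (0 <= C)%R.
    by rewrite -lee_fin; apply: le_trans (hrho 0%N); rewrite mule_ge0 ?lee_fin.
  by rewrite lee_fin ler_peMr// ler1n.
have [dd dE dd0] : exists2 r : R, delta = r%:E & (0 < r)%R.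
  by exists (fine delta); rewrite ?fineK// -lte_fin fineK.
have fwle : bsum fw (fun b => (chi t lam0 b)%:E) <= (C / dd)%:E.
  by rewrite mulrC EFinM lee_pdivlMl// -dE.
have fwfin : bsum fw (fun b => (chi t lam0 b)%:E) < +oo by rewrite (le_lt_trans fwle)// ltry.
have bwle lam : bsum bw (fun b => (chi t lam b)%:E) <= bsum fw (fun b => (chi t lam b)%:E).
  by apply: le_csum => b; [rewrite mule_ge0 ?lee_fin | rewrite lee_wpmul2r ?lee_fin].
have phi_gt1 : 1 < bsum bw (fun b => (chi t lam0 b)%:E).
  rewrite ltNge; apply/negP => phi1.
  have [C' hC'] := @char_upper R (dir d) bw fw PD pw rho rho1 bw0 fw0 PD0 rho0 rho10
    bw_nil renewal delayed (chi t lam0) (chi_gt0 t lam0) (chi_nil t lam0) (chi_cat t lam0)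
    C _ phi1 hrho hrho1 fwle.
  exact: no_lin hC'.
split => //.
pose Phi lam := bsum bw (fun b => (expR (dotR t (toR R (wpos b))) * expR (- lam * (size b)%:R))%:E).
have phiE lam : bsum bw (fun b => (chi t lam b)%:E) = Phi lam.
  by apply: eq_bsum => b _; rewrite /chi -expRD mulNr.
have phifin := le_lt_trans (bwle lam0) fwfin.
have [ph phE] : exists r : R, bsum bw (fun b => (chi t lam0 b)%:E) = r%:E.
  exists (fine (bsum bw (fun b => (chi t lam0 b)%:E))); rewrite fineK// ge0_fin_numE//.
  by apply: bsum_ge0 => // b; rewrite lee_fin.
have ph1 : (1 < ph)%R by rewrite -lte_fin -phE.
have Phi0fin : Phi lam0 < +oo by rewrite -phiE.
have Phi0gt : 1 < Phi lam0 by rewrite -phiE.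
have lam01 : (lam0 < lam0 + ph)%R by lra.
(* Blocks are nonempty, so raising the exponent by the mass [ph] itself divides the mass by at least
   [e^ph >= ph]. *)
have Phi1 : Phi (lam0 + ph)%R <= 1.
  rewrite -phiE.
  apply: (@le_trans _ _ (bsum bw (fun b => (expR (- ph))%:E * (chi t lam0 b)%:E))).
    apply: le_bsum => // [b|b wb]; first by rewrite lee_fin.
    rewrite -EFinM lee_fin /chi -expRD ler_expR.
    have b1 : (1 <= (size b)%:R :> R)%R.
      by rewrite ler1n; case: b wb => //; rewrite bw_nil eqxx.
    have : (ph * 1 <= ph * (size b)%:R)%R by rewrite ler_wpM2l//; lra.
    by rewrite mulrDl; lra.
  have -> : bsum bw (fun b => (expR (- ph))%:E * (chi t lam0 b)%:E) = (expR (- ph))%:E * ph%:E.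
    by rewrite -phE; apply: bsumZl => // *; rewrite lee_fin ?expR_ge0.
  rewrite -EFinM lee_fin.
  rewrite expRN mulrC ler_pdivrMr ?expR_gt0// mul1r.
  by have := @expR_ge1Dx R ph; lra.
have [lam lam0l lamE] := @bsum_expR_root R (dir d) bw bw0
  (fun b => expR (dotR t (toR R (wpos b)))) (fun=> expR_ge0 _) lam0 (lam0 + ph)%R
  Phi0fin Phi0gt lam01 Phi1.
rewrite -/(Phi lam) in lamE.
rewrite -phiE in lamE.
exists lam; split => //; apply: cvg_div_nat => kap kap0.
have up1 : bsum bw (fun b => (chi t lam b)%:E) <= 1 by rewrite lamE.
have hrho' n : wsum n (fun s => rho s * (chi t lam s)%:E) <= C%:E.
  apply: le_trans (hrho n); apply: le_wsum => s _.
  by rewrite lee_wpmul2l// lee_fin chi_le_chi// ltW.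
have hrho1' n : wsum n (fun s => rho1 s * (chi t lam s)%:E) <= C%:E.
  apply: le_trans (hrho1 n); apply: le_wsum => s _.
  by rewrite lee_wpmul2l// lee_fin chi_le_chi// ltW.
have fwle' : bsum fw (fun b => (chi t lam b)%:E) <= (C / dd)%:E.
  apply: le_trans fwle; apply: le_bsum => // [b|b _]; rewrite lee_fin//.
  by rewrite chi_le_chi// ltW.
have [C' hC'] := @char_upper R (dir d) bw fw PD pw rho rho1 bw0 fw0 PD0 rho0 rho10
    bw_nil renewal delayed (chi t lam) (chi_gt0 t lam) (chi_nil t lam) (chi_cat t lam)
    C _ up1 hrho' hrho1' fwle'.
have [b1 b1s b1w] := unit_block.
have [c c0 hc] := @renewal_lower R (dir d) bw PD rho bw0 PD0 rho0 bw_nil renewal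
  (chi t lam) b1 kap (chi_gt0 t lam) (chi_cat t lam) lamE kap0 b1s b1w d0.
have [D D0 hD] := @linear_le_expR R kap kap0.
have lo n : (c * expR (- kap * n%:R) <= mgf t n * expR (- lam * n%:R))%R.
  rewrite -lee_fin -wsum_chi; apply: (le_trans (hc n)); apply: le_wsum => s _.
  by rewrite lee_wpmul2r ?lee_fin// PD_le_pw.
have hi n : (mgf t n * expR (- lam * n%:R) <= `|C'| * D * expR (kap * n%:R) + 1 * expR (kap * n%:R))%R.
  rewrite -lee_fin -wsum_chi; apply: (le_trans (hC' n)); rewrite lee_fin.
  apply: (@le_trans _ _ (`|C'| * n.+1%:R)%R); first by rewrite ler_wpM2r// ler_norm.
  rewrite -mulrA; apply: (@le_trans _ _ (`|C'| * (D * expR (kap * n%:R)))%R).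
    by rewrite ler_wpM2l.
  by rewrite lerDl mul1r expR_ge0.
exists (`|ln c| + `|ln (`|C'| * D + 1)|)%R => n.
have E0 : (0 < `|C'| * D + 1)%R by rewrite ltr_wpDl// mulr_ge0// ltW.
have xE : (ln (mgf t n) - lam * n%:R = ln (mgf t n * expR (- lam * n%:R)))%R.
  by rewrite lnM ?posrE ?mgf_gt0 ?expR_gt0// expRK mulNr.
have lnlo : (ln c - kap * n%:R <= ln (mgf t n) - lam * n%:R)%R.
  rewrite xE -[X in (X <= _)%R](_ : ln (c * expR (- kap * n%:R)) = _)%R.
    by rewrite ler_ln ?posrE ?mulr_gt0 ?mgf_gt0 ?expR_gt0.
  by rewrite lnM ?posrE ?expR_gt0// expRK mulNr.
have lnhi : (ln (mgf t n) - lam * n%:R <= ln (`|C'| * D + 1) + kap * n%:R)%R.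
  rewrite xE -[X in (_ <= X)%R](_ : ln ((`|C'| * D + 1) * expR (kap * n%:R)) = _)%R.
    by rewrite ler_ln ?posrE ?mulr_gt0 ?mgf_gt0 ?expR_gt0// mulrDl.
  by rewrite lnM ?posrE ?expR_gt0// expRK.
have := ler_norm (ln (`|C'| * D + 1))%R; have := normr_ge0 (ln (`|C'| * D + 1))%R.
have := ler_norm (- ln c)%R; rewrite normrN; have := normr_ge0 (ln c).
move=> h1 h2 h3 h4; rewrite ler_norml; apply/andP; split; lra.
Qed.

End log_mgf.

Variable c : R.
Hypothesis hc : (~ nestling P pi -> nonnest_const P Zs u c) /\ (nestling P pi -> nest_const P Zs u c).

Section tilting_set.
Implicit Types (s a b : seq (dir d)) (w : T) (t : 'rV[R]_d).

Lemma tau1_firstregen k w : (0 < k)%N -> firstregen k w -> tau Zs u w 1 = Some k.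
Proof.
move=> k0 /(firstregenE _ k0)[fk wk] /=.
by apply/next_regenP => //; split => //; rewrite drop0.
Qed.

Lemma tau1_noregen n w k : noregen n w -> tau Zs u w 1 = Some k -> (n < k)%N.
Proof.
move=> nn /= /next_regenP [//|k0 fk wk].
rewrite ltnNge; apply/negP => kn; apply: (nn k); first by rewrite k0.
by apply/regenE; split => //; rewrite -[pfx w k]drop0; exact: firstw_top.
Qed.

Lemma chi_le_expR t lam s : (chi t lam s <= expR ((enorm t - lam) * (size s)%:R))%R.
Proof.
rewrite /chi ler_expR mulrBl lerD2r.
by apply: le_trans (ler_norm _) (abs_dot_wpos t s).
Qed.

Lemma Lambda_a_cvg t : (0 < Lambda_a P Zs t)%R ->
  (fun n => ln (mgf t n) / n%:R)%R @ \oo --> Lambda_a P Zs t.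
Proof.
rewrite /Lambda_a -/(mgf t) => L0.
have [cv|dv] := pselect (cvgn (fun n : nat => (ln (mgf t n) / n%:R)%R : R)); first exact: cv.
(* A divergent sequence has the default limit 0, which positivity excludes. *)
by move: L0; rewrite (dvgP dv) ltxx.
Qed.

(** Both regimes reduce to a [lam0] at which the tilt before and at the first regeneration is
    dominated by an integrable [Y], while the untruncated walk still grows exponentially relative to
    [lam0]. *)
Lemma tilting_root t : Cset P pi Zs c t ->
  0 < delta /\ exists lam0 C, [/\ (lam0 < Lambda_a P Zs t)%R,
    bsum fw (fun b => (chi t lam0 b)%:E) < +oo,
    bsum bw (fun b => (chi t (Lambda_a P Zs t) b)%:E) = 1,
    (fun n => ln (mgf t n) / n%:R)%R @ \oo --> Lambda_a P Zs t &
    (forall n, wsum n (fun s => rho1 s * (chi t lam0 s)%:E) <= C%:E) /\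
    (forall n, wsum n (fun s => rho s * (chi t lam0 s)%:E) <= C%:E)].
Proof.
move=> [tc Lpos]; have [hnon hnest] := hc.
suff [lam0 [Y [a [N [Y0 Yfin hfirst hno [a0 hgrow]]]]]] : exists lam0 (Y : T -> \bar R) (a : R) (N : nat),
  [/\ forall w, 0 <= Y w, \int[P]_w Y w < +oo,
    (forall k w, (0 < k)%N -> firstregen k w -> (chi t lam0 (pfx w k))%:E <= Y w),
    (forall n w, noregen n w -> (chi t lam0 (pfx w n))%:E <= Y w) &
    (0 < a)%R /\
    (forall n, (N <= n)%N -> expR (a * n%:R) <= mgf t n * expR (- lam0 * n%:R))%R].
  have [C C0 [h1 h2 h3]] := dominated_moments Y0 Yfin hfirst hno.
  have [d0 fin [lam [ll lamE cv]]] := growth_root a0 h1 h2 h3 hgrow.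
  have LE : Lambda_a P Zs t = lam by apply/cvg_lim.
  by split => //; exists lam0, C; rewrite LE.
have [nest|nonnest] := pselect (nestling P pi); last first.
  have [c0 fin] := hnon nonnest.
  pose Y w : \bar R := match tau Zs u w 1 with
    | Some k => (expR (2 * c * k%:R))%:E | None => +oo end.
  have E2c s : (chi t (enorm t - 2 * c) s <= expR (2 * c * (size s)%:R))%R.
    by apply: (le_trans (chi_le_expR _ _ _)); rewrite ler_expR opprB addrCA subrr addr0.
  (* Since [<t,X_n> <= |t| n], this exponent bounds the tilt by [e^(2 c n)]; as the moment
     generating function is at least [e^(- |t| n)], the growth rate is at least
     [2 (c - |t|) > 0]. *)
  exists (enorm t - 2 * c)%R, Y, (2 * (c - enorm t))%R, 0%N; split => //.
  - by move=> w; rewrite /Y; case: (tau _ _ _ _) => // k; rewrite lee_fin expR_ge0.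
  - move=> k w k0 wk; rewrite /Y (tau1_firstregen k0 wk) lee_fin.
    by apply: (le_trans (E2c _)); rewrite size_pfx.
  - move=> n w wn; rewrite /Y; case e : (tau _ _ _ _) => [k|]; last by rewrite leey.
    have nk := tau1_noregen wn e; rewrite lee_fin; apply: (le_trans (E2c _)).
    by rewrite size_pfx ler_expR ler_wpM2l ?mulr_ge0 ?(ltW c0)// ler_nat ltnW.
  - split; first by rewrite mulr_gt0// subr_gt0.
    move=> n _; have := @mgf_ge t n.
    move=> h; apply: (@le_trans _ _ (expR (- enorm t * n%:R) * expR (- (enorm t - 2 * c) * n%:R))%R).
      by rewrite -expRD ler_expR; lra.
    by rewrite ler_wpM2r ?expR_ge0.
have [c0 fin] := hnest nest; have {}Lpos := Lpos nest.
pose Y w : \bar R := ereal_sup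
      [set (expR (c * enorm (toR R (walk Zs w n))))%:E | n in
         [set n | (1 <= n)%N /\
                  match tau Zs u w 1 with
                  | Some t => (n <= t)%N | None => True end]].
have YE w n : (0 < n)%N -> match tau Zs u w 1 with Some k => is_true (n <= k)%N | None => True end ->
    (chi t 0 (pfx w n))%:E <= Y w.
  move=> n0 hn; apply: (@le_trans _ _ (expR (c * enorm (toR R (walk Zs w n))))%:E).
    rewrite lee_fin /chi mul0r subr0 ler_expR -walkE.
    apply: (le_trans (dotR_le_enorm _ _)); rewrite ler_wpM2r ?enorm_ge0//.
    exact: ltW.
  by apply: ereal_sup_ubound; exists n.
have Y1 w : 1 <= Y w.
  apply: (@le_trans _ _ (expR (c * enorm (toR R (walk Zs w 1))))%:E).
    by rewrite lee_fin -[leLHS]expR0 ler_expR mulr_ge0 ?enorm_ge0// ltW.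
  apply: ereal_sup_ubound; exists 1%N => //; split => //.
  by case e : (tau _ _ _ _) => [k|//]; case/next_regenP: e.
have cv := Lambda_a_cvg Lpos.
set L := Lambda_a P Zs t in Lpos cv *.
have L2 : (0 < L / 2)%R by rewrite divr_gt0.
have /cvgrPdist_le /(_ _ L2) [N _ hN] := cv.
(* In the nestling case no moment of [tau_1] is available, so the exponent is 0: [Y] dominates
   [e^<t,X_n>] as [|t| < c], and growth comes from [Lambda_a(t) > 0]. *)
exists 0%R, Y, (L / 2)%R, N.+1; split => //.
- by move=> w; apply: le_trans (Y1 w).
- move=> k w k0 wk; apply: YE => //.
  by rewrite (tau1_firstregen k0 wk).
- move=> n w wn; case: n wn => [|n] wn; first by rewrite /chi mul0r subr0 dot_nil expR0.
  apply: YE => //; case e : (tau _ _ _ _) => [k|//].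
  by rewrite ltnW// (tau1_noregen wn e).
split; first by rewrite divr_gt0.
move=> n Nn; rewrite oppr0 mul0r expR0 mulr1.
have n0 : (0 < n%:R :> R)%R by rewrite ltr0n (leq_trans _ Nn).
have := hN n (ltnW Nn); rewrite ler_norml => /andP[_ h].
have h' : (L / 2 <= ln (mgf t n) / n%:R)%R by lra.
rewrite ler_pdivlMr// in h'.
have mp := @mgf_gt0 t n.
by rewrite -(lnK mp) ler_expR.
Qed.

End tilting_set.

(** * Deviations under the tilted law *)

Section one_sided.
Variable t : 'rV[R]_d.
Hypothesis tC : Cset P pi Zs c t.
Variables (z0 : dir d) (K : nat) (M : R).
Implicit Types (s a b : seq (dir d)) (w : T) (L : seq (seq (dir d))) (f : (nat -> dir d) -> R).

Local Notation lam := (Lambda_a P Zs t).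

Lemma bsum_bw_fw r : bsum bw (fun b => (chi t r b)%:E) <= bsum fw (fun b => (chi t r b)%:E).
Proof.
apply: le_csum => b; first by rewrite mule_ge0 ?lee_fin.
by rewrite lee_wpmul2r ?lee_fin.
Qed.

(** Finite by [x <= e^(eta x) / eta] with [eta = lam - lam0]; at least 1 because blocks are
    nonempty. *)
Lemma mean_block_length : exists2 ell, (0 < ell)%R &
  bsum bw (fun b => ((size b)%:R * chi t lam b)%:E) = ell%:E.
Proof.
have [d0 [lam0 [C [ll fin h1 _ _]]]] := tilting_root tC.
have eta0 : (0 < lam - lam0)%R by rewrite subr_gt0.
have S0 b : 0 <= ((size b)%:R * chi t lam b)%:E by rewrite lee_fin mulr_ge0.
have le : bsum bw (fun b => ((size b)%:R * chi t lam b)%:E) <=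
    ((lam - lam0)^-1)%:E * bsum bw (fun b => (chi t lam0 b)%:E).
  have -> : ((lam - lam0)^-1)%:E * bsum bw (fun b => (chi t lam0 b)%:E) =
      bsum bw (fun b => ((lam - lam0)^-1)%:E * (chi t lam0 b)%:E).
    by apply/esym/bsumZl => // *; rewrite lee_fin ?invr_ge0 ?(ltW eta0).
  apply: le_bsum => // b _; rewrite -EFinM lee_fin mulrC.
  have -> : lam0 = (lam - (lam - lam0))%R by rewrite opprB addrC subrK.
  rewrite chi_shift mulrCA ler_wpM2l// opprB addrCA subrr addr0.
  rewrite -(ler_pM2l eta0) mulrA divff ?gt_eqF// mul1r.
  by have := @expR_ge1Dx R ((lam - lam0) * (size b)%:R)%R; lra.
have fin' : bsum bw (fun b => ((size b)%:R * chi t lam b)%:E) < +oo.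
  apply: (le_lt_trans le); rewrite lte_mul_pinfty ?lee_fin ?invr_ge0 ?(ltW eta0)//.
  exact: le_lt_trans (bsum_bw_fw _) fin.
have E : bsum bw (fun b => ((size b)%:R * chi t lam b)%:E) =
    (fine (bsum bw (fun b => ((size b)%:R * chi t lam b)%:E)))%:E.
  by rewrite fineK// ge0_fin_numE// bsum_ge0.
exists (fine (bsum bw (fun b => ((size b)%:R * chi t lam b)%:E))) => //.
rewrite -lte_fin -E; apply: (@lt_le_trans _ _ 1) => //; rewrite -h1.
apply: le_bsum => // [b|b wb]; first by rewrite lee_fin.
rewrite lee_fin ler_peMl// ler1n.
by case: b wb => //; rewrite bw_nil eqxx.
Qed.

Lemma headsum_bound (g : seq (dir d) -> R) B : (forall s, (0 <= g s <= B)%R) ->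
  exists gam, bsumn bw K.+1 (fun L => (headsum g L * chi t lam (flatten L))%:E) = gam%:E.
Proof.
move=> gB; have [ell ell0 hell] := mean_block_length.
have [d0 [lam0 [C [ll fin h1 _ _]]]] := tilting_root tC.
have B0 : (0 <= B)%R by case/andP: (gB [::]) => x y; exact: le_trans y.
have H0 L : 0 <= (headsum g L * chi t lam (flatten L))%:E.
  by rewrite lee_fin mulr_ge0// (headsum_ge0 gB).
have hs := integral_headsize K h1 hell.
exists (fine (bsumn bw K.+1 (fun L => (headsum g L * chi t lam (flatten L))%:E))).
rewrite fineK// ge0_fin_numE ?bsumn_ge0//.
apply: (@le_lt_trans _ _ (B * ell)%:E); last by rewrite ltry.
rewrite EFinM -hs; apply: (@le_trans _ _ (bsumn bw K.+1
   (fun L => B%:E * ((size (head [::] L))%:R * chi t lam (flatten L))%:E))).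
  apply: le_bsumn => // L _ _; rewrite -EFinM lee_fin mulrA ler_wpM2r//.
  exact: (headsum_le gB).
by rewrite (bsumnZl bw0)// => L; rewrite lee_fin mulr_ge0.
Qed.

Hypothesis M0 : (0 <= M)%R.

Let on_bound f : (forall z : nat -> dir d, `|f z| <= M)%R -> forall s,
  (0 <= on_words z0 (fun z => f z + M)%R s <= M + M)%R.
Proof.
by move=> fM s; rewrite /on_words; have := fM (nth z0 s); rewrite ler_norml => /andP[? ?]; apply/andP; split; lra.
Qed.

Lemma mu_value f : (forall z : nat -> dir d, `|f z| <= M)%R ->
  (forall x y : nat -> dir d, (forall k, (k < K)%N -> x k = y k) -> f x = f y) ->
  exists ell gam, [/\ (0 < ell)%R,
    bsum bw (fun b => ((size b)%:R * chi t lam b)%:E) = ell%:E,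
    bsumn bw K.+1 (fun L => (headsum (on_words z0 (fun z => f z + M)%R) L *
       chi t lam (flatten L))%:E) = gam%:E &
    mu_int P Zs u t f K.+1 = (gam / ell - M)%R].
Proof.
move=> fM fK; have [ell ell0 hell] := mean_block_length.
have [gam hgam] := headsum_bound (on_bound fM).
have [d0 [lam0 [C [ll fin h1 _ _]]]] := tilting_root tC.
exists ell, gam; split => //.
exact: (mu_intE d0 fM fK ell0 h1 hell hgam).
Qed.

(** Both values are computed from the nonnegative functions [M + f] and [M - f], whose head sums add
    up to [2 M] times the length of the first block. *)
Lemma mu_intN f : (forall z : nat -> dir d, `|f z| <= M)%R ->
  (forall x y : nat -> dir d, (forall k, (k < K)%N -> x k = y k) -> f x = f y) ->
  mu_int P Zs u t (fun z => - f z)%R K.+1 = (- mu_int P Zs u t f K.+1)%R.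
Proof.
move=> fM fK.
have fM' z : (`|- f z| <= M)%R by rewrite normrN.
have fK' x y : (forall k, (k < K)%N -> x k = y k) -> (- f x = - f y)%R.
  by move=> h; rewrite (fK x y h).
have [ell [gam [ell0 hell hgam ->]]] := mu_value fM fK.
have [ell' [gam' [_ hell' hgam' ->]]] := mu_value fM' fK'.
have ellE : ell' = ell by apply: EFin_inj; rewrite -hell -hell'.
have [d0 [lam0 [C [ll fin h1 _ _]]]] := tilting_root tC.
have hs := integral_headsize K h1 hell.
have H0 (g : seq (dir d) -> R) B : (forall s, 0 <= g s <= B)%R -> forall L,
    0 <= (headsum g L * chi t lam (flatten L))%:E.
  by move=> gB L; rewrite lee_fin mulr_ge0// (headsum_ge0 gB).
have : (gam + gam')%:E = (2 * M * ell)%:E.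
  rewrite EFinD -hgam -hgam' EFinM -hs -(bsumnD bw0 K.+1 (H0 _ _ (on_bound fM)) (H0 _ _ (on_bound fM'))).
  rewrite -(bsumnZl bw0); last 2 first.
  - by rewrite lee_fin mulr_ge0.
  - by move=> L; rewrite lee_fin mulr_ge0.
  apply: eq_bsumn => L _ _; rewrite -EFinD -EFinM mulrA -mulrDl; congr (_ * _)%:E.
  rewrite /headsum -big_split/= /on_words.
  transitivity (\sum_(j < size (head [::] L)) (2 * M))%R.
    by apply: eq_bigr => j _; ring.
  by rewrite sumr_const card_ord mulr_natr.
move=> e0; have e := EFin_inj e0; rewrite ellE.
have -> : (gam' = 2 * M * ell - gam)%R by lra.
by field; rewrite gt_eqF.
Qed.

(** The functional bound for [f + M] with [eta = lam - lam0]; on words of length [n] the shift adds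
    [M n] both to the sum and to its centering. *)
Lemma one_sided_mgf f eps : (forall z : nat -> dir d, `|f z| <= M)%R ->
  (forall x y : nat -> dir d, (forall k, (k < K)%N -> x k = y k) -> f x = f y) ->
  (0 < eps)%R ->
  exists2 sig, (0 < sig)%R & exists C, forall n,
    wsum n (fun s => pw s * (chi t lam s *
      expR (sig * (wordsum (on_words z0 f) s - mu_int P Zs u t f K.+1 * n%:R)))%:E) <=
    (C * n.+1%:R * expR (sig * eps / 2 * n%:R))%:E.
Proof.
move=> fM fK eps0.
have [ell [gam [ell0 hell hgam muE]]] := mu_value fM fK.
have [d0 [lam0 [C [ll fin h1 _ [hr1 hr]]]]] := tilting_root tC.
have eta0 : (0 < lam - lam0)%R by rewrite subr_gt0.
have chiE s : (chi t lam s * expR ((lam - lam0) * (size s)%:R) = chi t lam0 s)%R.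
  by rewrite -chi_shift opprB addrCA subrr addr0.
have bfin := le_lt_trans (bsum_bw_fw lam0) fin.
have finE (v : seq (dir d) -> \bar R) : (forall s, 0 <= v s) ->
    bsum v (fun b => (chi t lam0 b)%:E) < +oo ->
    bsum v (fun b => (chi t lam b * expR ((lam - lam0) * (size b)%:R))%:E) =
    (fine (bsum v (fun b => (chi t lam0 b)%:E)))%:E.
  move=> v0 vfin; rewrite fineK; first by apply: eq_bsum => b _; rewrite chiE.
  by rewrite ge0_fin_numE// bsum_ge0// => b; rewrite lee_fin.
have gloc s s' : (K <= size s)%N ->
    on_words z0 (fun z => f z + M)%R (s ++ s') = on_words z0 (fun z => f z + M)%R s.
  by apply: on_words_local => x y h; rewrite (fK x y h).
have hr' n : wsum n (fun s => rho s *
    (chi t lam s * expR ((lam - lam0) * (size s)%:R))%:E) <= C%:E.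
  by apply: le_trans (hr n); apply: le_wsum => s _; rewrite chiE.
have hr1' n : wsum n (fun s => rho1 s *
    (chi t lam s * expR ((lam - lam0) * (size s)%:R))%:E) <= C%:E.
  by apply: le_trans (hr1 n); apply: le_wsum => s _; rewrite chiE.
have fin1 : bsum fw (fun b => (chi t lam b * expR ((lam - lam0) * (size b)%:R))%:E) <=
    (fine (bsum fw (fun b => (chi t lam0 b)%:E)))%:E by rewrite (finE _ fw0 fin).
have [sig sig0 [C' hC']] := functional_upper bw0 fw0 PD0 rho0 rho10 bw_nil block_renewal
  delayed_renewal (chi_gt0 t lam) (chi_nil t lam) (chi_cat t lam)
  (on_bound fM) gloc eta0 eps0 ell0 h1 (finE _ bw0 bfin)
  hr' hr1' fin1 hell hgam.
exists sig => //; exists C' => n; apply: le_trans (hC' n).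
rewrite le_eqVlt; apply/orP; left; apply/eqP; apply: eq_wsum => s sn.
congr (_ * (_ * expR (sig * _))%:E); rewrite muE /wordsum /on_words big_split/=.
by rewrite sumr_const card_ord sn -mulr_natr; ring.
Qed.

End one_sided.

(** * Concentration of the tilted law at xi *)

Section tightness.
Implicit Types (s : seq (dir d)) (t : 'rV[R]_d).
Local Notation Lam := (Lambda_a P Zs).
Let X s : 'rV[R]_d := toR R (wpos s).

Lemma mgf_eventually t kap : Cset P pi Zs c t -> (0 < kap)%R ->
  exists N, forall n, (N <= n)%N ->
    (expR ((Lam t - kap) * n%:R) <= mgf t n <= expR ((Lam t + kap) * n%:R))%R.
Proof.
move=> tC k0; have [_ [lam0 [C [_ _ _ cv _]]]] := tilting_root tC.
have /cvgrPdist_le/(_ _ k0) [N _ hN] := cv.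
exists N.+1 => n Nn; have := hN n (ltnW Nn) => /=.
have n0 : (0 < n%:R :> R)%R by rewrite ltr0n (leq_trans _ Nn).
have m0 := @mgf_gt0 t n.
rewrite ler_distl => /andP[h1 h2].
rewrite -{1 2}(lnK (x := mgf t n)) ?posrE// !ler_expR -(ler_pdivlMr _ _ n0) -(ler_pdivrMr _ _ n0).
by apply/andP; split; lra.
Qed.

Variables theta xi : 'rV[R]_d.
Hypotheses (thetaC : Cset P pi Zs c theta) (grad : is_grad Lam theta xi).

Lemma directional_grad (z : dir d) e : (0 < e)%R ->
  exists2 r, (0 < r)%R & forall h, (0 < h < r)%R ->
    (`|Lam (theta + h *: toR R (vec z)) - Lam theta - h * dotR xi (toR R (vec z))| <= e * h)%R.
Proof.
move=> e0; have [r r0 hr] := directional_increment (grad z.1) e0; exists r => // h /andP[h0 hlt].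
have vE : toR R (vec z) = ((if z.2 then 1 else -1) *: delta_mx 0 z.1 :> 'rV[R]_d)%R.
  apply/rowP => i; rewrite !mxE !eqxx/= eq_sym.
  by case: z.2; case: (_ == _); rewrite /= ?mulr1 ?mulr0 ?mulr1z ?mulrN1z.
have sh : (`|h * (if z.2 then 1 else -1)| = h)%R.
  by case: z.2; rewrite ?mulr1 ?mulrN1 ?normrN gtr0_norm.
have := hr (h * (if z.2 then 1 else -1))%R; rewrite sh h0 hlt => /(_ isT).
by rewrite vE scalerA -vE dot_vec mulrA.
Qed.

(** Growth rates are known only on the tilting set, so the perturbed parameter has to stay in it:
    the norm bound is strict, and in the nestling case the first-order expansion keeps [Lambda_a]
    positive. *)
Lemma perturbed_Cset (z : dir d) del : (0 < del)%R ->
  exists2 h, (0 < h)%R & Cset P pi Zs c (theta + h *: toR R (vec z))%R /\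
    (Lam (theta + h *: toR R (vec z)) <= Lam theta + h * dotR xi (toR R (vec z)) + h * del)%R.
Proof.
move=> del0.
have [e [e0 ed e1]] : exists e : R, [/\ 0 < e, e <= del & e <= 1]%R.
  exists (Num.min del 1%R).
  by split; [rewrite lt_min del0/=|rewrite ge_min lexx|rewrite ge_min lexx orbT].
have [r r0 hr] := directional_grad z e0.
have [tc Lpos] := thetaC.
move: (dotR xi _) hr => g hr.
(* For a shift [h < q] the possible decrease of [Lambda_a], at most [h (|g| + 1)], is less than its
   value at [theta]. *)
have [q q0 hq] : exists2 q : R, (0 < q)%R & (nestling P pi -> q * (`|g| + 1) <= Lam theta)%R.
  have g1 : (0 < `|g| + 1)%R by rewrite ltr_wpDl.
  have [ne|nn] := pselect (nestling P pi); last by exists 1%R.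
  exists (Lam theta / (`|g| + 1))%R; first exact/divr_gt0/g1/Lpos.
  by rewrite divfK ?gt_eqF.
have [h [h0 hr' hc' hlt]] : exists h : R, [/\ 0 < h, h < r, h < c - enorm theta & h < q]%R.
  have m0 : (0 < Num.min (Num.min r (c - enorm theta)) q)%R.
    by rewrite !lt_min r0 q0 subr_gt0 tc.
  exists (Num.min (Num.min r (c - enorm theta)) q / 2)%R; move: m0.
  set m := Num.min _ q => m0.
  have : (m / 2 < m)%R by rewrite gtr_pMr// invf_lt1// ltr1n.
  by rewrite {2}/m !lt_min => /andP[/andP[]] *; split => //; rewrite divr_gt0.
exists h; first exact: h0.
have := hr h; rewrite h0 hr' => /(_ isT); rewrite ler_distl => /andP[h1 h2].
have eh : (e * h <= h * del)%R by rewrite mulrC ler_wpM2l// ltW.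
have eh1 : (e * h <= h)%R by rewrite ger_pMl.
split; last by rewrite -[leRHS]addrA -lerBlDl (le_trans h2)// lerD2l.
split.
  apply: le_lt_trans (enormD _ _) _; rewrite enormZ; last exact: ltW.
  rewrite -ltrBrDl; apply: le_lt_trans hc'.
  by rewrite ger_pMr// enorm_vec.
move=> ne; rewrite lerBrDl in h1; apply: lt_le_trans h1.
have hg : (- (h * g) <= h * `|g|)%R.
  by rewrite -mulrN ler_wpM2l ?(ltW h0)// lerNl lerNnormlW.
have : (h * (`|g| + 1) < Lam theta)%R.
  by apply: lt_le_trans (hq ne); rewrite ltr_pM2r// ltr_wpDl.
rewrite mulrDr mulr1 -subr_gt0 => /lt_le_trans; apply.
rewrite -?[leRHS]addrA lerD2l ?opprD.
by rewrite lerD ?lerN2// lerNl.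
Qed.

(** Exponential Chebyshev inequality with the tilt moved to [theta + h e]. The threshold gains
    [h del] per step; [h del / 4] is lost to differentiability and [h del / 8] to each of the two
    growth rates, which leaves [h del / 2]. *)
Lemma half_space_tail (z : dir d) del eta : (0 < del)%R -> (0 < eta)%R ->
  exists N, forall n, (N <= n)%N ->
    wsum n (fun s => pw s * (expR (dotR theta (X s)) *
      (n%:R * (dotR xi (toR R (vec z)) + del) < dotR (toR R (vec z)) (X s))%R%:R)%:E) <=
    (eta * mgf theta n)%:E.
Proof.
move=> del0 eta0; have [h h0 [hC hL]] := perturbed_Cset z (divr_gt0 del0 (ltr0n _ 4)).
set e := toR R (vec z) in hC hL *; set g := dotR xi e in hL *.
have k0 : (0 < h * del / 8)%R by rewrite divr_gt0// mulr_gt0.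
have [N1 hN1] := mgf_eventually thetaC k0.
have [N2 hN2] := mgf_eventually hC k0.
have a0 : (0 < h * del / 2)%R by rewrite divr_gt0// mulr_gt0.
have [N3 hN3] := expR_decay a0 eta0.
exists (maxn N1 (maxn N2 N3)) => n; rewrite !geq_max => /and3P[n1 n2 n3].
have /andP[l1 _] := hN1 n n1; have /andP[_ l2] := hN2 n n2; have l3 := hN3 n n3.
apply: (@le_trans _ _ (wsum n (fun s => (expR (- (h * (n%:R * (g + del)))))%:E *
    (pw s * (expR (dotR (theta + h *: e) (X s)))%:E)))).
  apply: le_wsum => s _; rewrite muleCA -EFinM lee_wpmul2l ?pw_ge0//.
  rewrite lee_fin -expRD dotRDl dotRZl.
  case: ltP => [lt|_]; last by rewrite mulr0 expR_ge0.
  by rewrite mulr1 ler_expR addrCA lerDl addrC subr_ge0 ler_pM2l// ltW.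
rewrite wsumZl; last by move=> s; rewrite mule_ge0 ?pw_ge0// lee_fin expR_ge0.
rewrite mgfE -EFinM lee_fin.
apply: (@le_trans _ _ (expR (- (h * (n%:R * (g + del)))) * expR ((Lam theta + h * g + h * (del / 4) + h * del / 8) * n%:R)))%R.
  rewrite ler_wpM2l ?expR_ge0//; apply: (le_trans l2); rewrite ler_expR ler_wpM2r// lerD2r.
  by rewrite -addrA in hL *.
apply: (@le_trans _ _ (expR (- (h * del / 2 * n%:R)) * expR ((Lam theta - h * del / 8) * n%:R)))%R.
  by rewrite -!expRD ler_expR; rewrite le_eqVlt; apply/orP; left; apply/eqP; field.
by rewrite ler_pM// expR_ge0.
Qed.

(** Outside the ball some coordinate deviates by more than [del / (d + 1)], so one of the [2 d] half
    spaces is entered. Each receives at most the fraction [eta = 1 / (2 (2 d + 1))] of the mass, and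
    together they leave at least half of it. *)
Lemma tilted_law_tight del : (0 < del)%R -> exists N, forall n, (N <= n)%N ->
  (mgf theta n / 2)%:E <= wsum n (fun s => pw s * (expR (dotR theta (X s)) *
    (enorm (n%:R^-1 *: X s - xi) <= del)%R%:R)%:E).
Proof.
move=> del0; pose del' := (del / d.+1%:R)%R.
have del'0 : (0 < del')%R by rewrite divr_gt0.
pose eta : R := ((2 * #|{: dir d}|.+1%:R)^-1)%R.
have eta0 : (0 < eta)%R by rewrite invr_gt0 mulr_gt0.
have /fin_all_exists [N hN] := fun z => half_space_tail z del'0 eta0.
exists (\max_z N z).+1 => n Nn.
have n0 : (0 < n%:R :> R)%R by rewrite ltr0n (leq_trans _ Nn).
set good := wsum n _.
pose bad z s : \bar R := pw s * (expR (dotR theta (X s)) *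
      (n%:R * (dotR xi (toR R (vec z)) + del') < dotR (toR R (vec z)) (X s))%R%:R)%:E.
have bad0 z s : 0 <= bad z s by rewrite mule_ge0 ?pw_ge0// lee_fin mulr_ge0 ?expR_ge0.
have split : (mgf theta n)%:E <= good + \sum_(z : dir d) wsum n (bad z).
  rewrite -mgfE -wsum_sum -wsumD; apply: le_wsum => s _ /=.
  have [ok|/negP nok] := boolP (enorm (n%:R^-1 *: X s - xi) <= del)%R.
    by rewrite mulr1 leeDl// sume_ge0.
  rewrite mulr0 mule0 add0e.
  have [i /negP hi] : exists i, ~ (`|(n%:R^-1 *: X s - xi) 0%R i| <= del')%R.
    by apply: contrapT => /forallNP hn; apply: nok; apply: enorm_le_coord (ltW del0) _ => i; exact: contrapT.
  have [b hb] : exists b, (n%:R * (dotR xi (toR R (vec (i, b))) + del') <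
      dotR (toR R (vec (i, b))) (X s))%R.
    move: hi; rewrite -ltNge lter_normr mxE [X in (X + _)%R]mxE [X in (_ + X)%R]mxE => hi.
    have XE : (X s ord0 i = n%:R * (n%:R^-1 * X s ord0 i))%R by rewrite mulrA divff ?gt_eqF// mul1r.
    case/orP: hi => hi; [exists true|exists false].
      rewrite (dotRC _ (X s)) !dot_vec/= !mul1r XE ltr_pM2l//; lra.
    by rewrite (dotRC _ (X s)) !dot_vec/= !mulN1r XE -mulrN ltr_pM2l//; lra.
  by rewrite (bigD1 (i, b))//= /bad hb mulr1 leeDl// sume_ge0// => z _; exact: bad0.
have : \sum_(z : dir d) wsum n (bad z) <= (mgf theta n / 2)%:E.
  apply: (@le_trans _ _ (\sum_(z : dir d) (eta * mgf theta n)%:E)).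
    apply: lee_sum => z _; apply: hN; apply: leq_trans (ltnW Nn); exact: leq_bigmax.
  rewrite sumEFin lee_fin sumr_const -[leLHS]mulr_natr mulrAC mulrC ler_wpM2l//.
    by rewrite ltW// mgf_gt0.
  rewrite /eta invfM -mulrA ler_piMr ?invr_ge0// ler_pdivrMl// mulr1 ler_nat//.
move=> hbad; have : (mgf theta n)%:E <= good + (mgf theta n / 2)%:E.
  by apply: (le_trans split); rewrite leeD2l.
rewrite -leeBlDr// -EFinB; apply: le_trans; rewrite lee_fin; lra.
Qed.

End tightness.

Section path_average.
Local Open Scope ring_scope.
Variable z0 : dir d.

(** The two sums agree except at the last [K] positions, whose windows reach beyond time [n]; there
    each term differs by at most [2 M]. *)
Lemma nu_int_wordsum (f : (nat -> dir d) -> R) M K w n : (0 < n)%N ->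
  (forall z, `|f z| <= M) ->
  (forall x y : nat -> dir d, (forall k, (k < K)%N -> x k = y k) -> f x = f y) ->
  `|n%:R * nu_int Zs f n w - wordsum (on_words z0 f) (pfx w n)| <= 2 * M * K%:R.
Proof.
move=> n0 fM fK; have M0 : 0 <= M by apply: le_trans (fM (fun=> z0)).
rewrite /nu_int mulrA divff ?mul1r ?pnatr_eq0 -?lt0n// /wordsum size_pfx -sumrB.
apply: le_trans (ler_norm_sum _ _ _) _.
apply: (@le_trans _ _ (\sum_(j < n) 2 * M * (rev_ord j < K)%N%:R)).
  apply: ler_sum => j _; case: ltnP => [_|Kj].
    apply: le_trans (ler_normB _ _) _; rewrite mulr1 mulrDl !mul1r lerD//.
    exact: fM.
  have -> : f (fun k => Zs w (j + k)%N) = on_words z0 f (drop j (pfx w n)).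
    by apply: (on_words_path _ _ fK); move: Kj (ltn_ord j) => /=; lia.
  by rewrite subrr normr0 mulr0.
rewrite -mulr_sumr -natr_sum ler_wpM2l ?mulr_ge0// ler_nat.
have := count_lt_leq n K; rewrite (reindex_inj rev_ord_inj); exact: leq_trans.
Qed.

Lemma nu_intN (f : (nat -> dir d) -> R) n w :
  nu_int Zs (fun z => - f z) n w = - nu_int Zs f n w.
Proof. by rewrite /nu_int sumrN mulrN. Qed.

Lemma nu_int_pfx (f : (nat -> dir d) -> R) K n w :
  (forall x y : nat -> dir d, (forall k, (k < K)%N -> x k = y k) -> f x = f y) ->
  nu_int Zs f n w =
  n%:R^-1 * \sum_(j < n) on_words z0 f (drop j (pfx w (n + K))).
Proof.
move=> fK; congr (_ * _); apply: eq_bigr => j _.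
by apply: (on_words_path _ _ fK); rewrite leq_add2r ltnW.
Qed.

End path_average.

(** * The conditional deviation probability *)

Section large_deviation.
Variables theta xi : 'rV[R]_d.
Hypotheses (thetaC : Cset P pi Zs c theta) (grad : is_grad (Lambda_a P Zs) theta xi).
Variables (z0 : dir d) (K : nat) (M : R).
Implicit Types (s : seq (dir d)) (f : (nat -> dir d) -> R).
Local Notation lam := (Lambda_a P Zs theta).
Let X s : 'rV[R]_d := toR R (wpos s).

Definition near_xi del n s := (enorm (n%:R^-1 *: X s - xi) <= del)%R.

Definition near_event del n : set T :=
  [set w | (enorm (n%:R^-1 *: toR R (walk Zs w n) - xi) <= del)%R].

Lemma near_eventE del n : near_event del n = [set w | near_xi del n (pfx w n)].
Proof. by apply/seteqP; split => w; rewrite /near_event /near_xi /X /= walkE. Qed.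

Lemma measurable_near del n : measurable (near_event del n).
Proof. by rewrite near_eventE; exact: measurable_pfx. Qed.

Definition excess f eps n : set T :=
  [set w | (eps < nu_int Zs f n w - mu_int P Zs u theta f K.+1)%R].

Lemma measurable_excess f eps n :
  (forall x y : nat -> dir d, (forall k, (k < K)%N -> x k = y k) -> f x = f y) ->
  measurable (excess f eps n).
Proof.
move=> fK; pose Q s := (eps < n%:R^-1 * \sum_(j < n) on_words z0 f (drop j s)
   - mu_int P Zs u theta f K.+1)%R.
rewrite (_ : excess f eps n = [set w | Q (pfx w (n + K))]); first exact: measurable_pfx.
by apply/seteqP; split => w; rewrite /excess /Q /= (nu_int_pfx z0 _ _ fK).
Qed.

Lemma P_pfx n (Q : pred (seq (dir d))) :
  P [set w | Q (pfx w n)] = wsum n (fun s => pw s * ((Q s)%:R)%:E).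
Proof.
rewrite -(integral_pfx n (fun s => ler0n _ _)).
transitivity (\int[P]_w (\1_[set w | Q (pfx w n)] w)%:E).
  by rewrite integral_indic ?setIT//; exact: measurable_pfx.
apply: eq_integral => w _; rewrite indicE; congr ((nat_of_bool _)%:R%:E).
by apply/idP/idP; rewrite inE.
Qed.

(* On the event |X_n/n - xi| <= del the tilt e^<theta,X_n> is e^(n<theta,xi>) up to e^(n|theta|del). *)
Lemma tilt_near del n s : (0 < n)%N -> near_xi del n s ->
  (`|dotR theta (X s) - dotR theta xi * n%:R| <= enorm theta * del * n%:R)%R.
Proof.
move=> n0 h; have n0' : (0 < n%:R :> R)%R by rewrite ltr0n.
have -> : (dotR theta (X s) - dotR theta xi * n%:R = n%:R * dotR theta (n%:R^-1 *: X s - xi))%R.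
  rewrite /dotR mulr_suml mulr_sumr -sumrB; apply: eq_bigr => i _.
  have -> : ((n%:R^-1 *: X s - xi) ord0 i = n%:R^-1 * X s ord0 i - xi ord0 i)%R.
    by rewrite mxE [X in (X + _)%R]mxE [X in (_ + X)%R]mxE.
  by field; rewrite gt_eqF.
rewrite normrM gtr0_norm// mulrC ler_pM2r//; apply: le_trans (abs_dotR_le _ _) _.
by rewrite ler_wpM2l ?enorm_ge0.
Qed.

(** Exponential Chebyshev inequality: on the event both [<theta,X_n>] and the centered sum of [f]
    are bounded below, so the tilted integrand times [e^a] is at least 1. The boundary error [2 M K]
    enters only the constant. *)
Lemma excess_upper f eps : (forall z, `|f z| <= M)%R ->
  (forall x y : nat -> dir d, (forall k, (k < K)%N -> x k = y k) -> f x = f y) ->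
  (0 < eps)%R ->
  exists sig C, [/\ (0 < sig)%R, (0 <= C)%R & forall del n, (0 < n)%N ->
    P (excess f eps n `&` near_event del n) <=
    (C * n.+1%:R * expR ((lam - dotR theta xi + enorm theta * del - sig * eps / 2) * n%:R))%:E].
Proof.
move=> fM fK eps0; have M0 : (0 <= M)%R by apply: le_trans (fM (fun=> z0)).
have [sig sig0 [C hC]] := one_sided_mgf thetaC z0 fM fK eps0.
exists sig, (`|C| * expR (sig * (2 * M * K%:R)))%R.
split => //.
move=> del n n0; have n0' : (0 < n%:R :> R)%R by rewrite ltr0n.
set mu := mu_int P Zs u theta f K.+1 in hC.
pose F s := wordsum (on_words z0 f) s.
pose Q s := (near_xi del n s && (eps * n%:R - 2 * M * K%:R < F s - mu * n%:R)%R).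
have sub : excess f eps n `&` near_event del n `<=` [set w | Q (pfx w n)].
  rewrite near_eventE => w [/= ex nr]; rewrite /Q nr/= ltrBlDr.
  have := nu_int_wordsum z0 w n0 fM fK; rewrite -/(F _) ler_norml => /andP[_].
  rewrite lerBlDr => h.
  have : (n%:R * (eps + mu) < n%:R * nu_int Zs f n w)%R.
    by rewrite ltr_pM2l// -ltrBrDr.
  move=> /lt_le_trans/(_ h) {}h; rewrite addrAC ltrBrDr [ltRHS]addrC.
  by rewrite -mulrDl mulrC.
have mE : measurable (excess f eps n `&` near_event del n).
  by apply: measurableI; [exact: measurable_excess|exact: measurable_near].
apply: (@le_trans _ _ (P [set w | Q (pfx w n)])).
  by apply: le_measure => //; rewrite inE//; exact: measurable_pfx.
rewrite P_pfx.
pose a := ((lam - dotR theta xi + enorm theta * del - sig * eps) * n%:R + sig * (2 * M * K%:R))%R.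
apply: (@le_trans _ _ (wsum n (fun s => (expR a)%:E * (pw s * (chi theta lam s *
   expR (sig * (F s - mu * n%:R)))%:E)))).
  apply: le_wsum => s sn; rewrite muleCA -EFinM lee_wpmul2l ?pw_ge0// lee_fin.
  have [/andP[nr ex]|_] := boolP (Q s); last by rewrite !mulr_ge0 ?expR_ge0// ltW// chi_gt0.
  rewrite /chi sn -!expRD -[leLHS]expR0 ler_expR /a.
  have := tilt_near n0 nr; rewrite ler_distl => /andP[h1 _].
  move: ex; rewrite -(ltr_pM2l sig0) => /ltW.
  move=> h2; exact: (exponent_ge0 lam h2 h1).
rewrite wsumZl; last first.
  by move=> s; rewrite mule_ge0 ?pw_ge0// lee_fin mulr_ge0 ?expR_ge0// ltW// chi_gt0.
apply: (@le_trans _ _ ((expR a)%:E * (`|C| * n.+1%:R * expR (sig * eps / 2 * n%:R))%:E)).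
  rewrite lee_wpmul2l ?lee_fin ?expR_ge0//; apply: (le_trans (hC n)).
  by rewrite lee_fin !ler_wpM2r ?expR_ge0// ler_norm.
rewrite -EFinM lee_fin le_eqVlt; apply/orP; left; apply/eqP.
rewrite mulrCA -expRD exponent_half expRD.
by rewrite -!mulrA; congr (_ * _)%R; rewrite mulrCA.
Qed.

(** The change of measure read backwards: near [xi] the tilted mass is at least half of
    [mgf theta n], and the tilt there is at most [e^(n (<theta,xi> + |theta| del))]. *)
Lemma near_lower del kap : (0 < del)%R -> (0 < kap)%R ->
  exists N, forall n, (N <= n)%N ->
    (expR ((lam - kap - dotR theta xi - enorm theta * del) * n%:R) / 2)%:E <=
    P (near_event del n).
Proof.
move=> del0 kap0.
have [N1 h1] := tilted_law_tight thetaC grad del0.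
have [N2 h2] := mgf_eventually thetaC kap0.
exists (maxn N1 N2).+1 => n; rewrite gtn_max => /andP[n1 n2].
have n0 : (0 < n)%N by exact: leq_trans n1.
have {}h1 := h1 n (ltnW n1); have /andP[{}h2 _] := h2 n (ltnW n2).
rewrite near_eventE P_pfx.
pose a := ((- dotR theta xi - enorm theta * del) * n%:R)%R.
apply: (@le_trans _ _ (wsum n (fun s => (expR a)%:E * (pw s * (expR (dotR theta (X s)) *
    (near_xi del n s)%:R)%:E)))); last first.
  apply: le_wsum => s sn; rewrite muleCA -EFinM lee_wpmul2l ?pw_ge0// lee_fin.
  have [nr|_] := boolP (near_xi del n s); last by rewrite !mulr0.
  rewrite !mulr1 -expRD -[leRHS]expR0 ler_expR /a.
  have := tilt_near n0 nr; rewrite ler_distl => /andP[_].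
  exact: exponent_le0.
rewrite wsumZl; last by move=> s; rewrite mule_ge0 ?pw_ge0// lee_fin mulr_ge0 ?expR_ge0.
apply: (@le_trans _ _ ((expR a)%:E * (mgf theta n / 2)%:E)); last first.
  by rewrite lee_wpmul2l// lee_fin expR_ge0.
rewrite -EFinM lee_fin mulrA ler_wpM2r// (le_trans _ (ler_wpM2l (expR_ge0 _) h2))//.
rewrite -expRD ler_expR /a -mulrDl ler_wpM2r//.
by rewrite [leRHS]addrC addrA.
Qed.

Lemma deviation_le_excess f eps n (E : set T) :
  [set w | eps < `|nu_int Zs f n w - mu_int P Zs u theta f K.+1|]%R `&` E =
  [set w | eps < nu_int Zs f n w - mu_int P Zs u theta f K.+1]%R `&` E `|`
  [set w | eps < - nu_int Zs f n w + mu_int P Zs u theta f K.+1]%R `&` E.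
Proof.
rewrite -setIUl; congr (_ `&` _); apply/seteqP; split => w /=.
  by rewrite lter_normr opprB addrC => /orP[|]; [left|right; rewrite addrC].
by rewrite lter_normr => -[->//|]; rewrite opprB addrC => ->; rewrite orbT.
Qed.

Lemma deviation_decay f eps : (forall z, `|f z| <= M)%R ->
  (forall x y : nat -> dir d, (forall k, (k < K)%N -> x k = y k) -> f x = f y) ->
  (0 < eps)%R ->
  exists b del0 : R, [/\ 0 < b, 0 < del0 & forall del, 0 < del < del0 ->
    exists N, forall n, (N <= n)%N ->
      fine (P ([set w | eps < `|nu_int Zs f n w - mu_int P Zs u theta f K.+1|]%R `&`
        near_event del n)) / fine (P (near_event del n)) <= expR (- b * n%:R)]%R.
Proof.
move=> fM fK eps0.
have fM' z : (`|- f z| <= M)%R by rewrite normrN.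
have fK' x y : (forall k, (k < K)%N -> x k = y k) -> (- f x = - f y)%R.
  by move=> h; rewrite (fK x y h).
have M0 : (0 <= M)%R by apply: le_trans (fM (fun=> z0)).
have muN := mu_intN thetaC z0 M0 fM fK.
have [s1 [C1 [s10 C10 h1]]] := excess_upper fM fK eps0.
have [s2 [C2 [s20 C20 h2]]] := excess_upper fM' fK' eps0.
have [B [B0 B1 B2]] : exists B : R, [/\ 0 < B, B <= s1 * eps / 2 & B <= s2 * eps / 2]%R.
  exists (Num.min (s1 * eps / 2) (s2 * eps / 2))%R; split.
  - by rewrite lt_min !divr_gt0// mulr_gt0.
  - by rewrite ge_min lexx.
  - by rewrite ge_min lexx orbT.
have B8 : (0 < B / 8)%R by rewrite divr_gt0.
have tt : (0 < 16 * (enorm theta + 1))%R by rewrite mulr_gt0// ltr_wpDl ?enorm_ge0.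
(* The common part [lam - <theta,xi>] of the exponents cancels in the quotient. Of the rate [B] four
   shares of [B / 8] are spent: on [2 |theta| del], which fixes the range of [del], on the lower
   bound of the denominator, on the linear factor and on the constants. *)
exists (B / 2)%R, (B / (16 * (enorm theta + 1)))%R; split; rewrite ?divr_gt0//.
move=> del /andP[del0 dlt].
have tdel : (2 * (enorm theta * del) <= B / 8)%R.
  move: dlt; rewrite ltr_pdivlMr// => dlt.
  have : (0 <= enorm theta * del)%R by rewrite mulr_ge0 ?enorm_ge0// ltW.
  rewrite ler_pdivlMr//; move: (enorm theta) dlt => e dlt _.
  have -> : (2 * (e * del) * 8 = del * (16 * e))%R by ring.
  by rewrite (le_trans _ (ltW dlt))// ler_pM2l// ler_pM2l// lerDl.
have [D D0 hD] := linear_le_expR B8.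
have CD0 : (0 <= (C1 + C2) * D)%R by rewrite mulr_ge0 ?addr_ge0// ltW.
have eta0 : (0 < (2 * ((C1 + C2) * D) + 1)^-1)%R by rewrite invr_gt0 ltr_wpDl// mulr_ge0.
have [N1 hN1] := expR_decay B8 eta0.
have [N2 hN2] := near_lower del0 B8.
exists (maxn N1 N2).+1 => n; rewrite gtn_max => /andP[/ltnW n1 n2].
have n0 : (0 < n)%N by exact: leq_ltn_trans n2.
have {}hN1 := hN1 n n1; have {}hN2 := hN2 n (ltnW n2).
have {}h1 := h1 del n n0; have {}h2 := h2 del n n0.
set N := near_event del n in h1 h2 hN2 *.
set E1 := expR ((lam - dotR theta xi + enorm theta * del - B) * n%:R)%R.
set E2 := expR ((lam - B / 8 - dotR theta xi - enorm theta * del) * n%:R)%R in hN2.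
have le1 (sig C : R) (A : set T) : (0 <= C)%R -> (B <= sig * eps / 2)%R ->
    P A <= (C * n.+1%:R * expR ((lam - dotR theta xi + enorm theta * del - sig * eps / 2) * n%:R))%:E ->
    P A <= (C * n.+1%:R * E1)%:E.
  move=> C0 Bs /le_trans; apply; rewrite lee_fin ler_wpM2l ?mulr_ge0//.
  by rewrite ler_expR ler_wpM2r// lerD2l lerN2.
have mA1 : measurable (excess f eps n `&` N).
  by apply: measurableI; [exact: measurable_excess|exact: measurable_near].
have mA2 : measurable (excess (fun z => - f z)%R eps n `&` N).
  by apply: measurableI; [exact: measurable_excess|exact: measurable_near].
have A2E : excess (fun z => - f z)%R eps n =
    [set w | eps < - nu_int Zs f n w + mu_int P Zs u theta f K.+1]%R.
  by apply/seteqP; split => w; rewrite /excess /= muN opprK nu_intN.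
rewrite deviation_le_excess -A2E -/(excess f eps n).
set A := _ `|` _; have mA : measurable A by exact: measurableU.
have PA : P A <= ((C1 + C2) * n.+1%:R * E1)%:E.
  apply: le_trans (measureU2 _ _ _) _ => //.
  by rewrite 2!mulrDl EFinD leeD//; [exact: le1 B1 h1|exact: le1 B2 h2].
have PAf : (fine (P A) <= (C1 + C2) * n.+1%:R * E1)%R.
  by rewrite -lee_fin fineK// fin_num_measure.
have PNf : (E2 / 2 <= fine (P N))%R.
  by rewrite -lee_fin fineK// fin_num_measure//; exact: measurable_near.
have PN0 : (0 < fine (P N))%R by apply: lt_le_trans PNf; rewrite divr_gt0// expR_gt0.
rewrite ler_pdivrMr//; apply: (le_trans PAf).
apply: (@le_trans _ _ (expR (- (B / 2) * n%:R) * (E2 / 2)))%R; last first.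
  by rewrite ler_wpM2l// expR_ge0.
apply: (@le_trans _ _ ((C1 + C2) * D * expR (B / 8 * n%:R) * E1))%R.
  by rewrite ler_wpM2r ?expR_ge0// -mulrA ler_wpM2l ?addr_ge0.
have CDle : ((C1 + C2) * D <= expR (B / 8 * n%:R) / 2)%R.
  rewrite ler_pdivlMr// mulrC; move: hN1; rewrite expRN lef_pV2 ?posrE ?expR_gt0//; last first.
    by rewrite -invr_gt0.
  by apply: le_trans; rewrite lerDl.
apply: (@le_trans _ _ (expR (B / 8 * n%:R) / 2 * expR (B / 8 * n%:R) * E1))%R.
  by rewrite !ler_wpM2r ?expR_ge0.
rewrite (_ : expR _ / 2 * _ * _ = expR (B / 8 * n%:R) * expR (B / 8 * n%:R) * E1 / 2)%R; last by ring.
rewrite mulrA ler_wpM2r// /E1 /E2.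
rewrite -!expRD ler_expR -!mulrDl ler_wpM2r//.
exact: (exponent_final _ _ tdel).
Qed.

End large_deviation.

End elliptic.
End random_walk.

Theorem theorem3p9
  (R : realType) (d : nat) (hd : (0 < d)%N)
  (dT : measure_display) (T : measurableType dT) (P : probability T R)
  (* environment: pi w x z = pi(x, x+z) in the environment of outcome w *)
  (pi : T -> site d -> dir d -> R)
  (* steps: Zs w i = Z_{i+1} = X_{i+1} - X_i, so X_n = walk Zs w n, X_0 = 0 *)
  (Zs : T -> nat -> dir d)
  (u : 'rV[R]_d) (c1 c : R) (xi theta : 'rV[R]_d)
  (K : nat) (f : (nat -> dir d) -> R) (eps : R)
  (* measurability *)
  (Hpi_meas : forall x z, measurable_fun setT (fun w => pi w x z))
  (HZ_meas : forall k z, measurable [set w | Zs w k = z])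
  (* environments are transition vectors *)
  (Henv : forall w x, (forall z, 0 <= pi w x z) /\ \sum_(z : dir d) pi w x z = 1)
  (* (A1): the law of the environment is an (i.i.d.) product measure *)
  (HA1 : forall (S : seq (site d)) (B : site d -> dir d -> set R),
     uniq S -> (forall x z, measurable (B x z)) ->
     P (envcyl pi S B) = (\prod_(x <- S) P (envcyl pi [:: (0 : site d)%R] (fun _ => B x)))%E)
  (* the averaged law P_0 = int P_0^omega dP(omega): joint law of (omega, X) *)
  (Hlaw : forall (S : seq (site d)) (B : site d -> dir d -> set R)
            (n : nat) (s : n.-tuple (dir d)),
     (forall x z, measurable (B x z)) ->
     (P (envcyl pi S B `&` [set w | forall i : 'I_n, Zs w i = tnth s i])
      = \int[P]_(w in envcyl pi S B) (qpath (pi w) s)%:E)%E)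
  (* (A2) uniform ellipticity *)
  (HA2 : 0 < c1 /\ forall z : dir d, P [set w | c1 <= pi w 0 z] = 1%E)
  (* (A3) Kalikow's condition relative to the unit vector u *)
  (Hu : enorm u = 1)
  (HA3 : Kalikow P pi Zs u)
  (* the constant c_3 (non-nestling) resp. c_4 (nestling) *)
  (Hc : (~ nestling P pi -> nonnest_const P Zs u c) /\
        (nestling P pi -> nest_const P Zs u c))
  (* xi in A, with theta the (unique) theta in C with xi = grad Lambda_a(theta) *)
  (Htheta : Cset P pi Zs c theta)
  (Hxi : is_grad (Lambda_a P Zs) theta xi)
  (* f bounded and depending only on (z_i)_{i <= K} *)
  (Hfb : exists M : R, forall s, `|f s| <= M)
  (HfK : forall s s' : nat -> dir d,
     (forall k, (k < K)%N -> s k = s' k) -> f s = f s')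
  (Heps : 0 < eps) :
  (limsup0 (fun delta : R =>
     limn_esup (fun n : nat =>
       (n%:R^-1)%:E *
       lne (condP P
         [set w | (eps < `|nu_int Zs f n w - mu_int P Zs u theta f K.+1|)%R]
         [set w | (enorm (n%:R^-1 *: toR R (walk Zs w n) - xi) <= delta)%R])))
   < 0)%E.
Proof.
have [M fM] := Hfb; have [c1_gt0 elliptic] := HA2.
(* Since [d > 0] there is a letter, the one that pads finite words. *)
have [b [del0 [b0 d0 h]]] := deviation_decay Hpi_meas HZ_meas Henv HA1 Hlaw c1_gt0 elliptic
  Hu Hc Htheta Hxi (Ordinal hd, true) fM HfK Heps.
apply: (@le_lt_trans _ _ (- b)%:E); last by rewrite lte_fin oppr_lt0.
exact: (limsup0_decay d0 h).
Qed.
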